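(* Let $n\in\mathbb N$ with $n\ge2$, and let $k\in\{1,\dots,n-1\}$ and $k/2\le\alpha<k$ be given. For every $R>0$ there exists a sequence of functions $\{f_N:N\in\mathbb N\}$ such that $$\|f_N\|_{\dot H^s(\mathbb R^n)}\eqsim N^s\ \text{ with } s\in\mathbb R,\qquad\text{and}\qquad \int_{SO(n)}\|(-\Delta)^{\alpha/2}I_\alpha f_N(\cdot,Q)\|_{L^2(B_R)}^2\,d\mu(Q)\gtrsim\mathfrak g(RN)$$ for all $N>\pi/(2R)$. The growth function $\mathfrak g$ is given by $\mathfrak g(t)=\log t$ if $\alpha=k/2$ and $\mathfrak g(t)=t^{2\alpha-k}$ if $\alpha>k/2$. The implicit constants are independent of $R$ and $N$.
   Context: $SO(n)$ is the group of real $n\times n$ matrices $Q$ with $Q^{\mathsf T}Q=\mathrm{id}$ and $\det Q=1$, $\mu$ is its normalized Haar measure, and $B_R=\{x\in\mathbb R^n:|x|<R\}$. The Fourier transform is $\widehat f(\xi)=(2\pi)^{-n/2}\int_{\mathbb R^n}e^{-i\xi\cdot x}f(x)\,dx$, and for $s\in\mathbb R$, $\|\phi\|_{\dot H^s(\mathbb R^n)}=\big(\int_{\mathbb R^n}|\xi|^{2s}|\widehat\phi(\xi)|^2\,d\xi\big)^{1/2}$. For positive quantities $a,b$, the notation $a\lesssim b$, or equivalently $b\gtrsim a$, means that there is a constant $C>0$ (the implicit constant) with $a\le Cb$; $a\eqsim b$ means $a\lesssim b$ and $b\lesssim a$. For $0<\alpha<k$, the $k$-vector-space Riesz potential $I_\alpha$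 is defined, for $f$ in the Schwartz class $\mathcal S(\mathbb R^n)$, by the formula $$I_\alpha f(x,Q)=\frac1{(2\pi)^{n/2}}\int_{\mathbb R^n}e^{ix\cdot\xi}\,\frac{\widehat f(\xi)}{|(Qe_1\cdot\xi)^2+\dots+(Qe_k\cdot\xi)^2|^{\alpha/2}}\,d\xi,\qquad(x,Q)\in\mathbb R^n\times SO(n),$$ where $\{e_1,\dots,e_n\}$ is the standard basis of $\mathbb R^n$. $(-\Delta)^{\alpha/2}$ denotes the fractional Laplacian in $\mathbb R^n$ (the Fourier multiplier with symbol $|\xi|^\alpha$), acting in the variable $x$. *)

(* Defs.v *)
From HB Require Import structures.
From mathcomp Require Import all_boot all_order all_algebra.
From mathcomp Require Import complex.
From mathcomp Require Import all_classical all_reals all_analysis.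

Set Implicit Arguments.
Unset Strict Implicit.
Unset Printing Implicit Defensive.

Import Order.TTheory GRing.Theory Num.Theory.
Import ComplexField.Normc.
Import numFieldNormedType.Exports.

Local Open Scope classical_set_scope.
Local Open Scope ring_scope.
Local Open Scope complex_scope.

(** Matrices carry the sigma-algebra generated by the coordinate functions. Over
    a [realType] it is the Borel sigma-algebra of ['M[R]_(m, n)]. *)

Definition matrix_display : measure_display -> measure_display.
Proof. exact. Qed.

Section measurable_matrix.
Context {d} {T : measurableType d}.
Variables m n : nat.

Definition coord_preimages : set (set 'M[T]_(m, n)) :=
  [set A | exists i j, exists2 B : set T,
     measurable B & A = (fun M : 'M[T]_(m, n) => M i j) @^-1` B].

Let mx_set0 : <<s coord_preimages >> set0.
Proof. exact: sigma_algebra0. Qed.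

Let mx_setC A : <<s coord_preimages >> A -> <<s coord_preimages >> (~` A).
Proof. exact: sigma_algebraC. Qed.

Let mx_bigcup (F : (set 'M[T]_(m, n))^nat) :
  (forall i, <<s coord_preimages >> (F i)) ->
  <<s coord_preimages >> (\bigcup_i (F i)).
Proof. exact: sigma_algebra_bigcup. Qed.

HB.instance Definition _ := @isMeasurable.Build (matrix_display d)
  'M[T]_(m, n) <<s coord_preimages >> mx_set0 mx_setC mx_bigcup.

Lemma measurable_coord (i : 'I_m) (j : 'I_n) :
  measurable_fun setT (fun M : 'M[T]_(m, n) => M i j).
Proof.
move=> _ B mB; rewrite setTI; apply: sub_sigma_algebra.
by exists i, j, B.
Qed.

Lemma measurable_fun_matrix d' (S : measurableType d') (f : S -> 'M[T]_(m, n)) :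
  (forall i j, measurable_fun setT (fun x => f x i j)) -> measurable_fun setT f.
Proof.
move=> mf; apply: (@measurability _ _ _ _ setT f coord_preimages) => //.
move=> _ [_ [i [j [B mB ->]]] <-].
exact: (mf i j measurableT B mB).
Qed.

End measurable_matrix.

Section lebesgue_Rn.
Context {R : realType}.

Definition vcons n (p : R * 'cV[R]_n) : 'cV[R]_n.+1 :=
  \col_i (if unlift ord0 i is Some j then p.2 j 0 else p.1).

Definition vtail n (v : 'cV[R]_n.+1) : 'cV[R]_n := \col_j v (lift ord0 j) 0.

Lemma measurable_vcons n : measurable_fun setT (@vcons n).
Proof.
apply: measurable_fun_matrix => i j.
rewrite (_ : (fun _ => _) = fun p : R * 'cV[R]_n =>
    if unlift ord0 i is Some k then p.2 k 0 else p.1); last first.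
  by apply/funext => p; rewrite mxE.
case: (unlift ord0 i) => [k|]; last exact: measurable_fst.
apply: (measurableT_comp (measurable_coord k 0)); exact: measurable_snd.
Qed.

Lemma measurable_vtail n : measurable_fun setT (@vtail n).
Proof.
apply: measurable_fun_matrix => i j.
rewrite (_ : (fun _ => _) = fun v : 'cV[R]_n.+1 => v (lift ord0 i) 0).
  exact: measurable_coord.
by apply/funext => v; rewrite mxE.
Qed.

Lemma vcons0 n (p : R * 'cV[R]_n) : vcons p ord0 0 = p.1.
Proof. by rewrite mxE unlift_none. Qed.

Lemma vconsK n (p : R * 'cV[R]_n) : vtail (vcons p) = p.2.
Proof. by apply/colP => j; rewrite !mxE liftK. Qed.

Section step.
Variables (n : nat) (m : {sigma_finite_measure set 'cV[R]_n -> \bar R}).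

Definition leb_step : set 'cV[R]_n.+1 -> \bar R :=
  pushforward (lebesgue_measure \x m)%E (@vcons n).

Let mstep : measurable_fun
  [set: (measurableTypeR R * 'cV[R]_n)%type] (@vcons n).
Proof. exact: measurable_vcons. Qed.

Let leb_step0 : leb_step set0 = 0%E.
Proof. by rewrite /leb_step /pushforward preimage_set0 measure0. Qed.

Let leb_step_ge0 A : (0 <= leb_step A)%E.
Proof. exact: measure_ge0. Qed.

Let leb_step_sigma_additive : semi_sigma_additive leb_step.
Proof.
move=> F mF tF mUF; rewrite /leb_step /pushforward preimage_bigcup.
apply: measure_semi_sigma_additive.
- by move=> i; rewrite -[X in measurable X]setTI; exact: mstep.
- apply/trivIsetP => /= i j _ _ ij; rewrite -preimage_setI.
  by move/trivIsetP : tF => /(_ _ _ _ _ ij) ->//; rewrite preimage_set0.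
- by rewrite -preimage_bigcup -[X in measurable X]setTI; exact: mstep.
Qed.

HB.instance Definition _ := isMeasure.Build _ _ _ leb_step
  leb_step0 leb_step_ge0 leb_step_sigma_additive.

Let leb_step_sigma_finite : sigma_finite setT leb_step.
Proof.
have /sigma_finiteP[F [FT Fnd Foo]] := sigma_finiteT (@lebesgue_measure R).
have /sigma_finiteP[G [GT Gnd Goo]] := sigma_finiteT m.
exists (fun i => [set v : 'cV[R]_n.+1 | F i (v ord0 0) /\ G i (vtail v)]).
  apply/seteqP; split => // v _.
  have [i _ Fi] : (\bigcup_i F i) (v ord0 0) by rewrite -FT.
  have [j _ Gj] : (\bigcup_j G j) (vtail v) by rewrite -GT.
  exists (maxn i j) => //=; split.
    by apply: (subsetPset _ _ (Fnd _ _ (leq_maxl i j))).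
  by apply: (subsetPset _ _ (Gnd _ _ (leq_maxr i j))).
move=> i; split.
  apply: measurableI; rewrite -[X in measurable X]setTI.
    by apply: (measurable_coord ord0 0) => //; exact: (Foo i).1.
  by apply: measurable_vtail => //; exact: (Goo i).1.
rewrite /leb_step /pushforward.
rewrite (_ : _ @^-1` _ = F i `*` G i); last first.
  apply/seteqP; split => p /=.
    by rewrite vcons0 vconsK.
  by rewrite vcons0 vconsK.
rewrite product_measure1E; [|exact: (Foo i).1|exact: (Goo i).1].
by rewrite lte_mul_pinfty// ?ge0_fin_numE//; [exact: (Foo i).2|exact: (Goo i).2].
Qed.

HB.instance Definition _ := @Measure_isSigmaFinite.Build _ _ _
  leb_step leb_step_sigma_finite.

End step.

(** Lebesgue measure on R^0 is the unit mass at the only point; on R^(n+1) it is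
    the product of the measure on R with the one on R^n, carried by [vcons]. *)
Fixpoint leb n : {sigma_finite_measure set 'cV[R]_n -> \bar R} :=
  match n with
  | 0 => @dirac _ 'cV[R]_0 0 R
  | n'.+1 => leb_step (leb n')
  end.

End lebesgue_Rn.

Section analysis_Rn.
Context {R : realType} {n : nat}.
Local Notation Rn := 'cV[R]_n.
Local Notation C := R[i].
Implicit Types (x xi : Rn) (f u m : Rn -> C).

Definition dot x xi : R := \sum_(i < n) x i 0 * xi i 0.

(** The norm [`|x|] of the library on matrices is the sup norm. *)
Definition enorm x : R := Num.sqrt (dot x x).

Definition eball (r : R) : set Rn := [set x | enorm x < r].

Definition basis_vec (j : 'I_n) : Rn := delta_mx j 0.

Definition cintegrable f : Prop :=
  (@leb R n).-integrable setT (EFin \o (fun x => complex.Re (f x))) /\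
  (@leb R n).-integrable setT (EFin \o (fun x => complex.Im (f x))).

Definition cintegral f : C :=
  (\int[@leb R n]_x complex.Re (f x)) +i* (\int[@leb R n]_x complex.Im (f x)).

Definition expi (t : R) : C := cos t +i* sin t.

Definition fourier_const : R := (2 * pi) `^ (- (n%:R / 2)).

Definition fourier f xi : C :=
  fourier_const%:C * cintegral (fun x => expi (- dot xi x) * f x).

Definition inv_fourier m x : C :=
  fourier_const%:C * cintegral (fun xi => expi (dot x xi) * m xi).

Definition partials (s : seq 'I_n) (g : Rn -> R) : Rn -> R :=
  foldr (fun i h x => 'D_(basis_vec i) h x) g s.

Definition schwartz_real (g : Rn -> R) : Prop :=
  forall s : seq 'I_n,
    [/\ continuous (partials s g),
        forall i x, derivable (partials s g) x (basis_vec i) &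
        forall N : nat, exists B : R, forall x,
          (1 + enorm x) ^+ N * `|partials s g x| <= B].

Definition schwartz f : Prop :=
  schwartz_real (fun x => complex.Re (f x)) /\ schwartz_real (fun x => complex.Im (f x)).

Definition L2norm (D : set Rn) u : \bar R :=
  ((\int[@leb R n]_(x in D) (normc (u x) ^+ 2)%:E) `^ (1 / 2))%E.

Definition sobolev_norm (s : R) f : \bar R :=
  ((\int[@leb R n]_xi (enorm xi `^ (2 * s) * normc (fourier f xi) ^+ 2)%:E)
    `^ (1 / 2))%E.

(** [riesz_potential k alpha f ^~ Q] is in general neither integrable nor square integrable, so
    its Fourier transform is not given by the integral [fourier]. It is the
    inverse transform of an integrable function, which is unique up to a null
    set; [spectrum u] is that function, i.e. the Fourier transform of [u] in the
    sense of tempered distributions. *)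

Definition is_spectrum u m : Prop :=
  cintegrable m /\ forall x, u x = inv_fourier m x.

Definition spectrum u : Rn -> C := xget (fun=> 0) [set m | is_spectrum u m].

Definition fourier_multiplier (sigma : Rn -> R) u : Rn -> C :=
  inv_fourier (fun xi => (sigma xi)%:C * spectrum u xi).

(** This is [(-Delta)^(alpha/2)], not [(-Delta)^alpha]. *)
Definition frac_laplacian (alpha : R) : (Rn -> C) -> Rn -> C :=
  fourier_multiplier (fun xi => enorm xi `^ alpha).

(** The vectors [e_1, ..., e_k] are those of index [j < k] (indices start at 0).
    On the null set where the denominator vanishes, division by 0 yields 0. *)
Definition riesz_potential (k : nat) (alpha : R) f x (Q : 'M[R]_n) : C :=
  fourier_const%:C * cintegral (fun xi =>
    expi (dot x xi) *
    (fourier f xi /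
     (`|\sum_(j < n | (j < k)%N) dot (Q *m basis_vec j) xi ^+ 2|
        `^ (alpha / 2))%:C)).

Definition SO : set 'M[R]_n := [set Q | Q^T *m Q = 1%:M /\ \det Q = 1].

(** The Haar measure is seen as a probability on all [n x n] matrices that is
    concentrated on [SO]. *)
Definition is_haar_SO (mu : probability 'M[R]_n R) : Prop :=
  mu SO = 1%E /\
  forall Q, SO Q -> forall A : set 'M[R]_n, measurable A ->
    mu ((fun P => Q *m P) @^-1` A) = mu A.

End analysis_Rn.

Definition growth {R : realType} (k : nat) (alpha t : R) : R :=
  if alpha == k%:R / 2 then ln t else t `^ (2 * alpha - k%:R).

(* Main.v *)
(* The Fourier transform of [f_N] is a product of n nonnegative smooth bumps of
   width 1 / (n r), centred at N e_1. On its support |xi| is comparable to N,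
   which gives the Sobolev norms, and for x in the ball B_r the phase
   x.(xi - N e_1) is at most 1, so that nothing cancels: up to a constant,
   |(-Delta)^(alpha/2) I_alpha f_N(x, Q)| is at least the integral of
   |xi|^alpha |P_Q xi|^(-alpha) times the transform of f_N, where P_Q projects
   onto the span of Q e_1, ..., Q e_k. With t = r N, the square of the L^2 norm on
   B_r is then at least c (t^2 / (t^2 |P_Q e_1|^2 + 1))^alpha.

   It remains to bound below the Haar measure of {Q : |P_Q e_1| <= n / m}. The k
   equations P_Q u = 0 have a solution u of sup norm 1 among the vectors
   supported on the first k + 1 coordinates; replacing u by a nearby point w of a
   grid, SO(n) is covered by (k + 1) (3 m)^k sets {Q : |P_Q w| <= n / m} with
   |w| >= 1, and by invariance none has a measure exceeding that of the set for
   w = e_1. Taking m comparable to t yields t^(2 alpha - k), and summing over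
   m = 2^j <= t yields log t when alpha = k / 2.

   As the fractional Laplacian is defined through [spectrum], one also needs that
   an integrable function is determined by its Fourier transform. *)

Require Import Defs.
From mathcomp Require Import all_boot all_order all_algebra.
From mathcomp Require Import complex.
From mathcomp Require Import all_classical all_reals all_analysis.
From mathcomp Require Import measurable_realfun ring lra.

Import Order.TTheory GRing.Theory Num.Theory.
Import numFieldNormedType.Exports.
Import ComplexField.Normc.

Set Implicit Arguments.
Unset Strict Implicit.
Unset Printing Implicit Defensive.

Local Open Scope classical_set_scope.
Local Open Scope ring_scope.
Local Open Scope complex_scope.

(** * Smooth bumps and their cosine transforms *)

(** The packets are prescribed on the frequency side, so one must know that the integral [fourier]
    really returns the prescribed bump. The product form serves this: exponentials, [leb] and
    Schwartz seminorms factor over coordinates, and inversion reduces to one compactly supported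
    function on the line, handled by Abel summation and the Poisson kernel. Off-centre bumps have
    complex transforms; only the first coordinate is off-centre, so real and imaginary parts of a
    packet remain tensor products.

    The scale [lam] is squeezed from both sides. Width 1 / [lam] must be at most 1 / (n r) for the
    phase to stay below 1 on the ball, and n / [lam] at most N for |xi| to be comparable to N. With
    [lam] = n r the second condition reads 1 <= r N, which N > pi / (2 r) provides since pi >= 2.
    Height sqrt [lam] per coordinate makes the L^2 norm of order 1; then all powers of r cancel
    (height, support, ball) and only t = r N survives, whence constants free of R and N.

    The symbol is singular on a subspace of codimension k. Integrability there, which needs alpha <
    k, is what makes [spectrum] well determined. *)

Section real_derivative.
Context {R : realType}.
Implicit Types (f g : R -> R) (x df dg : R).

Lemma is_derive1D f g x df dg : is_derive x (1:R) f df -> is_derive x (1:R) g dg ->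
  is_derive x (1:R) (fun y => f y + g y) (df + dg).
Proof. by move=> hf hg; exact: (is_deriveD hf hg). Qed.

Lemma is_derive1M f g x df dg : is_derive x (1:R) f df -> is_derive x (1:R) g dg ->
  is_derive x (1:R) (fun y => f y * g y) (df * g x + f x * dg).
Proof.
move=> hf hg; apply: (is_derive_eq (is_deriveM hf hg)).
by rewrite /GRing.scale/= addrC [g x * _]mulrC.
Qed.

Lemma is_derive1Z c f x df : is_derive x (1:R) f df ->
  is_derive x (1:R) (fun y => c * f y) (c * df).
Proof. by move=> hf; exact: (is_deriveZ c hf). Qed.

Lemma is_derive1_affine (c u x : R) : is_derive x (1:R) (fun y => c * y + u) c.
Proof. by apply: is_derive_eq; rewrite addr0 scaler1. Qed.

Lemma is_derive1_compose f g x df dg : is_derive (g x) (1:R) f df ->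
  is_derive x (1:R) g dg -> is_derive x (1:R) (fun y => f (g y)) (df * dg).
Proof. by move=> hf hg; exact: (@is_derive1_comp _ f g x _ _ hf hg). Qed.

End real_derivative.

Section smooth.
Context {R : realType}.
Implicit Types (f g : R -> R) (P : {poly R}).

(** Only the existence of m derivatives is recorded, not the continuity of the last one. In [smooth]
    all orders are required, so continuity of each derivative follows from the next order. *)
Fixpoint Ck (m : nat) f : Prop :=
  if m is m'.+1 then (forall x : R, derivable f x (1:R)) /\ Ck m' (derive1 f) else True.

Definition smooth f := forall m, Ck m f.

Lemma derive1_eq f g : (forall x : R, is_derive x (1:R) f (g x)) -> (derive1 f) = g.
Proof.
by move=> fg; apply/funext => x; rewrite derive1E; apply: derive_val.
Qed.

Lemma CkS m f : Ck m.+1 f -> Ck m f.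
Proof. by elim: m f => // m ih f [df /ih]. Qed.

Lemma Ck_is_derive m f g : (forall x : R, is_derive x (1:R) f (g x)) -> Ck m g ->
  Ck m.+1 f.
Proof. by move=> fg Cg; split=> [x|]; [exact: ex_derive|rewrite (derive1_eq fg)]. Qed.

Lemma smooth_is_derive f (x : R) : smooth f -> is_derive x (1:R) f ((derive1 f) x).
Proof. by move=> /(_ 1%N)[df _]; rewrite derive1E; exact: derivableP. Qed.

Lemma smooth_derive1 f : smooth f -> smooth (derive1 f).
Proof. by move=> sf m; case: (sf m.+1). Qed.

Lemma smooth_continuous f : smooth f -> continuous f.
Proof.
by move=> /(_ 1%N)[df _] x; apply/differentiable_continuous/derivable1_diffP.
Qed.

Lemma Ck_cst m (c : R) : Ck m (cst c).
Proof.
elim: m c => // m ih c; apply: (@Ck_is_derive _ _ (cst 0)) => //.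
Qed.

Lemma CkD m f g : Ck m f -> Ck m g -> Ck m (f \+ g).
Proof.
elim: m f g => // m ih f g [df Cf] [dg Cg].
apply: (@Ck_is_derive _ _ ((derive1 f) \+ (derive1 g))); last exact: ih.
by move=> x; rewrite /= !derive1E; apply: is_deriveD; exact: derivableP.
Qed.

Lemma CkM m f g : Ck m f -> Ck m g -> Ck m (f \* g).
Proof.
elim: m f g => // m ih f g Cf Cg.
have [df Cdf] := Cf; have [dg Cdg] := Cg.
apply: (@Ck_is_derive _ _ (f \* (derive1 g) \+ g \* (derive1 f))); last first.
  by apply: CkD; apply: ih => //; exact: CkS.
move=> x; rewrite /= !derive1E; apply: is_deriveM; exact: derivableP.
Qed.

Lemma Ck_id m : Ck m id.
Proof.
case: m => // m; apply: (@Ck_is_derive _ _ (cst 1)); exact: Ck_cst.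
Qed.

Lemma Ck_affine m f (a b : R) : Ck m f -> Ck m (fun x => f (a * x + b)).
Proof.
elim: m f => // m ih f [df Cf].
apply: (@Ck_is_derive _ _ (fun x => (derive1 f) (a * x + b) * a)); last first.
  by apply: (CkM (ih _ Cf)); exact: Ck_cst.
move=> x; apply: (@is_derive1_comp _ f (fun x => a * x + b)).
  by rewrite derive1E; exact: derivableP.
by apply: is_derive_eq; rewrite scaler1 addr0.
Qed.

(** One term of the exponential series gives y^n <= n! e^y. The estimate is used for the flatness of
    [flat] at 0, for the error of the Abel summation and for the step polynomials. *)
Lemma polyexp_bounded P : exists2 C : R, 0 <= C &
  forall y, 0 <= y -> `|P.[y]| * expR (- y) <= C.
Proof.
have xn n (y : R) : 0 <= y -> y ^+ n * expR (- y) <= n`!%:R.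
  move=> y0; rewrite expRN ler_pdivrMr ?expR_gt0//.
  case: n => [|n]; first by rewrite expr0 fact0 mul1r -expR0 ler_expR.
  have := expR_ge1Dxn n y0; rewrite -lerBrDl => h.
  have f0 : (0 : R) < n.+1`!%:R by rewrite ltr0n fact_gt0.
  rewrite -ler_pdivrMl// mulrC (le_trans h)// lerBlDr lerDl//.
exists (\sum_(i < size P) `|P`_i| * i`!%:R).
  by apply: sumr_ge0 => i _; rewrite mulr_ge0.
move=> y y0; rewrite horner_coef.
rewrite (le_trans (ler_wpM2r (expR_ge0 _) (ler_norm_sum _ _ _)))//.
rewrite mulr_suml; apply: ler_sum => i _.
rewrite normrM -mulrA ler_wpM2l// normrX (ger0_norm y0); exact: xn.
Qed.

(** [flat 1] is the classical e^(-1/x) extended by 0. The polynomial factor makes the family stable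
    under differentiation, P becoming X^2 (P - P'), so smoothness is an induction on the order over
    all P at once. *)
Definition flat P (x : R) := if 0 < x then P.[x^-1] * expR (- x^-1) else 0.

Lemma flat_le P : exists2 C : R, 0 <= C & forall x, `|flat P x| <= C * x ^+ 2.
Proof.
have [C C0 PC] := polyexp_bounded ('X^2 * P).
exists C => // x; rewrite /flat; case: ifPn => x0; last first.
  by rewrite normr0 mulr_ge0// sqr_ge0.
have y0 : 0 <= x^-1 by rewrite invr_ge0 ltW.
have := PC _ y0; rewrite hornerM hornerXn normrM (ger0_norm (exprn_ge0 _ y0)).
rewrite exprVn -mulrA ler_pdivrMl ?exprn_gt0// normrM.
by rewrite (ger0_norm (expR_ge0 _)) mulrC [leRHS]mulrC.
Qed.

Lemma is_derive_flat P (x : R) :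
  is_derive x 1 (flat P) (flat ('X^2 * (P - P^`())) x).
Proof.
have [x0|x0|<-] := ltgtP 0 x.
- have e : {near x, (fun y => P.[y^-1] * expR (- y^-1)) =1 flat P}.
    by apply: filterS (lt_nbhsr x0) => y y0; rewrite /flat y0.
  have xn0 : x != 0 by rewrite gt_eqF.
  apply: near_eq_is_derive e _.
  have dV : is_derive x 1 (fun y : R => y^-1) (- x ^- 2).
    have := is_deriveV xn0 (is_derive_id x (1:R)).
    by rewrite /GRing.scale/= mulr1.
  have d1 : is_derive x 1 (fun y : R => P.[y^-1]) (P^`().[x^-1] * - x ^- 2).
    exact: (@is_derive1_comp _ (fun y => P.[y]) (fun y : R => y^-1) x _ _ (is_derive_poly P _) dV).
  have d2 : is_derive x 1 (fun y : R => expR (- y^-1)) (expR (- x^-1) * (x ^- 2)).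
    have d3 : is_derive x (1:R) (fun y : R => - y^-1) (x ^- 2).
      by rewrite -[x ^- 2]opprK; exact: is_deriveN.
    exact: (@is_derive1_comp _ expR (fun y : R => - y^-1) x _ _ (is_derive_expR _) d3).
  apply: is_derive_eq; rewrite /flat x0 !hornerE /= /GRing.scale/= exprVn; ring.
- have e : {near x, (cst 0 : R -> R) =1 flat P}.
    apply: filterS (lt_nbhsl x0) => y y0.
    by rewrite /flat ltNge ltW.
  apply: near_eq_is_derive e _.
  rewrite /flat ltNge ltW//=; exact: is_derive_cst.
(* At the origin the derivative is 0, because the quadratic bound [flat_le] leaves a difference
   quotient of size at most C |h|. *)
- have [C C0 PC] := flat_le P.
  rewrite {2}/flat ltxx.
  have cv : h^-1 *: ((flat P \o shift 0) (h *: (1:R)) - flat P 0) @[h --> 0^'] --> (0:R).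
    apply: norm_cvg0; apply: (@squeeze_cvgr _ _ _ _ (cst 0) (fun h : R => C * `|h|)).
    - near=> h; rewrite normr_ge0/= normrZ normfV ler_pdivrMl ?normr_gt0; last first.
        by near: h; exact: nbhs_dnbhs_neq.
      rewrite {2}/flat ltxx subr0 /= scaler1 addr0 (le_trans (PC _))//.
      by rewrite [leRHS]mulrCA -expr2 real_normK// num_real.
    - exact: cvg_cst.
    - rewrite -[X in _ --> X](mulr0 C); apply: cvgM; first exact: cvg_cst.
      rewrite -[X in _ --> X](@normr0 R R); apply: cvg_norm; exact: cvg_within.
  apply: DeriveDef; first by apply/cvg_ex; exists 0.
  exact: cvg_lim.
Unshelve. all: by end_near. Qed.

Lemma Ck_flat m P : Ck m (flat P).
Proof.
elim: m P => // m ih P.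
exact: (Ck_is_derive (is_derive_flat P)).
Qed.

Definition bump (x : R) := flat 1 (1 + x) * flat 1 (1 - x).

Lemma smooth_bump : smooth bump.
Proof.
move=> m.
have -> : bump = (fun x => flat 1 (1 * x + 1)) \* (fun x => flat 1 ((-1) * x + 1)).
  by apply/funext => x; rewrite /bump /= mul1r mulN1r [1 + x]addrC [1 - x]addrC.
by apply: CkM; apply: Ck_affine; exact: Ck_flat.
Qed.

Lemma bumpN x : bump (- x) = bump x.
Proof. by rewrite /bump opprK mulrC. Qed.

Lemma flat1_01 x : 0 <= flat 1 x <= 1.
Proof.
rewrite /flat; case: ifP => x0; last by rewrite lexx ler01.
by rewrite hornerC mul1r expR_ge0 expR_le1 oppr_le0 invr_ge0 ltW.
Qed.

Lemma bump_ge0 x : 0 <= bump x.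
Proof. by rewrite mulr_ge0//; have /andP[] := flat1_01 (1 + x); have /andP[] := flat1_01 (1 - x). Qed.

Lemma bump_le1 x : bump x <= 1.
Proof.
have /andP[? ?] := flat1_01 (1 + x); have /andP[? ?] := flat1_01 (1 - x).
by rewrite mulr_ile1.
Qed.

Lemma bump_out x : 1 <= `|x| -> bump x = 0.
Proof.
rewrite /bump /flat ler_normr => /orP[x1|x1].
  by rewrite [X in _ * X]ifF ?mulr0//; apply/negbTE; rewrite -leNgt subr_le0.
by rewrite ifF ?mul0r//; apply/negbTE; rewrite -leNgt -(opprK x) subr_le0.
Qed.

(** Both factors are [flat 1] at points at least 1/2, where e^(-1/y) >= e^(-2). This is the origin
    of the powers of e^(-4) and e^(-8) in the later constants. *)
Lemma bump_ge x : `|x| <= 2^-1 -> expR (- 4) <= bump x.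
Proof.
rewrite ler_norml => /andP[xl xr].
have F (y : R) : 2^-1 <= y -> expR (- 2) <= flat 1 y.
  move=> y2; have y0 : 0 < y by apply: lt_le_trans y2; rewrite invr_gt0.
  rewrite /flat y0 hornerC mul1r ler_expR lerN2 -[leRHS]invrK lef_pV2//.
  by rewrite posrE invr_gt0.
have -> : - 4 = - 2 - 2 :> R by lra.
rewrite expRD; apply: ler_pM; rewrite ?expR_ge0//; apply: F; lra.
Qed.

End smooth.

Section trig_transform.
Context {R : realType}.
Local Notation mu := (@lebesgue_measure R).
Implicit Types (b g : R -> R) (L t x : R).

Definition test_fun L b := smooth b /\ forall x, L < `|x| -> b x = 0.

Lemma test_fun_derive1 L b : test_fun L b -> test_fun L (derive1 b).
Proof.
move=> [sb b0]; split; first exact: smooth_derive1.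
move=> x Lx; rewrite derive1E.
suff h : is_derive x (1:R) b 0 by exact: derive_val.
have e : {near x, (cst 0 : R -> R) =1 b}.
  have : \forall y \near x, L < `|y|.
    exact: (cvgr_gt _ (@norm_continuous _ R x)) Lx.
  by apply: filterS => y /b0.
by apply: near_eq_is_derive e _; exact: is_derive_cst.
Qed.

Lemma test_funM_id L b : test_fun L b -> test_fun L (fun x => x * b x).
Proof.
move=> [sb b0]; split => [m|x /b0->]; last by rewrite mulr0.
exact: (CkM (Ck_id m) (sb m)).
Qed.

Lemma test_fun_itvE L M b g : test_fun L b -> L <= M ->
  (fun x => b x * g x) = (fun x => b x * g x) \_ `[- M, M].
Proof.
move=> [_ b0] LM; apply/funext => x; rewrite patchE; case: ifPn => //.
rewrite notin_setE/= in_itv/= => /negP; rewrite -ler_norml -ltNge => Mx.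
by rewrite b0 ?mul0r//; exact: le_lt_trans Mx.
Qed.

Lemma integral_test_fun L M b g : test_fun L b -> L <= M ->
  \int[mu]_x (b x * g x) = \int[mu]_(x in `[- M, M]) (b x * g x).
Proof.
by move=> tb LM; rewrite [RHS]Rintegral_mkcond -(test_fun_itvE _ tb LM).
Qed.

Lemma integrable_seg M g : continuous g ->
  mu.-integrable `[- M, M] (EFin \o g).
Proof.
move=> cg; apply: continuous_compact_integrable; first exact: segment_compact.
exact: continuous_subspaceT.
Qed.

Lemma integrable_test_fun L b g : test_fun L b -> continuous g ->
  mu.-integrable setT (EFin \o (fun x => b x * g x)).
Proof.
move=> tb cg; rewrite (test_fun_itvE _ tb (lexx L)) -restrict_EFin.
apply/integrable_restrict => //=; rewrite setTI.
apply: integrable_seg => x; apply: cvgM; last exact: cg.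
exact: (smooth_continuous tb.1).
Qed.

Lemma test_fun_bounded L b : test_fun L b -> exists K, forall x, `|b x| <= K.
Proof.
move=> [sb b0].
have L0 : - `|L| <= `|L| by rewrite (le_trans _ (normr_ge0 L))// oppr_le0.
have [c _ cP] : exists2 c, c \in `[- `|L|, `|L|] &
    forall t, t \in `[- `|L|, `|L|] -> `|b t| <= `|b c|.
  apply: EVT_max => //; apply: continuous_subspaceT => x.
  by apply: cvg_norm; exact: (smooth_continuous sb).
exists `|b c| => x; have [xL|Lx] := leP `|x| `|L|.
  by apply: cP; rewrite in_itv/= -ler_norml.
by rewrite b0 ?normr0//; apply: le_lt_trans Lx; exact: ler_norm.
Qed.

(** The free phase t treats cosine and sine transforms together. Differentiating in x shifts t by pi
    / 2 and multiplies b by y; integrating by parts shifts t by - pi / 2 and differentiates b. The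
    family is thus closed under both operations. *)
Definition trig t b x := \int[mu]_y (b y * cos (x * y + t)).

Lemma continuous_cos_affine (x t : R) : continuous (fun y : R => cos (x * y + t)).
Proof.
move=> y; apply: continuous_comp; last exact: continuous_cos.
by apply: cvgD; [apply: cvgM; [exact: cvg_cst|exact: cvg_id]|exact: cvg_cst].
Qed.

Lemma trig_bounded L b t : test_fun L b -> exists K, forall x, `|trig t b x| <= K.
Proof.
move=> tb; exists (\int[mu]_y `|b y * 1|) => x.
have cb := integrable_test_fun tb (@continuous_cos_affine x t).
rewrite (le_trans (le_normr_Rintegral _ cb))// le_Rintegral//.
- exact: (integrable_norm cb).
- have c1 : continuous (cst 1 : R -> R) by move=> y; exact: cvg_cst.
  exact: (integrable_norm (integrable_test_fun tb c1)).
- by move=> y _; rewrite !normrM normr1 ler_wpM2l// cos_max.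
Qed.

Lemma is_derive_trig L b t x : test_fun L b ->
  is_derive x (1:R) (trig t b) (trig (t + pi / 2) (fun y => y * b y) x).
Proof.
move=> tb.
pose f x y := b y * cos (x * y + t).
have df (z y : R) : is_derive z (1:R) (f ^~ y) (b y * (- sin (z * y + t) * y)).
  have d1 : is_derive z (1:R) (fun z : R => z * y + t) y.
    by apply: is_derive_eq; rewrite addr0 scaler0 add0r /GRing.scale/= mulr1.
  have d2 : is_derive z (1:R) (fun z : R => cos (z * y + t)) (- sin (z * y + t) * y).
    exact: (@is_derive1_comp _ cos (fun z => z * y + t) z _ _ (is_derive_cos _) d1).
  exact: (is_deriveZ (b y) d2).
have p1 z y : partial1of2 f z y = y * b y * cos (z * y + (t + pi / 2)).
  rewrite /partial1of2 (derive1_eq (fun z => df z y)) addrA cosDpihalf; ring.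
have [K bK] := test_fun_bounded tb.
have tyb := test_funM_id tb.
have := @cvg_differentiation_under_integral R _ _ mu f setT measurableT x
  (x - 1) (x + 1) _ _ _ (fun y => `|y * b y * 1|) _ _ _.
move=> H; have {}H := H _ _ _ _ _ _.
suff cv : h^-1 *: ((trig t b \o shift x) (h *: (1:R)) - trig t b x) @[h --> 0^'] -->
    trig (t + pi / 2) (fun y => y * b y) x.
  apply: DeriveDef; first by apply/cvg_ex; eexists; exact: cv.
  exact: cvg_lim cv.
under eq_fun do rewrite /= scaler1.
rewrite (_ : trig _ _ x = \int[mu]_y partial1of2 f x y); last first.
  by apply: eq_Rintegral => y _; rewrite p1.
apply: H.
- by rewrite /= in_itv/= ltrBlDr ltrDl ltr01.
- by move=> z _; exact: (integrable_test_fun tb (@continuous_cos_affine z t)).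
- by move=> z y _ _; exact: ex_derive.
- by [].
- have c1 : continuous (cst 1 : R -> R) by move=> y; exact: cvg_cst.
  exact: (integrable_norm (integrable_test_fun tyb c1)).
- move=> z y _ _; rewrite p1 !normrM normr1 ler_wpM2l//.
  exact: cos_max.
Qed.

Lemma FTC_seg (F f : R -> R) (u v : R) : u <= v -> continuous f ->
  (forall x : R, is_derive x (1:R) F (f x)) ->
  \int[mu]_(x in `[u, v]) f x = F v - F u.
Proof.
move=> + cf dF; rewrite le_eqVlt => /predU1P[<-|uv].
  by rewrite set_itv1 Rintegral_set1 subrr.
have cF : continuous F.
  by move=> x; apply/differentiable_continuous/derivable1_diffP; exact: ex_derive.
rewrite /Rintegral (@continuous_FTC2 _ _ F)//.
- exact: continuous_subspaceT.
- split => [x _||].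
  + exact: ex_derive.
  + by apply: cvg_at_right_filter; exact: cF.
  + by apply: cvg_at_left_filter; exact: cF.
- by move=> x _; rewrite derive1E; exact: derive_val.
Qed.

Lemma mul_trig L b t x : test_fun L b ->
  x * trig t b x = - trig (t - pi / 2) (derive1 b) x.
Proof.
(* [M] exceeds |L| strictly: [test_fun] says nothing about b at L itself, and the boundary terms at
   M and - M must vanish. *)
move=> tb; pose M : R := `|L| + 1.
have LM : L < M by rewrite (le_lt_trans (ler_norm _))// ltrDl.
have M0 : 0 < M by rewrite ltr_wpDl.
have bM : b M = 0 by apply: tb.2; rewrite gtr0_norm.
have bNM : b (- M) = 0 by apply: tb.2; rewrite normrN gtr0_norm.
have tb' := test_fun_derive1 tb.
rewrite /trig (integral_test_fun _ tb (ltW LM)) (integral_test_fun _ tb' (ltW LM)).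
have cb := smooth_continuous tb.1; have cb' := smooth_continuous tb'.1.
have c1 : continuous (fun y => b y * cos (x * y + t)).
  by move=> y; apply: cvgM; [exact: cb|exact: continuous_cos_affine].
have c2 : continuous (fun y => derive1 b y * cos (x * y + (t - pi / 2))).
  by move=> y; apply: cvgM; [exact: cb'|exact: continuous_cos_affine].
have c3 : continuous (fun y => x * (b y * cos (x * y + t))).
  by move=> y; apply: cvgM; [exact: cvg_cst|exact: c1].
rewrite -RintegralZl//; last exact: integrable_seg.
apply/eqP; rewrite -subr_eq0 opprK -RintegralD//; [|exact: integrable_seg..].
have dF (y : R) : is_derive y (1:R) (fun y => b y * cos (x * y + (t - pi / 2)))
    (x * (b y * cos (x * y + t)) + derive1 b y * cos (x * y + (t - pi / 2))).
  have d1 := smooth_is_derive y tb.1.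
  have d3 : is_derive y (1:R) (fun z : R => x * z + (t - pi / 2)) x.
    by apply: is_derive_eq; rewrite addr0 scaler1.
  have d2 : is_derive y (1:R) (fun y : R => cos (x * y + (t - pi / 2)))
      (- sin (x * y + (t - pi / 2)) * x).
    exact: (@is_derive1_comp _ cos (fun z => x * z + (t - pi / 2)) y _ _ (is_derive_cos _) d3).
  apply: (is_derive_eq (is_deriveM d1 d2)).
  by rewrite addrA sinBpihalf /GRing.scale/=; ring.
have NM : - M <= M by rewrite (le_trans _ (ltW M0))// oppr_le0 ltW.
rewrite (FTC_seg NM _ dF) ?bM ?bNM ?mul0r ?subrr// => y.
by apply: cvgD; [exact: c3|exact: c2].
Qed.

(** Each factor 1 + |x| is paid for by one integration by parts ([mul_trig]). *)
Lemma trig_decay L b t (N : nat) : test_fun L b ->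
  exists B, forall x, (1 + `|x|) ^+ N * `|trig t b x| <= B.
Proof.
elim: N b t => [|N ih] b t tb.
  have [K bK] := trig_bounded t tb; exists K => x.
  by rewrite expr0 mul1r.
have [B1 h1] := ih _ t tb.
have [B2 h2] := ih _ (t - pi / 2) (test_fun_derive1 tb).
exists (B1 + B2) => x; rewrite exprSr -mulrA mulrDl mul1r mulrDr lerD//.
by rewrite -normrM (mul_trig t x tb) normrN.
Qed.

End trig_transform.

(** * Tensor products and Fubini *)

Section product_integral.
Context {R : realType} d1 d2 {T1 : measurableType d1} {T2 : measurableType d2}.
Variables (m1 : {sigma_finite_measure set T1 -> \bar R})
          (m2 : {sigma_finite_measure set T2 -> \bar R}).
Implicit Types (u : T1 -> R) (v : T2 -> R).

Lemma integrable_tensor u v :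
  m1.-integrable setT (EFin \o u) -> m2.-integrable setT (EFin \o v) ->
  (m1 \x m2)%E.-integrable setT (EFin \o (fun z => u z.1 * v z.2)).
Proof.
move=> iu iv.
have mu : measurable_fun setT u by apply/measurable_EFinP; exact: (measurable_int m1 iu).
have mv : measurable_fun setT v by apply/measurable_EFinP; exact: (measurable_int m2 iv).
apply/integrable12ltyP.
  apply/measurable_EFinP; apply: measurable_funM.
    exact: (measurableT_comp mu measurable_fst).
  exact: (measurableT_comp mv measurable_snd).
under eq_integral => x _.
  under eq_integral => y _ do rewrite /= normrM EFinM.
  rewrite ge0_integralZl//; last first.
    by apply/measurable_EFinP; exact: measurableT_comp.
  over.
rewrite /=.
have /integrableP[_ ivoo] := iv; have /integrableP[_ iuoo] := iu.
rewrite ge0_integralZr//.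
- by rewrite lte_mul_pinfty// ?integral_ge0// ge0_fin_numE// integral_ge0.
- by apply/measurable_EFinP; exact: measurableT_comp.
- exact: integral_ge0.
Qed.

Lemma integral_tensor u v :
  m1.-integrable setT (EFin \o u) -> m2.-integrable setT (EFin \o v) ->
  \int[(m1 \x m2)%E]_z (u z.1 * v z.2) = \int[m1]_x u x * \int[m2]_y v y.
Proof.
move=> iu iv; rewrite {1}/Rintegral.
have := integral12_prod_meas1 (integrable_tensor iu iv).
rewrite /= => <-.
rewrite /fubini_F /=.
under eq_integral => x _.
  under eq_integral => y _ do rewrite EFinM.
  rewrite integralZl//.
  rewrite -[(\int[m2]_y _)%E]fineK ?integrable_fin_num//.
  rewrite -EFinM.
  over.
rewrite /= -/(Rintegral m2 setT v) -/(Rintegral m1 setT (fun x => u x * Rintegral m2 setT v)).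
by rewrite RintegralZr.
Qed.

End product_integral.

Section kernel_fubini.
Context {R : realType} d1 d2 {T1 : measurableType d1} {T2 : measurableType d2}.
Variables (m1 : {sigma_finite_measure set T1 -> \bar R})
          (m2 : {sigma_finite_measure set T2 -> \bar R}).
Implicit Types (u : T1 -> R) (v : T2 -> R) (k : T1 * T2 -> R).

Lemma integrable_bounded_kernel d (T : measurableType d)
    (m : {measure set T -> \bar R}) (u k : T -> R) :
  m.-integrable setT (EFin \o u) -> measurable_fun setT k ->
  (forall z, `|k z| <= 1) -> m.-integrable setT (EFin \o (fun z => u z * k z)).
Proof.
move=> iu mk k1; apply: (le_integrable _ _ _ iu) => //.
  apply/measurable_EFinP; apply: measurable_funM => //.
  by apply/measurable_EFinP; exact: (measurable_int m iu).
by move=> z _; rewrite /= normrM lee_fin ler_piMr.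
Qed.

(** Integrability on the product comes from the tensor u v alone; the kernel, here a cosine mixing
    both variables, only has to be bounded. *)
Lemma Fubini_bounded_kernel u v k :
  m1.-integrable setT (EFin \o u) -> m2.-integrable setT (EFin \o v) ->
  measurable_fun setT k -> (forall z, `|k z| <= 1) ->
  \int[m1]_x \int[m2]_y (u x * v y * k (x, y)) =
  \int[m2]_y \int[m1]_x (u x * v y * k (x, y)).
Proof.
move=> iu iv mk k1.
have ik := integrable_bounded_kernel (integrable_tensor iu iv) mk k1.
have := Fubini ik; rewrite /= => F.
rewrite /Rintegral; congr fine; rewrite /=.
under eq_integral => x _.
  rewrite fineK; last first.
    apply: integrable_fin_num => //.
    apply: integrable_bounded_kernel => //.
      apply: eq_integrable (integrableZl measurableT (u x) iv) => //=.
    exact: measurableT_comp mk (measurable_pair1 x).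
  over.
rewrite F; apply: eq_integral => y _.
rewrite fineK//; apply: integrable_fin_num => //.
apply: integrable_bounded_kernel => //.
  by apply: eq_integrable (integrableZr measurableT (v y) iu) => //=.
exact: measurableT_comp mk (measurable_pair2 y).
Qed.

Lemma integrable_bounded_kernel2 u v k :
  m1.-integrable setT (EFin \o u) -> m2.-integrable setT (EFin \o v) ->
  measurable_fun setT k -> (forall z, `|k z| <= 1) ->
  m2.-integrable setT (EFin \o (fun y => \int[m1]_x (u x * v y * k (x, y)))).
Proof.
move=> iu iv mk k1.
have ik := integrable_bounded_kernel (integrable_tensor iu iv) mk k1.
have iuy y : m1.-integrable setT (EFin \o (fun x => u x * v y * k (x, y))).
  apply: integrable_bounded_kernel => //.
    by apply: eq_integrable (integrableZr measurableT (v y) iu) => //=.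
  exact: measurableT_comp mk (measurable_pair2 y).
have iN := integrableZl measurableT (\int[m1]_x `|u x|) (integrable_norm iv).
apply: (le_integrable _ _ _ iN) => //.
  have := measurable_fubini_G ik; rewrite /fubini_G /=.
  apply: eq_measurable_fun => y _ /=.
  by rewrite /Rintegral fineK//; exact: (integrable_fin_num measurableT (iuy y)).
move=> y _; rewrite /= lee_fin normrM normr_id.
rewrite (le_trans (le_normr_Rintegral _ (iuy y)))//.
apply: (@le_trans _ _ (\int[m1]_x (`|u x| * `|v y|))).
  have iuv := integrableZr measurableT `|v y| (integrable_norm iu).
  apply: le_Rintegral => //.
    exact: (integrable_norm (iuy y)).
  by move=> x _; rewrite !normrM ler_piMr ?mulr_ge0.
rewrite RintegralZr//; last exact: (integrable_norm iu).
by rewrite ler_wpM2r// ler_norm.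
Qed.

End kernel_fubini.

(** * Abel means of the cosine and the Poisson kernel *)

Section abel.
Context {R : realType}.
Local Notation mu := (@lebesgue_measure R).
Implicit Types (b : R -> R) (L t x y : R).

Lemma expR_cos_primitive (s h t : R) x : s ^+ 2 + h ^+ 2 != 0 ->
  is_derive x (1:R)
    (fun x => expR (s * x) * (s * cos (h * x + t) + h * sin (h * x + t)) /
              (s ^+ 2 + h ^+ 2))
    (expR (s * x) * cos (h * x + t)).
Proof.
move=> sh.
have de : is_derive x (1:R) (fun x : R => expR (s * x)) (expR (s * x) * s).
  apply: (is_derive1_compose (is_derive_expR _)).
  by have := is_derive1_affine s 0 x; under eq_fun do rewrite addr0.
have dc : is_derive x (1:R) (fun x : R => cos (h * x + t)) (- sin (h * x + t) * h).
  exact: (is_derive1_compose (is_derive_cos _) (is_derive1_affine h t x)).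
have ds : is_derive x (1:R) (fun x : R => sin (h * x + t)) (cos (h * x + t) * h).
  exact: (is_derive1_compose (is_derive_sin _) (is_derive1_affine h t x)).
have d1 := is_derive1D (is_derive1Z s dc) (is_derive1Z h ds).
have := is_derive1Z (s ^+ 2 + h ^+ 2)^-1 (is_derive1M de d1).
under eq_fun do rewrite mulrC.
by move/is_derive_eq; apply; field.
Qed.

Lemma continuous_expR_cos (s h t : R) :
  continuous (fun x => expR (s * x) * cos (h * x + t)).
Proof.
move=> x; apply: cvgM; last exact: continuous_cos_affine.
apply: continuous_comp; last exact: continuous_expR.
by apply: cvgM; [exact: cvg_cst|exact: cvg_id].
Qed.

(** The explicit primitive, taken on either side of 0, gives the Poisson kernel at 0 and
    exponentially small boundary terms at q and - q. Staying on a segment with an explicit error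
    avoids improper integrals. *)
Lemma integral_abel_cos (e q h t : R) : 0 < e -> 0 <= q ->
  `| \int[mu]_(x in `[- q, q]) (expR (- e * `|x|) * cos (h * x + t)) -
     2 * cos t * (e / (e ^+ 2 + h ^+ 2)) | <= 4 / e * expR (- (e * q)).
Proof.
move=> e0 q0.
have eh : 0 < e ^+ 2 + h ^+ 2 by rewrite ltr_wpDr ?sqr_ge0// exprn_gt0.
have ehn : e ^+ 2 + h ^+ 2 != 0 by rewrite gt_eqF.
have Neh : (- e) ^+ 2 + h ^+ 2 != 0 by rewrite sqrrN.
have cf : continuous (fun x : R => expR (- e * `|x|) * cos (h * x + t)).
  move=> x; apply: cvgM; last exact: continuous_cos_affine.
  apply: continuous_comp; last exact: continuous_expR.
  by apply: cvgM; [exact: cvg_cst|exact: norm_continuous].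
have int_ u v : mu.-integrable `[u, v]
    (EFin \o (fun x : R => expR (- e * `|x|) * cos (h * x + t))).
  apply: continuous_compact_integrable; first exact: segment_compact.
  exact: continuous_subspaceT.
have -> : \int[mu]_(x in `[- q, q]) (expR (- e * `|x|) * cos (h * x + t)) =
   \int[mu]_(x in `[- q, 0]) (expR (e * x) * cos (h * x + t)) +
   \int[mu]_(x in `[0, q]) (expR (- e * x) * cos (h * x + t)).
  have := @Rintegral_itvB R (fun x : R => expR (- e * `|x|) * cos (h * x + t))
    (BLeft (- q)) (BRight q) 0 (int_ _ _).
  rewrite !bnd_simp oppr_le0 q0 => /(_ isT isT) H.
  rewrite -[LHS](subrK (\int[mu]_(x in `[- q, 0]) (expR (- e * `|x|) * cos (h * x + t)))).
  rewrite H addrC; congr (_ + _).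
    apply: eq_Rintegral => x; rewrite inE/= in_itv/= => /andP[_ x0].
    by rewrite ler0_norm// mulrNN.
  rewrite Rintegral_itv_obnd_cbnd; last first.
    by apply: integrableS (int_ 0 q) => //; exact: subset_itv_oc_cc.
  apply: eq_Rintegral => x; rewrite inE/= in_itv/= => /andP[x0 _].
  by rewrite ger0_norm.
rewrite (FTC_seg _ (@continuous_expR_cos e h t) (fun x => expR_cos_primitive t x ehn)); last first.
  by rewrite oppr_le0.
rewrite (FTC_seg q0 (@continuous_expR_cos (- e) h t) (fun x => expR_cos_primitive t x Neh)).
rewrite !mulr0 add0r expR0 !mul1r sqrrN mulrN mulNr.
set D := e ^+ 2 + h ^+ 2; set E := expR _.
set c1 := cos _; set s1 := sin _; set c0 := cos _; set s0 := sin _.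
set c2 := cos _; set s2 := sin _.
have -> : (e * c1 + h * s1) / D - E * (e * c0 + h * s0) / D +
   (E * (- e * c2 + h * s2) / D - (- e * c1 + h * s1) / D) - 2 * c1 * (e / D) =
   E / D * (- (e * c0 + h * s0) + (- e * c2 + h * s2)) by ring.
have E0 : 0 <= E by exact: expR_ge0.
have D0 : 0 < D by [].
rewrite normrM (ger0_norm (divr_ge0 E0 (ltW D0))) [leRHS]mulrC -mulrA ler_wpM2l//.
rewrite ler_pdivrMl//.
(* The boundary terms are at most 2 (e + |h|), and e (e + |h|) <= 2 (e^2 + h^2); hence the constant
   4 / e. *)
apply: (@le_trans _ _ (2 * (e + `|h|))).
  have hn c s : `|c| <= 1 -> `|s| <= 1 -> `|e * c + h * s| <= e + `|h| :> R.
    move=> c1' s1'; rewrite (le_trans (ler_normD _ _))// !normrM (gtr0_norm e0).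
    by rewrite lerD// ler_piMr// ltW.
  rewrite (le_trans (ler_normD _ _))// normrN mulr_natl mulr2n lerD//.
    by apply: hn; [exact: cos_max|exact: sin_max].
  rewrite mulNr -mulrN.
  by apply: hn; rewrite ?normrN ?cos_max ?sin_max.
rewrite mulrA ler_pdivlMr// -mulrA.
have -> : D = e ^+ 2 + `|h| ^+ 2 by rewrite real_normK// num_real.
have := sqr_ge0 (e - `|h|); have := sqr_ge0 (e + `|h|); rewrite !sqrrD; nra.
Qed.

End abel.

(** * Fourier inversion for test functions of one variable *)

Section inversion.
Context {R : realType}.
Local Notation mu := (@lebesgue_measure R).
Implicit Types (b : R -> R) (L t x y : R).

Lemma test_fun_lipschitz L b : test_fun L b ->
  exists2 K, 0 <= K & forall x y, `|b x - b y| <= K * `|x - y|.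
Proof.
move=> tb; have [K bK] := test_fun_bounded (test_fun_derive1 tb).
have K0 : 0 <= K by exact: le_trans (bK 0).
exists K => // x y.
wlog xy : x y / x <= y.
  move=> H; have [xy|/ltW yx] := leP x y; first exact: H.
  by rewrite distrC [`|x - y|]distrC; exact: H.
rewrite distrC [`|x - y|]distrC.
have db z : z \in `]x, y[ -> is_derive z (1:R) b (derive1 b z).
  by move=> _; exact: (smooth_is_derive z tb.1).
have cb : {within `[x, y], continuous b}.
  by apply: continuous_subspaceT; exact: smooth_continuous tb.1.
by have [c _ ->] := MVT_segment xy db cb; rewrite normrM ler_wpM2r.
Qed.

Lemma oneDsqr_integrable :
  mu.-integrable setT (EFin \o (fun x : R => (1 + x ^+ 2)^-1)).
Proof.
have c : continuous (fun x : R => (1 + x ^+ 2)^-1) by exact: (@continuous_oneDsqrV R).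
have p (x : R) : 0 <= (1 + x ^+ 2)^-1 by rewrite invr_ge0 addr_ge0// sqr_ge0.
apply/integrableP; split.
  by apply/measurable_EFinP; exact: continuous_measurable_fun.
under eq_integral do rewrite /= ger0_norm//.
rewrite (ge0_symfun_integralT p c); last first.
  by move=> x /=; rewrite sqrrN.
rewrite (_ : [set x | _] = `[0, +oo[%classic); last first.
  by apply/seteqP; split => x /=; rewrite in_itv/= andbT.
have := @integral0y_oneDsqr R; rewrite /oneDsqr => ->.
by rewrite -EFinM ltry.
Qed.

(** The integrand, in the variable x, of the inversion formula at the point z: t = 0 gives its real
    part and t = - pi / 2 its imaginary part, up to the sign convention of the exponential. *)
Definition shifted_trig b z t x := \int[mu]_y (b y * cos (x * (y - z) + t)).

Lemma shifted_trigE b z t x : shifted_trig b z t x = trig (t - x * z) b x.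
Proof. by apply: eq_Rintegral => y _; congr (_ * cos _); ring. Qed.

Lemma shifted_trig_eq L b z t : test_fun L b ->
  shifted_trig b z t = fun x => cos (x * z) * trig t b x + sin (x * z) * trig (t - pi / 2) b x.
Proof.
move=> tb; apply/funext => x; rewrite shifted_trigE /trig.
have int_ u := integrable_test_fun tb (@continuous_cos_affine R x u).
rewrite -!RintegralZl// -RintegralD//; last 2 first.
  exact: (integrableZl _ _ (int_ _)).
  exact: (integrableZl _ _ (int_ _)).
apply: eq_Rintegral => y _.
rewrite (_ : x * y + (t - x * z) = (x * y + t) - x * z); last by ring.
by rewrite addrA cosB cosBpihalf; ring.
Qed.

Lemma continuous_trig L b t : test_fun L b -> continuous (trig t b).
Proof.
move=> tb x; apply/differentiable_continuous/derivable1_diffP.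
by case: (is_derive_trig t x tb).
Qed.

Lemma continuous_shifted_trig L b z t : test_fun L b -> continuous (shifted_trig b z t).
Proof.
move=> tb; rewrite (shifted_trig_eq z t tb) => x.
apply: cvgD; apply: cvgM.
- apply: continuous_comp; last exact: continuous_cos.
  by apply: cvgM; [exact: cvg_id|exact: cvg_cst].
- exact: (@continuous_trig L b t tb x).
- apply: (@continuous_comp _ _ _ (fun x : R => x * z) sin); last exact: continuous_sin.
  by apply: cvgM; [exact: cvg_id|exact: cvg_cst].
- exact: (@continuous_trig L b (t - pi / 2) tb x).
Qed.

Lemma shifted_trig_integrable L b z t : test_fun L b ->
  mu.-integrable setT (EFin \o shifted_trig b z t).
Proof.
move=> tb.
have [B1 h1] := trig_decay t 2 tb.
have [B2 h2] := trig_decay (t - pi / 2) 2 tb.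
have B0 : 0 <= B1 + B2.
  rewrite addr_ge0//; [apply: le_trans (h1 0)|apply: le_trans (h2 0)];
    by rewrite mulr_ge0// exprn_ge0// addr_ge0.
have i := integrableZl measurableT (B1 + B2) oneDsqr_integrable.
apply: (le_integrable _ _ _ i) => //.
  apply/measurable_EFinP; apply: continuous_measurable_fun.
  exact: continuous_shifted_trig tb.
move=> x _; rewrite (shifted_trig_eq z t tb) /= lee_fin.
have p : 0 < 1 + x ^+ 2 by rewrite ltr_wpDr// sqr_ge0.
rewrite normrM normfV (ger0_norm B0) (gtr0_norm p) ler_pdivlMr// mulrC.
apply: (@le_trans _ _ ((1 + `|x|) ^+ 2 * (`|trig t b x| + `|trig (t - pi / 2) b x|))).
  apply: ler_pM => //; first exact: ltW.
    rewrite sqrrD expr1n mul1r real_normK ?num_real// lerD2r lerDl.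
    by rewrite mulrn_wge0.
  rewrite (le_trans (ler_normD _ _))// !normrM lerD// ler_piMl//.
    exact: cos_max.
  exact: sin_max.
by rewrite mulrDr lerD.
Qed.

(** The Poisson kernel of width 1 / (m + 1) is an approximate identity of mass pi. Its mass on
    [- M, M] is a difference of arctangents with limits pi / 2 and - pi / 2, because z is interior
    to the segment. *)
Lemma poisson_cvg L b z : test_fun L b ->
  \int[mu]_y (b y * (m.+1%:R^-1 / (m.+1%:R^-1 ^+ 2 + (y - z) ^+ 2))) @[m --> \oo]
    --> pi * b z.
Proof.
move=> tb; pose M : R := `|L| + `|z| + 1.
have LM : L <= M by rewrite /M (le_trans (ler_norm L))// -addrA lerDl.
have zM : `|z| < M by rewrite /M addrAC ltrDr ltr_wpDl.
have M0 : 0 < M by exact: le_lt_trans zM.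
pose e m : R := m.+1%:R^-1.
have e0 m : 0 < e m by rewrite /e invr_gt0.
pose P m y := e m / (e m ^+ 2 + (y - z) ^+ 2).
have den m y : 0 < e m ^+ 2 + (y - z) ^+ 2.
  by rewrite ltr_wpDr ?sqr_ge0// exprn_gt0.
have P0 m y : 0 <= P m y by rewrite divr_ge0// ltW.
have cP m : continuous (P m).
  move=> y; apply: cvgM; first exact: cvg_cst.
  apply: cvgV; first by rewrite gt_eqF.
  apply: cvgD; first exact: cvg_cst.
  by apply: cvgM; (apply: cvgD; [exact: cvg_id|exact: cvg_cst]).
have cb := smooth_continuous tb.1.
have [K K0 bK] := test_fun_lipschitz tb.
pose g m y := (b y - b z) * P m y.
have cg m : continuous (g m).
  move=> y; apply: cvgM; last exact: cP.
  by apply: cvgD; [exact: cb|exact: cvg_cst].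
(* The Lipschitz bound on b absorbs the singularity of the kernel: (b y - b z) P is bounded
   uniformly in m, so dominated convergence applies on the segment. *)
have Pyz m y : `|y - z| * P m y <= 1.
  rewrite /P mulrA ler_pdivrMr// mul1r.
  have := sqr_ge0 (e m - `|y - z|).
  have -> : (y - z) ^+ 2 = `|y - z| ^+ 2 by rewrite real_normK// num_real.
  have := e0 m; have := normr_ge0 (y - z); rewrite sqrrB; nra.
have gK m y : `|g m y| <= K.
  rewrite normrM (ger0_norm (P0 _ _)).
  apply: (@le_trans _ _ (K * (`|y - z| * P m y))).
    by rewrite [leRHS]mulrA ler_wpM2r.
  by rewrite ler_piMr.
have ecvg : e m @[m --> \oo] --> (0:R) by exact: cvg_harmonic.
have g0 y : g m y @[m --> \oo] --> (0:R).
  have [->|yz] := eqVneq y z.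
    by rewrite /g subrr; under eq_fun do rewrite mul0r; exact: cvg_cst.
  rewrite /g -[X in _ --> X](mulr0 (b y - b z)); apply: cvgM; first exact: cvg_cst.
  rewrite /P -[X in _ --> X](mul0r ((0 ^+ 2 + (y - z) ^+ 2)^-1)); apply: cvgM => //.
  apply: cvgV.
    by rewrite expr0n add0r sqrf_eq0 subr_eq0.
  apply: cvgD; last exact: cvg_cst.
  by apply: cvgM.
have I1 : \int[mu]_(y in `[- M, M]) g m y @[m --> \oo] --> (0:R).
  have [] := @dominated_convergence _ _ _ mu `[- M, M]%classic (measurable_itv _)
     (fun m => EFin \o g m) (cst 0%E) (cst K%:E).
  - by move=> m; apply/measurable_EFinP; apply: measurable_funTS; exact: continuous_measurable_fun.
  - exact: measurable_cst.
  - by apply: aeW => y _; apply: cvg_EFin; [exact: nearW|exact: g0].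
  - by apply: (@integrable_seg R M (cst K)); exact: cst_continuous.
  - by apply: aeW => y m _; rewrite lee_fin.
  move=> _ _; rewrite integral0 => /fine_cvg.
  exact.
have I2 m : \int[mu]_(y in `[- M, M]) P m y =
    atan ((M - z) * m.+1%:R) - atan ((- M - z) * m.+1%:R).
  have dF (y : R) : is_derive y (1:R) (fun y => atan ((m.+1%:R) * y + (- z * m.+1%:R)))
      (P m y).
    have := is_derive1_compose (is_derive1_atan _) (is_derive1_affine m.+1%:R (- z * m.+1%:R) y).
    move/is_derive_eq; apply.
    rewrite /P /e; field.
    by apply/andP; split; rewrite gt_eqF// ltr_wpDr// sqr_ge0.
  rewrite (FTC_seg _ (cP m) dF); last by rewrite (le_trans _ (ltW M0))// oppr_le0 ltW.
  by congr (atan _ - atan _); ring.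
have I3 : \int[mu]_(y in `[- M, M]) P m y @[m --> \oo] --> (pi : R).
  under eq_fun do rewrite I2.
  have -> : pi = pi / 2 - (- (pi / 2)) :> R by lra.
  have ncv (c : R) : 0 < c -> atan (c * m.+1%:R) @[m --> \oo] --> (pi / 2 : R).
    move=> c0; apply: (cvg_comp _ _ _ (@cvgy_atan R)).
    apply/cvgryPge => A; near=> m; rewrite -ler_pdivrMl// mulrC.
    rewrite (@le_trans _ _ m%:R) ?ler_nat//.
    by near: m; exact: nbhs_infty_ger.
  have [zM1 zM2] : - M < z /\ z < M by move: zM; rewrite ltr_norml => /andP.
  apply: cvgB; first by apply: ncv; rewrite subr_gt0.
  under eq_fun do rewrite -[X in atan X]opprK atanN.
  apply: cvgN; under eq_fun do rewrite -mulNr.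
  by apply: ncv; lra.
rewrite (_ : (fun m => _) = fun m => \int[mu]_(y in `[- M, M]) g m y +
    b z * \int[mu]_(y in `[- M, M]) P m y); last first.
  apply/funext => m; rewrite (integral_test_fun _ tb LM) -RintegralZl//; last first.
    exact: integrable_seg.
  rewrite -RintegralD//; last 2 first.
    exact: integrable_seg.
    apply: (@integrable_seg _ _ (fun y => b z * P m y)) => y.
    by apply: cvgM; [exact: cvg_cst|exact: cP].
  by apply: eq_Rintegral => y _; rewrite /g /P /e; ring.
rewrite mulrC -[X in _ --> X]add0r; apply: cvgD => //.
by apply: cvgM; [exact: cvg_cst|].
Unshelve. all: end_near. Qed.

(** Inserting the truncated Abel factor [u m] changes nothing in the limit, by domination. For fixed
    m, Fubini integrates in x first, which yields 2 cos t times the Poisson integral of b up to the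
    error of [integral_abel_cos]. *)
Theorem integral_shifted_trig L b z t : test_fun L b ->
  \int[mu]_x (shifted_trig b z t x) = 2 * pi * cos t * b z.
Proof.
move=> tb.
have iG := shifted_trig_integrable z t tb.
have mG : measurable_fun setT (shifted_trig b z t).
  by apply: continuous_measurable_fun; exact: (continuous_shifted_trig tb).
have ib : mu.-integrable setT (EFin \o b).
  have := integrable_test_fun tb (@cst_continuous _ _ (1 : R)).
  by under eq_fun do rewrite mulr1.
pose e m : R := m.+1%:R^-1.
have e0 m : 0 < e m by rewrite /e invr_gt0.
(* The truncation must outrun the regularisation: with [e m] = 1 / (m + 1) one gets [e m] [q m] = m
   + 1, and the Abel error 4 (m + 1) e^(-(m + 1)) tends to 0. *)
pose q m : R := m.+1%:R ^+ 2.
have q0 m : 0 <= q m by rewrite exprn_ge0.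
pose u m x := expR (- e m * `|x|) * \1_(`[- q m, q m]%classic) x.
have mI m : measurable_fun setT (\1_(`[- q m, q m]%classic) : R -> R).
  exact: measurable_indic.
have cE m : continuous (fun x : R => expR (- e m * `|x|)).
  move=> x; apply: continuous_comp; last exact: continuous_expR.
  by apply: cvgM; [exact: cvg_cst|exact: norm_continuous].
have mu_ m : measurable_fun setT (u m).
  by apply: measurable_funM => //; exact: continuous_measurable_fun.
have u0 m x : 0 <= u m x by rewrite mulr_ge0// ?expR_ge0// indicE.
have u1 m x : u m x <= 1.
  rewrite mulr_ile1 ?expR_ge0 ?indicE//; last by case: (_ \in _).
  by rewrite -expR0 ler_expR mulNr oppr_le0 mulr_ge0// ltW.
have uE m (f : R -> R) : \int[mu]_x (u m x * f x) =
    \int[mu]_(x in `[- q m, q m]) (expR (- e m * `|x|) * f x).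
  rewrite [RHS]Rintegral_mkcond; apply: eq_Rintegral => x _.
  rewrite patchE /u indicE; case: (x \in _); first by rewrite mulr1.
  by rewrite mulr0 mul0r.
have iu m : mu.-integrable setT (EFin \o u m).
  rewrite (_ : u m = (fun x : R => expR (- e m * `|x|)) \_ `[- q m, q m]); last first.
    by apply/funext => x; rewrite patchE /u indicE; case: (_ \in _); rewrite ?mulr1 ?mulr0.
  rewrite -restrict_EFin; apply/integrable_restrict => //=; rewrite setTI.
  exact: integrable_seg.
pose A m := \int[mu]_x (u m x * shifted_trig b z t x).
pose B m := \int[mu]_y (b y * (e m / (e m ^+ 2 + (y - z) ^+ 2))).
have AG : A m @[m --> \oo] --> \int[mu]_x shifted_trig b z t x.
  have := @dominated_convergence _ _ _ mu setT measurableT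
     (fun m => EFin \o (fun x => u m x * shifted_trig b z t x))
     (EFin \o shifted_trig b z t) (fun x => `|shifted_trig b z t x|%:E).
  move=> [].
  - move=> m; apply/measurable_EFinP; apply: measurable_funM; [exact: mu_|exact: mG].
  - exact/measurable_EFinP.
  - apply: aeW => x _; apply: cvg_EFin; first exact: nearW.
    rewrite -[X in _ --> X]mul1r; apply: cvgM; last exact: cvg_cst.
    apply: (@cvg_trans _ (expR (- e m * `|x|) @[m --> \oo])).
      apply: near_eq_cvg; near=> m; rewrite /u indicE mem_set ?mulr1//=.
      rewrite in_itv/= -ler_norml /q.
      rewrite (@le_trans _ _ m%:R)//.
        by near: m; exact: nbhs_infty_ger.
      by rewrite -natrX ler_nat (leq_trans (leqnSn m))// leq_pmull.
    have c0 : - e m * `|x| @[m --> \oo] --> (0 : R).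
      rewrite -(mul0r `|x|); apply: cvgM; last exact: cvg_cst.
      by rewrite -oppr0; apply: cvgN; exact: cvg_harmonic.
    rewrite -expR0; apply: (cvg_comp _ _ c0); exact: continuous_expR.
  - exact: (integrable_norm iG).
  - by apply: aeW => x m _; rewrite /= lee_fin normrM ler_piMl// ger0_norm.
  move=> _ _; rewrite -(fineK (integrable_fin_num measurableT iG)) => /fine_cvg.
  exact.
have AB m : `|A m - 2 * cos t * B m| <=
    4 * m.+1%:R * expR (- m.+1%:R) * \int[mu]_y `|b y|.
  pose k (p : R * R) := cos (p.1 * (p.2 - z) + t).
  have mk : measurable_fun setT k.
    apply: measurableT_comp; first by apply: continuous_measurable_fun; exact: continuous_cos.
    apply: measurable_funD => //; apply: measurable_funM => //.
    by apply: measurable_funB.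
  have k1 p : `|k p| <= 1 by exact: cos_max.
  have -> : A m = \int[mu]_y \int[mu]_x (u m x * b y * k (x, y)).
    rewrite -(Fubini_bounded_kernel (iu m) ib mk k1).
    apply: eq_Rintegral => x _; rewrite /shifted_trig -RintegralZl//.
      by apply: eq_Rintegral => y _; rewrite mulrA.
    have := integrable_test_fun tb (@continuous_cos_affine R x (t - x * z)).
    congr (mu.-integrable _ _); apply/funext => y /=.
    by congr (_ * cos _)%:E; ring.
  have iJ := integrable_bounded_kernel2 (iu m) ib mk k1.
  have iP : mu.-integrable setT (EFin \o (fun y => b y * (e m / (e m ^+ 2 + (y - z) ^+ 2)))).
    apply: (integrable_test_fun tb) => y; apply: cvgM; first exact: cvg_cst.
    apply: cvgV.
      by rewrite gt_eqF// ltr_wpDr ?sqr_ge0// exprn_gt0.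
    apply: cvgD; first exact: cvg_cst.
    by apply: cvgM; (apply: cvgD; [exact: cvg_id|exact: cvg_cst]).
  rewrite /B -RintegralZl// -RintegralB//; last exact: (integrableZl measurableT (2 * cos t) iP).
  have iD := integrableB measurableT iJ (integrableZl measurableT (2 * cos t) iP).
  rewrite (le_trans (le_normr_Rintegral _ iD))//.
  have iN := integrableZl measurableT (4 * m.+1%:R * expR (- m.+1%:R)) (integrable_norm ib).
  rewrite -RintegralZl//; last exact: (integrable_norm ib).
  apply: le_Rintegral => //; first exact: (integrable_norm iD).
  move=> y _.
  have -> : \int[mu]_x (u m x * b y * k (x, y)) =
      b y * \int[mu]_(x in `[- q m, q m]) (expR (- e m * `|x|) * cos ((y - z) * x + t)).
    rewrite -uE -RintegralZl//.
      by apply: eq_Rintegral => x _; rewrite /k/= [x * _]mulrC; ring.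
    apply: (integrable_bounded_kernel (iu m)).
      by apply: continuous_measurable_fun; exact: continuous_cos_affine.
    by move=> x; exact: cos_max.
  rewrite [2 * _ * _]mulrCA -mulrBr normrM mulrC ler_wpM2r//.
  have := integral_abel_cos (y - z) t (e0 m) (q0 m).
  have -> : e m * q m = m.+1%:R by rewrite /e /q expr2 mulrA mulVf ?mul1r.
  by rewrite /e invrK.
have AB0 : A m - 2 * cos t * B m @[m --> \oo] --> (0 : R).
  have [C C0 hC] := @polyexp_bounded R 'X^2.
  set I := \int[mu]_y `|b y| in AB.
  have I0 : 0 <= I by apply: Rintegral_ge0.
  apply: norm_cvg0; apply: (@squeeze_cvgr _ _ _ _ (cst 0) (fun m => 4 * C * I * e m)).
  - apply: nearW => m; rewrite normr_ge0/= (le_trans (AB m))//.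
    rewrite [leRHS]mulrAC ler_wpM2r// -!mulrA ler_wpM2l// /e.
    rewrite ler_pdivlMr// mulrAC -expr2.
    by have := hC m.+1%:R (ler0n _ _); rewrite hornerXn ger0_norm// exprn_ge0.
  - exact: cvg_cst.
  - rewrite -[X in _ --> X](mulr0 (4 * C * I)); apply: cvgM; first exact: cvg_cst.
    exact: cvg_harmonic.
have AB1 : A m @[m --> \oo] --> 2 * cos t * (pi * b z).
  rewrite (_ : A = fun m => (A m - 2 * cos t * B m) + 2 * cos t * B m); last first.
    by apply/funext => m; rewrite subrK.
  rewrite -[X in _ --> X]add0r; apply: cvgD => //.
  by apply: cvgM; [exact: cvg_cst|exact: (@poisson_cvg L b z tb)].
rewrite -(cvg_unique (@norm_hausdorff _ _) AB1 AG); ring.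
Unshelve. all: end_near.
Qed.

End inversion.

(** * Tensor products on R^n *)

Section leb_products.
Context {R : realType}.
Local Notation mu := (@lebesgue_measure R).
Local Notation C := R[i].

(* [lebesgue_measure] lives on [measurableTypeR R], the Borel structure of the
   matrices on [R] itself; the two structures are convertible. *)
Lemma measurable_vconsR n :
  measurable_fun [set: (measurableTypeR R * 'cV[R]_n)%type] (@vcons R n).
Proof. exact: measurable_vcons. Qed.

Lemma leb_integrable_tensor n (u : R -> R) (v : 'cV[R]_n -> R) :
  mu.-integrable setT (EFin \o u) -> (leb n).-integrable setT (EFin \o v) ->
  (leb n.+1).-integrable setT (EFin \o (fun x : 'cV[R]_n.+1 => u (x ord0 0) * v (vtail x))) /\
  \int[leb n.+1]_x (u ((x : 'cV[R]_n.+1) ord0 0) * v (vtail x)) =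
    \int[mu]_x u x * \int[leb n]_x v x.
Proof.
move=> iu iv.
have mF : measurable_fun setT (EFin \o (fun x : 'cV[R]_n.+1 => u (x ord0 0) * v (vtail x))).
  apply/measurable_EFinP; apply: measurable_funM.
    apply: measurableT_comp (measurable_coord ord0 0).
    by apply/measurable_EFinP; exact: (measurable_int mu iu).
  apply: measurableT_comp (@measurable_vtail R n).
  by apply/measurable_EFinP; exact: (measurable_int (leb n) iv).
have FE : (EFin \o (fun x : 'cV[R]_n.+1 => u (x ord0 0) * v (vtail x))) \o @vcons R n =
    EFin \o (fun z => u z.1 * v z.2).
  by apply/funext => p; rewrite /= vcons0 vconsK.
have iF := integrable_tensor iu iv.
rewrite -FE in iF.
have ip := integrable_pushforward (@measurable_vconsR n) mF iF measurableT.
split; first exact: ip.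
rewrite -(integral_tensor iu iv) /Rintegral; congr fine.
have := integral_pushforward (@measurable_vconsR n) mF iF measurableT.
by move=> ->; rewrite FE.
Qed.

Lemma leb0_integrable_cst (c : R) :
  (@leb R 0).-integrable setT (EFin \o cst c).
Proof. exact: (finite_measure_integrable_cst (@dirac _ 'cV[R]_0 0 R)). Qed.

Lemma leb0_integral_cst (c : R) : \int[@leb R 0]_x (cst c) x = c.
Proof.
have e : @leb R 0 setT = 1%E by rewrite /= diracE in_setT.
rewrite Rintegral_cst// -[RHS]mulr1; congr (_ * _).
exact: (congr1 fine e).
Qed.

Lemma leb_prod n (phi : 'I_n -> R -> R) :
  (forall i, mu.-integrable setT (EFin \o phi i)) ->
  (leb n).-integrable setT (EFin \o (fun x : 'cV[R]_n => \prod_i phi i (x i 0))) /\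
  \int[leb n]_x (\prod_i phi i ((x : 'cV[R]_n) i 0)) = \prod_i \int[mu]_x phi i x.
Proof.
elim: n phi => [|n ih] phi iphi.
  have E : (fun x : 'cV[R]_0 => \prod_i phi i (x i 0)) = cst 1.
    by apply/funext => x; rewrite big_ord0.
  rewrite E big_ord0; split.
    exact: leb0_integrable_cst.
  exact: leb0_integral_cst.
have [i1 e1] := ih (fun j => phi (lift ord0 j)) (fun j => iphi _).
have [i2 e2] := leb_integrable_tensor (iphi ord0) i1.
have E : (fun x : 'cV[R]_n.+1 => \prod_i phi i (x i 0)) =
   (fun x : 'cV[R]_n.+1 => phi ord0 (x ord0 0) * \prod_i phi (lift ord0 i) ((vtail x) i 0)).
  apply/funext => x; rewrite big_ord_recl; congr (_ * _).
  by apply: eq_bigr => j _; rewrite mxE.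
by rewrite E big_ord_recl -e1.
Qed.

Definition cint1 (f : R -> C) : C :=
  (\int[mu]_x complex.Re (f x)) +i* (\int[mu]_x complex.Im (f x)).

Definition cintegrable1 (f : R -> C) : Prop :=
  mu.-integrable setT (EFin \o (fun x => complex.Re (f x))) /\
  mu.-integrable setT (EFin \o (fun x => complex.Im (f x))).

Lemma Re_mul (a b : C) : complex.Re (a * b) =
  complex.Re a * complex.Re b - complex.Im a * complex.Im b.
Proof. by case: a b => [? ?] [? ?]. Qed.

Lemma Im_mul (a b : C) : complex.Im (a * b) =
  complex.Re a * complex.Im b + complex.Im a * complex.Re b.
Proof. by case: a b => [? ?] [? ?]. Qed.

(** Stated for complex factors because exponentials split over coordinates whereas their real and
    imaginary parts do not. One induction step expands a complex product into four real tensors. *)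
Lemma leb_cprod n (phi : 'I_n -> R -> C) :
  (forall i, cintegrable1 (phi i)) ->
  cintegrable (fun x : 'cV[R]_n => \prod_i phi i (x i 0)) /\
  cintegral (fun x : 'cV[R]_n => \prod_i phi i (x i 0)) = \prod_i cint1 (phi i).
Proof.
elim: n phi => [|n ih] phi iphi.
  have E : (fun x : 'cV[R]_0 => \prod_i phi i (x i 0)) = cst 1.
    by apply/funext => x; rewrite big_ord0.
  rewrite E big_ord0; split.
    by split; exact: leb0_integrable_cst.
  by rewrite /cintegral !leb0_integral_cst.
have [[i1 i1'] e1] := ih (fun j => phi (lift ord0 j)) (fun j => iphi _).
have [i0 i0'] := iphi ord0.
have [irr err] := leb_integrable_tensor i0 i1.
have [iri eri] := leb_integrable_tensor i0 i1'.
have [iir eir] := leb_integrable_tensor i0' i1.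
have [iii eii] := leb_integrable_tensor i0' i1'.
have E : (fun x : 'cV[R]_n.+1 => \prod_i phi i (x i 0)) =
   (fun x : 'cV[R]_n.+1 => phi ord0 (x ord0 0) * \prod_i phi (lift ord0 i) ((vtail x) i 0)).
  apply/funext => x; rewrite big_ord_recl; congr (_ * _).
  by apply: eq_bigr => j _; rewrite mxE.
rewrite E; split.
  split.
    under eq_fun do rewrite Re_mul.
    exact: (integrableB measurableT irr iii).
  under eq_fun do rewrite Im_mul.
  exact: (integrableD measurableT iri iir).
rewrite big_ord_recl -e1 /cintegral.
under eq_Rintegral do rewrite Re_mul.
under [X in _ +i* X]eq_Rintegral do rewrite Im_mul.
by rewrite RintegralB// RintegralD// err eii eri eir.
Qed.

Lemma indicM_prod n (A : 'I_n -> set R) (x : 'cV[R]_n) :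
  \1_[set y : 'cV[R]_n | forall i, A i (y i 0)] x = \prod_i \1_(A i) (x i 0) :> R.
Proof.
rewrite indicE; have [h|h] := pselect (forall i, A i (x i 0)).
  rewrite mem_set//= big1// => i _; rewrite indicE mem_set//.
rewrite memNset//=; move/existsNP: h => [i hi].
by rewrite (bigD1 i)//= indicE memNset// mul0r.
Qed.

Lemma measurable_cylinder n (A : 'I_n -> set R) : (forall i, measurable (A i)) ->
  measurable [set y : 'cV[R]_n | forall i, A i (y i 0)].
Proof.
move=> mA; rewrite (_ : [set _ | _] =
    \bigcap_(i in [set: 'I_n]) ((fun y : 'cV[R]_n => y i 0) @^-1` (A i))); last first.
  by apply/seteqP; split => y /= h i => [_|]; exact: h.
apply: fin_bigcap_measurable => // i _.
by rewrite -[X in measurable X]setTI; exact: measurable_coord.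
Qed.

Lemma leb_box n (a b : 'I_n -> R) : (forall i, a i <= b i) ->
  leb n [set y : 'cV[R]_n | forall i, `[a i, b i]%classic (y i 0)] =
  (\prod_i (b i - a i))%:E.
Proof.
move=> ab; set A := [set _ | _].
have mA : measurable A.
  by apply: (@measurable_cylinder n (fun i => `[a i, b i]%classic)) => i.
have ii i : mu.-integrable setT (EFin \o (\1_(`[a i, b i]%classic) : R -> R)).
  exact: integrable_indic_itv.
have [i1 e1] := leb_prod ii.
have := integral_indic (leb n) measurableT mA; rewrite setIT => <-.
under eq_integral do rewrite (indicM_prod (fun i => `[a i, b i]%classic)).
have := integrable_fin_num measurableT i1.
move/fineK => <-; congr EFin.
rewrite [LHS]e1; apply: eq_bigr => i _.
have e : (\int[mu]_x (\1_(`[a i, b i]%classic) x)%:E = mu `[a i, b i]%classic)%E.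
  by have := integral_indic mu measurableT (measurable_itv `[a i, b i]); rewrite setIT.
rewrite /Rintegral e lebesgue_measure_itv/= lte_fin.
have := ab i; rewrite le_eqVlt => /predU1P[->|->//].
by rewrite ltxx subrr.
Qed.

End leb_products.

(** * Tensor products of Schwartz functions *)

Section schwartz_products.
Context {R : realType}.
Implicit Types (p : R -> R).

Fixpoint schwartz1 (m : nat) p : Prop :=
  (forall N : nat, exists B : R, forall x, (1 + `|x|) ^+ N * `|p x| <= B) /\
  if m is m'.+1 then (forall x : R, derivable p x (1:R)) /\ schwartz1 m' (derive1 p)
  else True.

Lemma schwartz1_trig L m (t : R) (b : R -> R) : test_fun L b -> schwartz1 m (trig t b).
Proof.
elim: m t b => [|m ih] t b tb; split; try by move=> N; exact: trig_decay tb.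
  by [].
split; first by move=> x; case: (is_derive_trig t x tb).
rewrite (derive1_eq (fun x => is_derive_trig t x tb)).
by apply: ih; exact: test_funM_id.
Qed.

Lemma schwartz1_derive1 m p : schwartz1 m.+1 p -> schwartz1 m (derive1 p).
Proof. by move=> [_ []]. Qed.

Lemma schwartz1_iter (m j : nat) p : (forall m, schwartz1 m p) ->
  schwartz1 m (iter j (@derive1 R R) p).
Proof.
move=> sp; elim: j m => [|j ih] m; first exact: sp.
exact: schwartz1_derive1 (ih m.+1).
Qed.

Lemma schwartz1_derivable p (x : R) : schwartz1 1 p -> derivable p x (1:R).
Proof. by move=> [_ []]. Qed.

Lemma schwartz1_continuous p : schwartz1 1 p -> continuous p.
Proof.
by move=> sp x; apply/differentiable_continuous/derivable1_diffP; exact: schwartz1_derivable.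
Qed.

Variable n : nat.
Local Notation Rn := 'cV[R]_n.
Implicit Types (x : Rn) (phi : 'I_n -> R -> R).

Definition tensor phi x : R := \prod_j phi j (x j 0).

Lemma is_derive_tensor phi x (i : 'I_n) : derivable (phi i) (x i 0) (1:R) ->
  is_derive x (basis_vec i) (tensor phi)
    (tensor (fun j => if j == i then derive1 (phi i) else phi j) x).
Proof.
move=> dphi.
pose P := \prod_(j < n | j != i) phi j (x j 0).
have -> : tensor (fun j => if j == i then derive1 (phi i) else phi j) x =
    derive1 (phi i) (x i 0) * P.
  rewrite /tensor (bigD1 i)//= eqxx; congr (_ * _).
  by apply: eq_bigr => j /negbTE->.
have E h : h^-1 *: ((tensor phi \o shift x) (h *: basis_vec i) - tensor phi x) =
    h^-1 *: ((phi i \o shift (x i 0)) (h *: (1:R)) - phi i (x i 0)) * P.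
  rewrite /tensor /= !(bigD1 i (P := predT))//= /basis_vec !mxE !eqxx !mulr1.
  rewrite (_ : \prod_(j < n | j != i) _ = P); last first.
    apply: eq_bigr => j ji; rewrite !mxE eqxx andbT (negbTE ji).
    by rewrite mulr0 add0r.
  by rewrite /P /GRing.scale/= mulr1 -mulrBl mulrA.
have cv : h^-1 *: ((tensor phi \o shift x) (h *: basis_vec i) - tensor phi x) @[h --> 0^']
    --> derive1 (phi i) (x i 0) * P.
  under eq_fun do rewrite E.
  apply: cvgM; last exact: cvg_cst.
  by rewrite derive1E; exact: dphi.
apply: DeriveDef; first by apply/cvg_ex; eexists; exact: cv.
exact: cvg_lim cv.
Qed.

Lemma partials_tensor phi (s : seq 'I_n) : (forall i m, schwartz1 m (phi i)) ->
  partials s (tensor phi) =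
  tensor (fun i => iter (count_mem i s) (@derive1 R R) (phi i)).
Proof.
move=> sp; elim: s => [//|i s ih].
rewrite /= ih; apply/funext => x.
have d := is_derive_tensor (x := x) (i := i)
  (phi := fun i => iter (count_mem i s) (@derive1 R R) (phi i)).
have {}d := d (@schwartz1_derivable _ (x i 0) (schwartz1_iter _ _ (sp i))).
rewrite (@derive_val _ _ _ _ _ _ _ d).
apply: eq_bigr => j _; rewrite [i == j]eq_sym.
by have [->|] := eqVneq j i.
Qed.

Lemma enorm_ge0 x : 0 <= enorm x. Proof. exact: sqrtr_ge0. Qed.

Lemma dot_ge0 x : 0 <= dot x x.
Proof. by apply: sumr_ge0 => i _; rewrite -expr2 sqr_ge0. Qed.

Lemma sqr_enorm x : enorm x ^+ 2 = dot x x.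
Proof. by rewrite sqr_sqrtr// dot_ge0. Qed.

Lemma enorm_le_sum x : enorm x <= \sum_i `|x i 0|.
Proof.
have s0 : 0 <= \sum_i `|x i 0| by exact: sumr_ge0.
rewrite -(ler_pXn2r (n := 2))// ?nnegrE ?enorm_ge0// sqr_enorm /dot.
rewrite expr2 mulr_suml; apply: ler_sum => i _.
rewrite -expr2 -real_normK ?num_real// expr2 ler_wpM2l//.
by rewrite (bigD1 i)//= lerDl sumr_ge0.
Qed.

(** With a i = |x_i| this bounds the weight 1 + |x| by a product of one-variable weights, so that
    decay of a tensor is checked factor by factor. *)
Lemma le_prod_sum (a : 'I_n -> R) : (forall i, 0 <= a i) ->
  1 + \sum_i a i <= \prod_i (1 + a i).
Proof.
move=> a0; suff [] : 1 <= \prod_i (1 + a i) /\ 1 + \sum_i a i <= \prod_i (1 + a i) by [].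
elim/big_rec2 : _ => [|i s p _ [p1 sp]]; first by rewrite addr0.
have := a0 i; split; nra.
Qed.

Lemma continuous_tensor phi : (forall i, continuous (phi i)) -> continuous (tensor phi).
Proof.
move=> cp; rewrite /tensor; elim: (index_enum _) => [|i r ih].
  have -> : (fun x : Rn => \prod_(j <- [::]) phi j (x j 0)) = cst 1.
    by apply/funext => y; rewrite big_nil.
  exact: cst_continuous.
have -> : (fun x : Rn => \prod_(j <- i :: r) phi j (x j 0)) =
    fun y : Rn => phi i (y i 0) * \prod_(j <- r) phi j (y j 0).
  by apply/funext => y; rewrite big_cons.
have ci : continuous (fun y : Rn => phi i (y i 0)).
  move=> x; apply: (cvg_comp _ _ (@coord_continuous R n 1 i 0 x)).
  exact: cp.
by move=> x; exact: (cvgM (ci x) (ih x)).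
Qed.

Lemma schwartz_real_tensor phi : (forall i m, schwartz1 m (phi i)) ->
  schwartz_real (tensor phi).
Proof.
move=> sp s; rewrite partials_tensor//.
set psi := fun i => iter _ _ _.
have spsi i m : schwartz1 m (psi i) by apply: schwartz1_iter; exact: sp.
split.
- by apply: continuous_tensor => i; exact: (schwartz1_continuous (spsi i 1%N)).
- move=> i x.
  by case: (is_derive_tensor (@schwartz1_derivable _ (x i 0) (spsi i 1%N))).
- move=> N.
  have /choice[B hB] : forall i, exists B, forall y : R, (1 + `|y|) ^+ N * `|psi i y| <= B.
    by move=> i; have [] := spsi i 0%N.
  exists (\prod_i B i) => x.
  apply: (@le_trans _ _ (\prod_i ((1 + `|x i 0|) ^+ N * `|psi i (x i 0)|))).
    rewrite big_split/= /tensor normr_prod ler_wpM2r ?prodr_ge0//.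
    rewrite prodrXl; apply: lerXn2r; rewrite ?nnegrE ?addr_ge0 ?enorm_ge0//.
      by apply: prodr_ge0 => i _; rewrite addr_ge0.
    apply: le_trans (le_prod_sum _) => //.
    by rewrite lerD2l enorm_le_sum.
  apply: ler_prod => i _; rewrite hB andbT mulr_ge0//.
Qed.

End schwartz_products.

(** * Fourier transform of tensor products *)

Section fourier_products.
Context {R : realType}.
Local Notation mu := (@lebesgue_measure R).
Local Notation C := R[i].

Lemma expiD (s t : R) : expi (s + t) = expi s * expi t.
Proof. by rewrite /expi cosD sinD; apply/eqP; rewrite eq_complex/= [X in _ && (X == _)]addrC !eqxx. Qed.

Lemma expi0 : expi 0 = 1 :> C.
Proof. by rewrite /expi cos0 sin0. Qed.

Lemma expi_sum n (a : 'I_n -> R) : expi (\sum_i a i) = \prod_i expi (a i).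
Proof. exact: (big_morph _ expiD expi0). Qed.

(** The integral of w(y) e^(i x y) dy, since cos (x y - pi / 2) = sin (x y). The Fourier constants
    are left out and restored through [gauge]. *)
Definition trigC (w : R -> R) (x : R) : C := trig 0 w x +i* trig (- (pi / 2)) w x.

Definition itrans n (w : 'I_n -> R -> R) (x : 'cV[R]_n) : C :=
  \prod_j trigC (w j) (x j 0).

Lemma trigNpi (w : R -> R) L (t x : R) : test_fun L w -> trig (t - pi) w x = - trig t w x.
Proof.
move=> tw; rewrite /trig -[RHS]mulN1r -RintegralZl//; last first.
  exact: (integrable_test_fun tw (@continuous_cos_affine R x t)).
apply: eq_Rintegral => y _.
have -> : x * y + (t - pi) = x * y + t - pi by ring.
by rewrite cosB cospi sinpi; ring.
Qed.

Lemma cint1_expi_trigC (w : R -> R) L (z : R) : test_fun L w ->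
  cintegrable1 (fun x => expi (- (z * x)) * trigC w x) /\
  cint1 (fun x => expi (- (z * x)) * trigC w x) = (2 * pi * w z)%:C.
Proof.
move=> tw.
have ReE : (fun x => complex.Re (expi (- (z * x)) * trigC w x)) = shifted_trig w z 0.
  apply/funext => x; rewrite (shifted_trig_eq z 0 tw) /= cosN sinN sub0r.
  by rewrite [z * x]mulrC; ring.
have ImE : (fun x => complex.Im (expi (- (z * x)) * trigC w x)) =
    shifted_trig w z (- (pi / 2)).
  apply/funext => x; rewrite (shifted_trig_eq z _ tw) /= cosN sinN.
  have -> : - (pi / 2) - pi / 2 = 0 - pi :> R by lra.
  by rewrite (trigNpi _ _ tw) [z * x]mulrC; ring.
rewrite /cintegrable1 /cint1 ReE ImE.
split; first by split; exact: shifted_trig_integrable tw.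
rewrite !(integral_shifted_trig _ _ tw) cos0 cosN cos_pihalf.
by apply/eqP; rewrite eq_complex/= !mulr1 !(mulr0, mul0r) !eqxx.
Qed.

Lemma fourier_itrans n (w : 'I_n -> R -> R) L (xi : 'cV[R]_n) :
  (forall i, test_fun L (w i)) ->
  fourier (itrans w) xi =
    (fourier_const (R := R) (n := n) * \prod_i (2 * pi * w i (xi i 0)))%:C.
Proof.
move=> tw; rewrite /fourier.
pose phi (i : 'I_n) (x : R) := expi (- (xi i 0 * x)) * trigC (w i) x.
have iphi i : cintegrable1 (phi i) by have [] := cint1_expi_trigC (xi i 0) (tw i).
have [_ e] := leb_cprod iphi.
have -> : (fun x => expi (- dot xi x) * itrans w x) =
   (fun x : 'cV[R]_n => \prod_i phi i (x i 0)).
  apply/funext => x; rewrite big_split/= -expi_sum; congr (expi _ * _).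
  by rewrite /dot sumrN.
rewrite e rmorphM rmorph_prod; congr (_ * _); apply: eq_bigr => i _.
by have [_ ->] := cint1_expi_trigC (xi i 0) (tw i).
Qed.

Lemma trig_even (w : R -> R) L (x : R) : test_fun L w -> (forall y, w (- y) = w y) ->
  trig (- (pi / 2)) w x = 0.
Proof.
move=> tw ew; rewrite /trig.
pose M : R := `|L|.
have LM : L <= M by exact: ler_norm.
have M0 : - M <= M by rewrite -subr_ge0 opprK addr_ge0 /M ?normr_ge0.
rewrite (integral_test_fun _ tw LM).
pose f y := w y * cos (x * y + - (pi / 2)).
rewrite -[LHS]/(\int[mu]_(y in `[- M, M]) f y).
have cf : continuous f.
  move=> y; apply: cvgM; first exact: (smooth_continuous tw.1).
  exact: continuous_cos_affine.
have fN y : f (- y) = - f y.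
  by rewrite /f ew mulrN !cosBpihalf sinN mulrN.
have : \int[mu]_(y in `[- M, M]) f y = - \int[mu]_(y in `[- M, M]) f y.
  have H : (\int[mu]_(y in `[(- M)%R, M]) (f y)%:E = \int[mu]_(y in `[(- M)%R, M]) ((f \o -%R) y)%:E)%E.
    have := @integration_by_substitution_oppr R f (- M) M M0; rewrite opprK; apply.
    exact: continuous_subspaceT.
  rewrite {1}/Rintegral H -[RHS]mulN1r -RintegralZl//; last exact: integrable_seg.
  by apply: eq_Rintegral => y _ /=; rewrite fN mulN1r.
lra.
Qed.

(** Evenness of the factors other than the first makes their transforms real ([trig_even]). Only one
    factor is then complex, and the real and imaginary parts of the product are single tensors
    instead of sums over subsets of coordinates. *)
Lemma schwartz_itrans n (w : 'I_n.+1 -> R -> R) L :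
  (forall i, test_fun L (w i)) ->
  (forall i y, w (lift ord0 i) (- y) = w (lift ord0 i) y) ->
  schwartz (itrans w).
Proof.
move=> tw ew.
have E x : itrans w x = tensor (fun i => trig 0 (w i)) x +i*
   tensor (fun i => if i == ord0 then trig (- (pi / 2)) (w i) else trig 0 (w i)) x.
  rewrite /itrans /tensor big_ord_recl [in X in X +i* _]big_ord_recl.
  rewrite [in X in _ +i* X]big_ord_recl eqxx.
  rewrite (eq_bigr (fun j => (trig 0 (w (lift ord0 j)) (x (lift ord0 j) 0))%:C)).
    rewrite -rmorph_prod /trigC.
    apply/eqP; rewrite eq_complex/= !mulr0 subr0 add0r eqxx/=.
    apply/eqP; rewrite mulrC; congr (_ * _).
  by move=> j _; rewrite /trigC (trig_even _ (tw _)).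
split.
  under eq_fun do rewrite E /=.
  by apply: schwartz_real_tensor => i m; exact: schwartz1_trig (tw i).
under eq_fun do rewrite E /=.
apply: schwartz_real_tensor => i m.
by case: ifP => _; exact: schwartz1_trig (tw i).
Qed.

End fourier_products.

(** * Uniqueness of the Fourier transform of integrable functions *)

Section step_polynomial.
Context {R : realType}.

Lemma bernoulli_ge (z : R) K : 0 <= z <= 1 -> 1 - K%:R * z <= (1 - z) ^+ K.
Proof.
move=> /andP[z0 z1]; elim: K => [|K ih]; first by rewrite mul0r subr0 expr0.
rewrite exprS; apply: (@le_trans _ _ ((1 - z) * (1 - K%:R * z))).
  rewrite -natr1; have : 0 <= K%:R * (z * z) by rewrite mulr_ge0// mulr_ge0.
  lra.
by rewrite ler_wpM2l// subr_ge0.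
Qed.

Lemma bernoulli_le (z : R) K : 0 <= z <= 1 -> (1 - z) ^+ K <= (1 + K%:R * z)^-1.
Proof.
move=> /andP[z0 z1].
have p : 0 < 1 + K%:R * z by rewrite ltr_wpDr// mulr_ge0.
rewrite -[leRHS]mul1r ler_pdivlMr//.
apply: (@le_trans _ _ ((1 - z) ^+ K * (1 + z) ^+ K)).
  rewrite ler_wpM2l//; first by rewrite exprn_ge0// subr_ge0.
  elim: K {p} => [|K ih]; first by rewrite mul0r addr0.
  rewrite exprS; apply: (@le_trans _ _ ((1 + z) * (1 + K%:R * z))).
    rewrite -natr1; have : 0 <= K%:R * (z * z) by rewrite mulr_ge0// mulr_ge0.
    lra.
  by rewrite ler_wpM2l// addr_ge0.
rewrite -exprMn exprn_ile1//; nra.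
Qed.

Lemma cvg_mulrn_expr (z : R) : 0 <= z < 1 -> m%:R * z ^+ m @[m --> \oo] --> 0.
Proof.
move=> /andP[z0 z1]; have [->|zn0] := eqVneq z 0.
  apply: (@cvg_trans _ (cst (0:R) m @[m --> \oo])); last exact: cvg_cst.
  by apply: near_eq_cvg; near=> m; rewrite expr0n gtn_eqF ?mulr0//; near: m; exact: nbhs_infty_gt.
have zp : 0 < z by rewrite lt_neqAle eq_sym zn0.
pose c := - ln z.
have c0 : 0 < c by rewrite oppr_gt0 ln_lt0// zp.
have [B B0 hB] := @polyexp_bounded R 'X^2.
have E m : z ^+ m = expR (- (m%:R * c)).
  by rewrite -mulrN opprK expRM_natl lnK.
apply: norm_cvg0.
apply: (@squeeze_cvgr _ _ _ _ (cst 0) (fun m => B / c ^+ 2 * m%:R^-1)).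
- near=> m; have m0 : (0 : R) < m%:R by rewrite ltr0n; near: m; exact: nbhs_infty_gt.
  have zm0 : 0 <= z ^+ m by rewrite exprn_ge0.
  have mc0 : 0 <= m%:R * c by rewrite mulr_ge0// ltW.
  rewrite normr_ge0/= ger0_norm; last by rewrite mulr_ge0// ltW.
  have := hB _ mc0; rewrite hornerXn (ger0_norm (exprn_ge0 _ mc0)) -E => h.
  rewrite ler_pdivlMr// ler_pdivlMr ?exprn_gt0//.
  by apply: le_trans h; rewrite le_eqVlt; apply/orP; left; apply/eqP; ring.
- exact: cvg_cst.
- rewrite -[X in _ --> X](mulr0 (B / c ^+ 2)); apply: cvgM; first exact: cvg_cst.
  apply/(gtr0_cvgV0 (f := fun m : nat => m%:R : R)); last exact: cvgr_idn.
  by near=> m; rewrite ltr0n; near: m; exact: nbhs_infty_gt.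
Unshelve. all: end_near. Qed.

(** A variant of the polynomials (1 - x^m)^(2^m) of the Brosowski-Deutsch proof of the
    Stone-Weierstrass theorem, with x = (1 - y) / 2. The extra factor m in the exponent forces the
    limit 0 also at y = 0, where 2 x = 1. *)
Definition step_poly (m : nat) : {poly R} :=
  (1 - (2^-1 *: (1 - 'X)) ^+ m) ^+ (m * 2 ^ m).

Lemma step_polyE m (y : R) :
  (step_poly m).[y] = (1 - ((1 - y) / 2) ^+ m) ^+ (m * 2 ^ m).
Proof. by rewrite /step_poly !(hornerE, horner_exp) [2^-1 * _]mulrC. Qed.

Lemma step_poly_01 m (y : R) : `|y| <= 1 -> `|(step_poly m).[y]| <= 1.
Proof.
rewrite ler_norml => /andP[y1 y2]; rewrite step_polyE.
have x01 : 0 <= (1 - y) / 2 <= 1 by apply/andP; split; lra.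
have z01 : 0 <= ((1 - y) / 2) ^+ m <= 1.
  by case/andP : x01 => x0 x1; rewrite exprn_ge0//= exprn_ile1.
case/andP : z01 => z0 z1.
rewrite normrX exprn_ile1// ger0_norm ?subr_ge0//.
by rewrite gerBl.
Qed.

(** Everything is governed by m (2 x)^m with x = (1 - y) / 2. For y > 0 it tends to 0 and Bernoulli
    pushes the value to 1; for y <= 0 it is at least m and the value is at most 1 / (1 + m). *)
Lemma cvg_step_poly (y : R) : `|y| <= 1 ->
  (step_poly m).[y] @[m --> \oo] --> ((0 < y)%R%:R : R).
Proof.
move=> y1; have := y1; rewrite ler_norml => /andP[ym1 yp1].
set x := (1 - y) / 2.
have x01 : 0 <= x <= 1 by rewrite /x; apply/andP; split; lra.
have z01 m : 0 <= x ^+ m <= 1.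
  by case/andP : x01 => x0 x1; rewrite exprn_ge0//= exprn_ile1.
have E m : (m * 2 ^ m)%:R * x ^+ m = m%:R * (2 * x) ^+ m.
  by rewrite natrM natrX [(2 * x) ^+ m]exprMn; ring.
have [y0|y0] := ltP 0 y.
- apply: (@squeeze_cvgr _ _ _ _ (fun m => 1 - m%:R * (2 * x) ^+ m) (cst 1)).
  + near=> m; apply/andP; split.
      by rewrite step_polyE -E; exact: bernoulli_ge.
    by apply: le_trans (@step_poly_01 m y y1); exact: ler_norm.
  + rewrite -[X in _ --> X]subr0; apply: cvgB; first exact: cvg_cst.
    by apply: cvg_mulrn_expr; rewrite /x; apply/andP; split; lra.
  + exact: cvg_cst.
- apply: (@squeeze_cvgr _ _ _ _ (cst 0) (fun m => m.+1%:R^-1)).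
  + near=> m; rewrite step_polyE -/x; apply/andP; split.
      by rewrite exprn_ge0// subr_ge0; have /andP[] := z01 m.
    apply: le_trans (bernoulli_le _ (z01 m)) _.
    rewrite lef_pV2 ?posrE//; last by rewrite ltr_wpDr// mulr_ge0//; have /andP[] := z01 m.
    rewrite -natr1 addrC lerD2l E ler_peMr//.
    by rewrite exprn_ege1// /x; lra.
  + exact: cvg_cst.
  + exact: cvg_harmonic.
Unshelve. all: end_near. Qed.

End step_polynomial.

Section uniqueness.
Context {R : realType} {n : nat}.
Local Notation Rn := 'cV[R]_n.
Local Notation nu := (@leb R n).
Implicit Types (x y : Rn) (F G : Rn -> R) (A : set Rn).

Lemma measurable_dot x : measurable_fun setT (fun xi : Rn => dot x xi).
Proof.
rewrite /dot; apply: measurable_sum => i.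
by apply: measurable_funM => //; exact: measurable_coord.
Qed.

Lemma measurable_cos_dot x (t : R) : measurable_fun setT (fun xi : Rn => cos (dot x xi + t)).
Proof.
apply: measurableT_comp.
  by apply: continuous_measurable_fun; exact: continuous_cos.
by apply: measurable_funD => //; exact: measurable_dot.
Qed.

Lemma dotDl x y (z : Rn) : dot (x + y) z = dot x z + dot y z.
Proof. by rewrite /dot -big_split/=; apply: eq_bigr => i _; rewrite mxE mulrDl. Qed.

Lemma dotNl x (z : Rn) : dot (- x) z = - dot x z.
Proof. by rewrite /dot -sumrN; apply: eq_bigr => i _; rewrite mxE mulNr. Qed.

Lemma dotZl (a : R) x (z : Rn) : dot (a *: x) z = a * dot x z.
Proof. by rewrite /dot mulr_sumr; apply: eq_bigr => i _; rewrite mxE mulrA. Qed.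

Lemma dotC x y : dot x y = dot y x.
Proof. by apply: eq_bigr => i _; rewrite mulrC. Qed.

Lemma dot_basis (j : 'I_n) (z : Rn) : dot (basis_vec j) z = z j 0.
Proof.
rewrite /dot (bigD1 j)//= /basis_vec mxE !eqxx mul1r big1 ?addr0// => i ij.
by rewrite mxE (negbTE ij) mul0r.
Qed.

Variable h : Rn -> R.
Hypothesis ih : nu.-integrable setT (EFin \o h).
Hypothesis h0 : forall x (t : R), \int[nu]_xi (cos (dot x xi + t) * h xi) = 0.

(* This class is stable under multiplication by cosines and under bounded
   limits, hence (step polynomials of sines) by indicators of half-spaces. *)
Definition annihilated F := [/\ measurable_fun setT F,
  exists K, forall xi, `|F xi| <= K &
  forall x (t : R), \int[nu]_xi (F xi * (cos (dot x xi + t) * h xi)) = 0].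

Let mh : measurable_fun setT h.
Proof. by apply/measurable_EFinP; exact: (measurable_int nu ih). Qed.

Let icos x (t : R) : nu.-integrable setT (EFin \o (fun xi => cos (dot x xi + t) * h xi)).
Proof.
apply: (le_integrable _ _ _ ih) => //.
  by apply/measurable_EFinP; apply: measurable_funM => //; exact: measurable_cos_dot.
by move=> xi _; rewrite /= lee_fin normrM ler_piMl// cos_max.
Qed.

Let iF F x (t : R) : annihilated F ->
  nu.-integrable setT (EFin \o (fun xi => F xi * (cos (dot x xi + t) * h xi))).
Proof.
move=> [mF [K hK] _].
have iK := integrableZl measurableT `|K| (integrable_norm (icos x t)).
apply: (le_integrable _ _ _ iK) => //.
  apply/measurable_EFinP; apply: measurable_funM => //; apply: measurable_funM => //.
  exact: measurable_cos_dot.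
move=> xi _; rewrite /= lee_fin normrM [leRHS]normrM !normr_id ler_wpM2r//.
by rewrite (le_trans (hK xi))// ler_norm.
Qed.

Lemma annihilated1 : annihilated (cst 1).
Proof.
split; first exact: measurable_cst.
  by exists 1 => xi; rewrite normr1.
by move=> x t; under eq_Rintegral do rewrite mul1r; exact: h0.
Qed.

Lemma annihilatedD F G : annihilated F -> annihilated G ->
  annihilated (fun xi => F xi + G xi).
Proof.
move=> aF aG; have [mF [K hK] F0] := aF; have [mG [L hL] G0] := aG; split.
- exact: measurable_funD.
- by exists (K + L) => xi; rewrite (le_trans (ler_normD _ _))// lerD.
- move=> x t; under eq_Rintegral do rewrite mulrDl.
  rewrite RintegralD//; [by rewrite F0 G0 addr0|exact: iF..].
Qed.

Lemma annihilatedZ (a : R) F : annihilated F -> annihilated (fun xi => a * F xi).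
Proof.
move=> aF; have [mF [K hK] F0] := aF; split.
- exact: measurable_funM.
- by exists (`|a| * K) => xi; rewrite normrM ler_wpM2l.
- move=> x t; under eq_Rintegral do rewrite -mulrA.
  by rewrite RintegralZl//; [rewrite F0 mulr0|exact: iF].
Qed.

Lemma annihilatedB F G : annihilated F -> annihilated G ->
  annihilated (fun xi => F xi - G xi).
Proof.
move=> aF aG; have := annihilatedD aF (annihilatedZ (-1) aG).
by under [fun _ => _]eq_fun do rewrite mulN1r.
Qed.

(** The product of two cosines is a half-sum of cosines of x + y and x - y; this is why
    [annihilated] quantifies over all frequencies and phases. *)
Lemma annihilated_cos F y (s : R) : annihilated F ->
  annihilated (fun xi => F xi * cos (dot y xi + s)).
Proof.
move=> aF; have [mF [K hK] F0] := aF; split.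
- by apply: measurable_funM => //; exact: measurable_cos_dot.
- by exists K => xi; rewrite normrM (le_trans _ (hK xi))// ler_piMr// cos_max.
- move=> x t.
  have E xi : F xi * cos (dot y xi + s) * (cos (dot x xi + t) * h xi) =
      2^-1 * (F xi * (cos (dot (x + y) xi + (t + s)) * h xi)) +
      2^-1 * (F xi * (cos (dot (x - y) xi + (t - s)) * h xi)).
    rewrite !dotDl dotNl.
    have -> : dot x xi + dot y xi + (t + s) = (dot x xi + t) + (dot y xi + s) by ring.
    have -> : dot x xi - dot y xi + (t - s) = (dot x xi + t) - (dot y xi + s) by ring.
    by move: (dot x xi + t) (dot y xi + s) => X Y; rewrite cosD cosB; field.
  under eq_Rintegral do rewrite E.
  have i1 := iF (x + y) (t + s) aF; have i2 := iF (x - y) (t - s) aF.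
  rewrite RintegralD//; [|exact: (integrableZl measurableT _ i1)|exact: (integrableZl measurableT _ i2)].
  by rewrite !RintegralZl// !F0 !mulr0 addr0.
Qed.

Lemma annihilated_poly F y (s : R) (p : {poly R}) : annihilated F ->
  annihilated (fun xi => F xi * p.[sin (dot y xi + s)]).
Proof.
elim/poly_ind: p F => [|p c IH] F aF.
  under eq_fun do rewrite horner0 mulrC; exact: annihilatedZ.
have a1 := IH _ (annihilated_cos y (s - pi / 2) aF).
have := annihilatedD a1 (annihilatedZ c aF).
congr annihilated; apply/funext => xi.
by rewrite addrA cosBpihalf !hornerE; ring.
Qed.

Lemma annihilated_lim (F_ : nat -> Rn -> R) F (K : R) :
  (forall m, annihilated (F_ m)) -> (forall m xi, `|F_ m xi| <= K) ->
  (forall xi, F_ m xi @[m --> \oo] --> F xi) -> annihilated F.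
Proof.
move=> aF bF cF.
have mF : measurable_fun setT F.
  apply: (measurable_fun_cvg (h := F_)) => [m|xi _]; last exact: cF.
  by have [] := aF m.
have FK xi : `|F xi| <= K.
  have c : `|F_ m xi| @[m --> \oo] --> `|F xi| by apply: cvg_norm.
  rewrite -(cvg_lim (@Rhausdorff R) c); apply: limr_le; first by apply/cvg_ex; exists `|F xi|.
  exact: nearW.
split=> //; first by exists K.
move=> x t.
have iK := integrableZl measurableT `|K| (integrable_norm (icos x t)).
have [] := @dominated_convergence _ _ _ nu setT measurableT
  (fun m => EFin \o (fun xi => F_ m xi * (cos (dot x xi + t) * h xi)))
  (EFin \o (fun xi => F xi * (cos (dot x xi + t) * h xi))) _ _ _ _ iK.
- move=> m; exact: (measurable_int nu (iF x t (aF m))).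
- apply/measurable_EFinP; apply: measurable_funM => //.
  by apply: measurable_funM => //; exact: measurable_cos_dot.
- apply: aeW => xi _; apply: cvg_EFin; first exact: nearW.
  by apply: cvgM; [exact: cF|exact: cvg_cst].
- apply: aeW => xi m _; rewrite /= lee_fin normrM ler_wpM2r//.
  by rewrite (le_trans (bF m xi))// ler_norm.
move=> i _ cv.
have e m : (\int[nu]_xi (EFin \o (fun xi => F_ m xi * (cos (dot x xi + t) * h xi))%R) xi = 0)%E.
  have := integrable_fin_num measurableT (iF x t (aF m)).
  by move/fineK => <-; have [_ _ /(_ x t) e] := aF m; rewrite [X in X%:E]e.
rewrite /Rintegral.
have : ([sequence (\int[nu]_xi (EFin \o (fun xi => F_ m xi * (cos (dot x xi + t) * h xi))%R) xi)%E]_m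
   @ \oo --> 0%E).
  by apply: cvg_near_cst; apply: nearW => m; exact: e.
move/(cvg_unique (@ereal_hausdorff R) cv) => /= ->.
by [].
Qed.

Lemma annihilated_sin_gt0 F y (s : R) : annihilated F ->
  annihilated (fun xi => F xi * (0 < sin (dot y xi + s))%R%:R).
Proof.
move=> aF; have [_ [K hK] _] := aF.
apply: (@annihilated_lim (fun m xi => F xi * (step_poly m).[sin (dot y xi + s)]) _ K).
- by move=> m; exact: annihilated_poly.
- move=> m xi; rewrite normrM (le_trans _ (hK xi))// ler_piMr//.
  by apply: step_poly_01; exact: sin_max.
- by move=> xi; apply: cvgM; [exact: cvg_cst|apply: cvg_step_poly; exact: sin_max].
Qed.

(** The periodic sets where sin (T (xi_j - a)) > 0 are stretched by T = 1 / (m + 1). For fixed xi,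
    eventually T |xi_j - a| < pi and the sine has the sign of xi_j - a. *)
Lemma annihilated_ray F (j : 'I_n) (a : R) : annihilated F ->
  annihilated (fun xi => F xi * (a < xi j 0)%R%:R).
Proof.
move=> aF; have [_ [K hK] _] := aF.
pose T m : R := m.+1%:R^-1.
apply: (@annihilated_lim (fun m xi => F xi *
  (0 < sin (dot (T m *: basis_vec j) xi + - (T m * a)))%R%:R) _ K).
- by move=> m; exact: annihilated_sin_gt0.
- by move=> m xi; rewrite normrM (le_trans _ (hK xi))// ler_piMr//; rewrite normr_nat lern1 leq_b1.
- move=> xi; apply: cvgM; first exact: cvg_cst.
  apply: cvg_near_cst.
  have c0 : T m * (xi j 0 - a) @[m --> \oo] --> (0 : R).
    rewrite -(mul0r (xi j 0 - a)); apply: cvgM; last exact: cvg_cst.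
    exact: cvg_harmonic.
  have pi0 := @pi_gt0 R.
  near=> m.
  have T0 : 0 < T m by rewrite /T invr_gt0.
  have b1 : T m * (xi j 0 - a) < pi by near: m; exact: (cvgr_lt _ c0).
  have b2 : - pi < T m * (xi j 0 - a) by near: m; apply: (cvgr_gt _ c0); rewrite oppr_lt0.
  congr (_%:R); congr nat_of_bool.
  rewrite dotZl dot_basis -mulrBr.
  have [h1|h1] := ltP a (xi j 0).
    by apply: sin_gt0_pi; rewrite b1 mulr_gt0// subr_gt0.
  apply/negbTE; rewrite -leNgt -oppr_ge0 -sinN.
  apply: sin_ge0_pi; apply/andP; split; last by rewrite lerNl ltW.
  by rewrite oppr_ge0 pmulr_rle0// subr_le0.
Unshelve. all: end_near. Qed.

(** Quantifying over all annihilated F, and not only the constant 1, makes these sets stable under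
    intersection. They form a sigma-algebra, so generators suffice and no monotone class argument is
    needed. *)
Definition annihilated_set A := forall F, annihilated F ->
  annihilated (fun xi => F xi * \1_A xi).

Lemma annihilated_setC A : annihilated_set A -> annihilated_set (~` A).
Proof.
move=> aA F aF; have := annihilatedB aF (aA F aF).
congr annihilated; apply/funext => xi; rewrite !indicE in_setC.
by case: (_ \in A); rewrite /= ?mulr0 ?mulr1 ?subrr ?subr0.
Qed.

Lemma annihilated_set_bigcap (A_ : nat -> set Rn) :
  (forall i, annihilated_set (A_ i)) -> annihilated_set (\bigcap_i A_ i).
Proof.
move=> aA F aF; have [_ [K hK] _] := aF.
apply: (@annihilated_lim (fun m xi => F xi * \prod_(i < m) \1_(A_ i) xi) _ K).
- elim=> [|m IH]; first by under eq_fun do rewrite big_ord0 mulr1.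
  under eq_fun do rewrite big_ord_recr/= mulrA.
  exact: aA.
- move=> m xi; rewrite normrM (le_trans _ (hK xi))// ler_piMr// normr_prod.
  by apply: prodr_ile1 => i _; rewrite normr_ge0/= indicE; case: (_ \in _); rewrite ?normr1 ?normr0.
- move=> xi; apply: cvgM; first exact: cvg_cst.
  apply: cvg_near_cst; rewrite indicE.
  have [hA|/existsNP[i /not_implyP[_ hi]]] := pselect ((\bigcap_i A_ i) xi).
    rewrite mem_set//; apply: nearW => m; rewrite big1// => i _.
    by rewrite indicE mem_set//; exact: hA.
  rewrite memNset; last by move=> H; exact/hi/H.
  near=> m; have im : (i < m)%N by near: m; exact: nbhs_infty_gt.
  by rewrite (bigD1 (Ordinal im))//= indicE memNset// mul0r.
Unshelve. all: end_near. Qed.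

Lemma annihilated_setT : annihilated_set setT.
Proof. by move=> F aF; under eq_fun do rewrite indicT mulr1. Qed.

Lemma annihilated_set_bigcup (A_ : nat -> set Rn) :
  (forall i, annihilated_set (A_ i)) -> annihilated_set (\bigcup_i A_ i).
Proof.
move=> aA; rewrite -[X in annihilated_set X]setCK setC_bigcup.
by apply: annihilated_setC; apply: annihilated_set_bigcap => i; exact: annihilated_setC.
Qed.

Lemma annihilated_coord (i : 'I_n) (B : set R) : measurable B ->
  annihilated_set ((fun xi : Rn => xi i 0) @^-1` B).
Proof.
pose D := [set B : set R | annihilated_set ((fun xi : Rn => xi i 0) @^-1` B)].
suff : (@measurable _ (measurableTypeR R) `<=` D)%classic by move=> s /s.
rewrite RGenOInfty.measurableE; apply: smallest_sub.
  split.
  - by rewrite /D/= preimage_set0 -setCT; exact/annihilated_setC/annihilated_setT.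
  - by move=> A /annihilated_setC; rewrite /D /= setTD preimage_setC.
  - by move=> A_ aA; rewrite /D /= preimage_bigcup; exact: annihilated_set_bigcup.
move=> _ [a ->] F aF; rewrite /=.
have := annihilated_ray i a aF; congr annihilated; apply/funext => xi.
rewrite indicE; congr (_ * _%:R); congr nat_of_bool; apply/idP/idP => [axi|/set_mem].
  by apply/mem_set; rewrite /= in_itv/= andbT.
by rewrite /= in_itv/= andbT.
Qed.

Lemma annihilated_measurable A : measurable A -> annihilated_set A.
Proof.
suff : (@measurable _ Rn `<=` annihilated_set)%classic by apply.
apply: smallest_sub.
  split.
  - by rewrite -setCT; exact/annihilated_setC/annihilated_setT.
  - by move=> B /annihilated_setC; rewrite setTD.
  - exact: annihilated_set_bigcup.
move=> _ [i [j [B mB ->]]]; rewrite (ord1 j); exact: annihilated_coord.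
Qed.

(** Testing the indicator of A at frequency 0 and phase 0 says that h has integral 0 over every
    measurable A. *)
Lemma ae_eq0_of_annihilated : ae_eq nu setT (EFin \o h) (cst 0%E).
Proof.
apply: (integral_ae_eq measurableT ih); first exact: measurable_cst.
move=> A _ mA; rewrite integral0.
have [_ _ /(_ 0 0)] := annihilated_measurable mA annihilated1.
have d0 xi : dot (0 : Rn) xi = 0 by rewrite /dot big1// => i _; rewrite mxE mul0r.
under eq_Rintegral do rewrite mul1r d0 add0r cos0 mul1r mulrC.
move=> e.
have iA : nu.-integrable A (EFin \o h) by exact: integrableS ih.
rewrite -(fineK (integrable_fin_num mA iA)); congr EFin.
rewrite -[LHS]/(\int[nu]_(xi in A) h xi) Rintegral_mkcond -[RHS]e.
apply: eq_Rintegral => xi _; rewrite patchE indicE.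
by case: ifP; rewrite ?mulr1 ?mulr0.
Qed.

End uniqueness.

(** * Injectivity of the inverse transform and Fourier multipliers *)

Section spectrum.
Context {R : realType} {n : nat}.
Local Notation Rn := 'cV[R]_n.
Local Notation C := R[i].
Local Notation nu := (@leb R n).
Implicit Types (x xi : Rn) (m u : Rn -> C).

Lemma fourier_const_gt0 : 0 < fourier_const (R := R) (n := n).
Proof. by rewrite /fourier_const powR_gt0// mulr_gt0// pi_gt0. Qed.

Lemma measurable_sin_dot x : measurable_fun setT (fun xi : Rn => sin (dot x xi)).
Proof.
apply: measurableT_comp; last exact: measurable_dot.
by apply: continuous_measurable_fun; exact: continuous_sin.
Qed.

Lemma measurable_cos_dot0 x : measurable_fun setT (fun xi : Rn => cos (dot x xi)).
Proof. by have := measurable_cos_dot x 0; under eq_fun do rewrite addr0. Qed.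

Lemma Re_expi_mul x xi (z : C) : complex.Re (expi (dot x xi) * z) =
  cos (dot x xi) * complex.Re z - sin (dot x xi) * complex.Im z.
Proof. by rewrite Re_mul. Qed.

Lemma Im_expi_mul x xi (z : C) : complex.Im (expi (dot x xi) * z) =
  cos (dot x xi) * complex.Im z + sin (dot x xi) * complex.Re z.
Proof. by rewrite Im_mul. Qed.

Lemma integrable_bounded_mul (f g : Rn -> R) : measurable_fun setT f ->
  (forall xi, `|f xi| <= 1) -> nu.-integrable setT (EFin \o g) ->
  nu.-integrable setT (EFin \o (fun xi => f xi * g xi)).
Proof.
move=> mf f1 ig; under eq_fun do rewrite mulrC.
exact: integrable_bounded_kernel.
Qed.

Lemma cintegral_expi x m : cintegrable m ->
  cintegral (fun xi => expi (dot x xi) * m xi) =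
  (\int[nu]_xi (cos (dot x xi) * complex.Re (m xi)) -
   \int[nu]_xi (sin (dot x xi) * complex.Im (m xi))) +i*
  (\int[nu]_xi (cos (dot x xi) * complex.Im (m xi)) +
   \int[nu]_xi (sin (dot x xi) * complex.Re (m xi))).
Proof.
move=> [ir ii]; rewrite /cintegral.
under eq_Rintegral do rewrite Re_expi_mul.
under [X in _ +i* X]eq_Rintegral do rewrite Im_expi_mul.
have c1 xi : `|cos (dot x xi)| <= 1 by exact: cos_max.
have s1 xi : `|sin (dot x xi)| <= 1 by exact: sin_max.
have mc := measurable_cos_dot0 x; have ms := measurable_sin_dot x.
by rewrite RintegralB ?RintegralD//; exact: integrable_bounded_mul.
Qed.

Lemma ae_eq0_of_fourier (h : Rn -> R) : nu.-integrable setT (EFin \o h) ->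
  (forall x, \int[nu]_xi (cos (dot x xi) * h xi) = 0) ->
  (forall x, \int[nu]_xi (sin (dot x xi) * h xi) = 0) ->
  ae_eq nu setT (EFin \o h) (cst 0%E).
Proof.
move=> ih hc hs; apply: (@ae_eq0_of_annihilated R n h ih) => x t.
have c1 xi : `|cos (dot x xi)| <= 1 by exact: cos_max.
have s1 xi : `|sin (dot x xi)| <= 1 by exact: sin_max.
have ic := integrable_bounded_mul (measurable_cos_dot0 x) c1 ih.
have is_ := integrable_bounded_mul (measurable_sin_dot x) s1 ih.
have E xi : cos (dot x xi + t) * h xi =
    cos t * (cos (dot x xi) * h xi) - sin t * (sin (dot x xi) * h xi).
  by rewrite cosD; ring.
under eq_Rintegral do rewrite E.
rewrite RintegralB//; [|exact: (integrableZl measurableT _ ic)|exact: (integrableZl measurableT _ is_)].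
by rewrite !RintegralZl// hc hs !mulr0 subrr.
Qed.

Lemma inv_fourier_inj m1 m2 : cintegrable m1 -> cintegrable m2 ->
  (forall x, inv_fourier m1 x = inv_fourier m2 x) ->
  ae_eq nu setT (EFin \o (fun xi => complex.Re (m1 xi))) (EFin \o (fun xi => complex.Re (m2 xi))) /\
  ae_eq nu setT (EFin \o (fun xi => complex.Im (m1 xi))) (EFin \o (fun xi => complex.Im (m2 xi))).
Proof.
move=> i1 i2 e12.
have [r1 j1] := i1; have [r2 j2] := i2.
have fcn0 : (fourier_const (R := R) (n := n))%:C != 0.
  by rewrite -(rmorph0 (real_complex R)) (inj_eq (@complexI R)) gt_eqF// fourier_const_gt0.
have c1 x xi : `|cos (dot x xi)| <= 1 by exact: cos_max.
have s1 x xi : `|sin (dot x xi)| <= 1 by exact: sin_max.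
have ic x g := integrable_bounded_mul (g := g) (measurable_cos_dot0 x) (c1 x).
have is_ x g := integrable_bounded_mul (g := g) (measurable_sin_dot x) (s1 x).
pose cr m x := \int[nu]_xi (cos (dot x xi) * complex.Re (m xi)).
pose ci m x := \int[nu]_xi (cos (dot x xi) * complex.Im (m xi)).
pose sr m x := \int[nu]_xi (sin (dot x xi) * complex.Re (m xi)).
pose si m x := \int[nu]_xi (sin (dot x xi) * complex.Im (m xi)).
have H x : cr m1 x - si m1 x = cr m2 x - si m2 x /\ ci m1 x + sr m1 x = ci m2 x + sr m2 x.
  have := mulfI fcn0 (e12 x); rewrite (cintegral_expi x i1) (cintegral_expi x i2).
  by case=> ? ?.
have dN x xi : dot (- x) xi = - dot x xi by exact: dotNl.
have crN m x : cr m (- x) = cr m x by apply: eq_Rintegral => xi _; rewrite dN cosN.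
have ciN m x : ci m (- x) = ci m x by apply: eq_Rintegral => xi _; rewrite dN cosN.
have srN m x : cintegrable m -> sr m (- x) = - sr m x.
  move=> [ir _]; rewrite /sr -mulN1r -RintegralZl//; last exact: is_.
  by apply: eq_Rintegral => xi _; rewrite dN sinN mulN1r mulNr.
have siN m x : cintegrable m -> si m (- x) = - si m x.
  move=> [_ ii]; rewrite /si -mulN1r -RintegralZl//; last exact: is_.
  by apply: eq_Rintegral => xi _; rewrite dN sinN mulN1r mulNr.
(* Equality at x only compares combinations of real and imaginary parts. Cosine integrals are even
   in x and sine integrals odd, so comparing x and - x separates the four terms. *)
have K x : [/\ cr m1 x = cr m2 x, si m1 x = si m2 x, ci m1 x = ci m2 x & sr m1 x = sr m2 x].
  have [h1 h2] := H x; have [] := H (- x).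
  rewrite !crN !ciN !srN// !siN// => h3 h4; split; lra.
have ae (g1 g2 : Rn -> R) : nu.-integrable setT (EFin \o g1) ->
    nu.-integrable setT (EFin \o g2) ->
    (forall x, \int[nu]_xi (cos (dot x xi) * g1 xi) = \int[nu]_xi (cos (dot x xi) * g2 xi)) ->
    (forall x, \int[nu]_xi (sin (dot x xi) * g1 xi) = \int[nu]_xi (sin (dot x xi) * g2 xi)) ->
    ae_eq nu setT (EFin \o g1) (EFin \o g2).
  move=> ig1 ig2 hc hs.
  have := @ae_eq0_of_fourier (fun xi => g1 xi - g2 xi) (integrableB measurableT ig1 ig2).
  move=> h; have {}h : ae_eq nu setT (EFin \o (fun xi => g1 xi - g2 xi)) (cst 0%E).
    apply: h => x; under eq_Rintegral do rewrite mulrBr.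
      by rewrite RintegralB//; [rewrite hc subrr|exact: ic..].
    by rewrite RintegralB//; [rewrite hs subrr|exact: is_..].
  apply: filterS h => xi h /h /= [/eqP]; rewrite subr_eq0 => /eqP ->.
  by [].
by split; apply: ae => // x; have [] := K x.
Qed.

(** [spectrum] picks some integrable function with the given inverse transform; injectivity makes it
    equal to m almost everywhere, and the integral defining the multiplier does not see the
    difference. *)
Lemma fourier_multiplier_inv (sigma : Rn -> R) m : measurable_fun setT sigma ->
  cintegrable m -> forall x,
  fourier_multiplier sigma (inv_fourier m) x =
  inv_fourier (fun xi => (sigma xi)%:C * m xi) x.
Proof.
move=> ms im x; rewrite /fourier_multiplier.
set s := spectrum _.
have [is_ es] : is_spectrum (inv_fourier m) s.
  by apply: (@xgetPex _ (fun=> 0) [set m' | is_spectrum (inv_fourier m) m']); exists m.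
have [aer aei] := inv_fourier_inj im is_ es.
rewrite /inv_fourier; congr (_ * _).
have [mr mi] := im; have [sr si] := is_.
have mmr : measurable_fun setT (fun xi => complex.Re (m xi)) by apply/measurable_EFinP; exact: (measurable_int nu mr).
have mmi : measurable_fun setT (fun xi => complex.Im (m xi)) by apply/measurable_EFinP; exact: (measurable_int nu mi).
have msr : measurable_fun setT (fun xi => complex.Re (s xi)) by apply/measurable_EFinP; exact: (measurable_int nu sr).
have msi : measurable_fun setT (fun xi => complex.Im (s xi)) by apply/measurable_EFinP; exact: (measurable_int nu si).
have mcos := measurable_cos_dot0 x; have msin := measurable_sin_dot x.
have ReE (g : Rn -> C) xi : complex.Re (expi (dot x xi) * ((sigma xi)%:C * g xi)) =
    cos (dot x xi) * (sigma xi * complex.Re (g xi)) - sin (dot x xi) * (sigma xi * complex.Im (g xi)).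
  by rewrite Re_expi_mul Re_mul Im_mul /=; ring.
have ImE (g : Rn -> C) xi : complex.Im (expi (dot x xi) * ((sigma xi)%:C * g xi)) =
    cos (dot x xi) * (sigma xi * complex.Im (g xi)) + sin (dot x xi) * (sigma xi * complex.Re (g xi)).
  by rewrite Im_expi_mul Re_mul Im_mul /=; ring.
rewrite /cintegral; congr (_ +i* _).
- apply/esym; congr fine; apply: ae_eq_integral => //.
  + apply/measurable_EFinP; under eq_fun do rewrite ReE.
    by apply: measurable_funB; apply: measurable_funM => //; apply: measurable_funM.
  + apply/measurable_EFinP; under eq_fun do rewrite ReE.
    by apply: measurable_funB; apply: measurable_funM => //; apply: measurable_funM.
  + apply: filterS2 aer aei => xi h1 h2 _; rewrite !ReE.
    by case: (h1 I) => ->; case: (h2 I) => ->.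
- apply/esym; congr fine; apply: ae_eq_integral => //.
  + apply/measurable_EFinP; under eq_fun do rewrite ImE.
    by apply: measurable_funD; apply: measurable_funM => //; apply: measurable_funM.
  + apply/measurable_EFinP; under eq_fun do rewrite ImE.
    by apply: measurable_funD; apply: measurable_funM => //; apply: measurable_funM.
  + apply: filterS2 aer aei => xi h1 h2 _; rewrite !ImE.
    by case: (h1 I) => ->; case: (h2 I) => ->.
Qed.

End spectrum.

(** * Integrability of the symbol near its singular subspace *)

Section sublevel.
Context {R : realType}.
Local Notation mu := (@lebesgue_measure R).

(** Tonelli: for a fixed tail in T, the first coordinate ranges over an interval of length 2 e whose
    centre may depend on the tail. *)
Lemma leb_le_section n (S : set 'cV[R]_n.+1) (T : set 'cV[R]_n) (c : 'cV[R]_n -> R) (e : R) :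
  measurable S -> measurable T -> 0 <= e ->
  (forall xi, S xi -> T (vtail xi) /\ `|xi ord0 0 - c (vtail xi)| <= e) ->
  (leb n.+1 S <= (2 * e)%:E * leb n T)%E.
Proof.
move=> mS mT e0 ST.
pose E := @vcons R n @^-1` S.
have mE : measurable E by rewrite -[E]setTI; exact: measurable_vconsR.
have -> : leb n.+1 S = (mu \x leb n)%E E by [].
have -> : ((mu \x leb n)%E E = \int[(mu \x leb n)%E]_z (\1_E z)%:E)%E.
  by rewrite integral_indic// setIT.
have m1E : measurable_fun setT (EFin \o \1_E : (measurableTypeR R * 'cV[R]_n)%type -> \bar R).
  by apply/measurable_EFinP; exact: measurable_indic.
rewrite (fubini_tonelli2 (m1 := mu) (m2 := leb n) _ m1E) => [|z]; last by rewrite lee_fin.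
have m1T : measurable_fun setT (fun y => (\1_T y)%:E : \bar R).
  by apply/measurable_EFinP; exact: measurable_indic.
have -> : ((2 * e)%:E * leb n T = \int[leb n]_y ((2 * e)%:E * (\1_T y)%:E))%E.
  rewrite ge0_integralZl ?lee_fin ?mulr_ge0//.
  by rewrite integral_indic// setIT.
apply: ge0_le_integral => //.
- by move=> y _; apply: integral_ge0 => x _; rewrite lee_fin.
- by apply: (measurable_fun_fubini_tonelli_G _ m1E) => z; rewrite lee_fin.
- exact: measurable_funeM.
move=> y _; rewrite /fubini_G.
have [yT|yT] := pselect (T y); last first.
  rewrite integral0_eq; first by rewrite mule_ge0// lee_fin// mulr_ge0.
  move=> x _ /=; rewrite indicE memNset// => /= /ST[].
  by rewrite vconsK.
rewrite [X in (_ <= _ * X)%E](_ : _ = 1%E); last by rewrite indicE mem_set.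
rewrite mule1.
apply: (@le_trans _ _ (\int[mu]_x (\1_(`[c y - e, c y + e]%classic) x)%:E)%E).
  apply: ge0_le_integral => //.
  - by move=> x _; rewrite lee_fin.
  - exact: (measurableT_comp m1E (measurable_pair2 y)).
  - by apply/measurable_EFinP; exact: measurable_indic.
  move=> x _; rewrite /= lee_fin !indicE.
  have [/set_mem/ST|_] := boolP ((x, y) \in E); last by rewrite ler0n.
  rewrite vconsK vcons0/= => -[_]; rewrite ler_distl => H.
  by rewrite mem_set//= in_itv.
have ->: (\int[mu]_x (\1_(`[c y - e, c y + e]%classic) x)%:E = mu `[(c y - e)%R, (c y + e)%R]%classic)%E.
  by have := integral_indic mu measurableT (measurable_itv `[c y - e, c y + e]); rewrite setIT.
rewrite lebesgue_measure_itv/= lte_fin; case: ifP => _.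
  by rewrite -EFinB lee_fin; lra.
by rewrite lee_fin mulr_ge0.
Qed.

Definition sublevel n k (A : 'M[R]_(k, n)) (B rho : R) : set 'cV[R]_n :=
  [set xi : 'cV[R]_n | (forall j, `|xi j 0| <= B) /\ forall i, `|(A *m xi) i 0| <= rho].

Lemma measurable_forall_ord n k (P : 'I_k -> set 'cV[R]_n) :
  (forall i, measurable (P i)) -> measurable [set xi | forall i, P i xi].
Proof.
move=> mP; rewrite (_ : [set _ | _] = \bigcap_(i in [set: 'I_k]) P i); last first.
  by apply/seteqP; split => y /= h i => [_|]; exact: h.
by apply: fin_bigcap_measurable => // i _.
Qed.

Lemma measurable_le_cst n (f : 'cV[R]_n -> R) (a : R) : measurable_fun setT f ->
  measurable [set xi | f xi <= a].
Proof.
move=> mf; have := mf measurableT _ (measurable_itv `]-oo, a]%R); rewrite setTI.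
by congr measurable; apply/seteqP; split => xi /=; rewrite in_itv.
Qed.

Lemma measurable_mulmx n k (A : 'M[R]_(k, n)) (i : 'I_k) :
  measurable_fun setT (fun xi : 'cV[R]_n => (A *m xi) i 0).
Proof.
under eq_fun do rewrite mxE; apply: measurable_sum => j.
by apply: measurable_funM => //; exact: measurable_coord.
Qed.

Lemma measurable_sublevel n k (A : 'M[R]_(k, n)) (B rho : R) :
  measurable (sublevel A B rho).
Proof.
apply: measurableI; apply: measurable_forall_ord => i; apply: measurable_le_cst.
  by apply: measurableT_comp => //; exact: measurable_coord.
by apply: measurableT_comp => //; exact: measurable_mulmx.
Qed.

(** Gaussian elimination, one coordinate at a time. A coordinate absent from all equations costs a
    factor 2 B; otherwise a pivot equation confines it to an interval of length proportional to rho
    and k drops by 1. Independence of the k rows guarantees k pivots, hence rho^k. *)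
Lemma leb_sublevel n k (A : 'M[R]_(k, n)) (B : R) : 0 <= B ->
  (forall v : 'rV[R]_k, v *m A = 0 -> v = 0) ->
  exists2 C : R, 0 <= C & forall rho, 0 <= rho ->
    (leb n (sublevel A B rho) <= (C * rho ^+ k)%:E)%E.
Proof.
move=> B0; elim: n k A => [|n IH] k A fA.
  (* In dimension 0 independent rows can only be an empty family; the constant row is a nonzero
     relation otherwise. *)
  case: k A fA => [|k] A fA; last first.
    have z : const_mx 1 *m A = 0 :> 'rV[R]_0 by apply/rowP => -[].
    have /matrixP/(_ 0 0) := fA _ z.
    by rewrite !mxE => /eqP; rewrite oner_eq0.
  exists 1 => // rho rho0; rewrite expr0 mul1r.
  by rewrite /= diracE lee_fin; case: (_ \in _).
have tailE (xi : 'cV[R]_n.+1) i : (A *m xi) i 0 =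
    A i ord0 * xi ord0 0 + \sum_j A i (lift ord0 j) * vtail xi j 0.
  rewrite mxE big_ord_recl; congr (_ + _).
  by apply: eq_bigr => j _; rewrite mxE.
have [a0|/existsNP[i0 /eqP ai0]] := pselect (forall i, A i ord0 = 0).
  pose A' := \matrix_(i < k, j < n) A i (lift ord0 j).
  have fA' (v : 'rV[R]_k) : v *m A' = 0 -> v = 0.
    move=> vA; apply: fA; apply/rowP => j; rewrite !mxE.
    case: (unliftP ord0 j) => [j' ->|->].
      move/rowP/(_ j'): vA; rewrite !mxE => vA; rewrite -[RHS]vA.
      by apply: eq_bigr => i _; rewrite mxE.
    by rewrite big1// => i _; rewrite a0 mulr0.
  have [C C0 hC] := IH k A' fA'.
  exists (2 * B * C); first by rewrite !mulr_ge0.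
  move=> rho rho0.
  apply: le_trans (@leb_le_section n _ (sublevel A' B rho) (cst 0) B _ _ B0 _) _.
  - exact: measurable_sublevel.
  - exact: measurable_sublevel.
  - move=> xi [xB xA]; split; last by rewrite subr0.
    split=> [j|i]; first by rewrite mxE.
    have := xA i; rewrite tailE a0 mul0r add0r; congr (`|_| <= _).
    by rewrite [RHS]mxE; apply: eq_bigr => j _; rewrite [A' _ _]mxE.
  apply: (@le_trans _ _ ((2 * B)%:E * (C * rho ^+ k)%:E)%E); last first.
    by rewrite -EFinM !mulrA.
  by rewrite lee_wpmul2l ?lee_fin ?mulr_ge0//; exact: hC.
case: k A i0 ai0 fA tailE => [|k] A; first by case.
move=> i0 ai0 fA tailE.
pose c i := A (lift i0 i) ord0 / A i0 ord0.
pose A' := \matrix_(i < k, j < n) (A (lift i0 i) (lift ord0 j) - c i * A i0 (lift ord0 j)).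
have fA' (v : 'rV[R]_k) : v *m A' = 0 -> v = 0.
  move=> vA.
  (* A relation v between the reduced rows lifts to a relation w between the original ones, its
     pivot entry undoing the elimination. *)
  pose w : 'rV[R]_k.+1 := \row_i
    (if unlift i0 i is Some i' then v 0 i' else - \sum_i v 0 i * c i).
  have w0 : w = 0.
    apply: fA; apply/rowP => j; rewrite !mxE (bigD1_ord i0)//= mxE unlift_none.
    under eq_bigr do rewrite mxE liftK.
    case: (unliftP ord0 j) => [j' ->|->].
      move/rowP/(_ j'): vA; rewrite !mxE => vA.
      rewrite -[RHS]vA mulNr mulr_suml addrC -sumrB.
      by apply: eq_bigr => i _; rewrite mxE; ring.
    rewrite mulNr mulr_suml addrC -sumrB big1// => i _.
    by rewrite /c; field.
  apply/rowP => i; move/rowP/(_ (lift i0 i)): w0.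
  by rewrite !mxE liftK.
have [C C0 hC] := IH k A' fA'.
(* Subtracting c i times the pivot equation enlarges the bound rho at most by the factor 1 + |c
   i|. *)
pose K := 1 + \sum_i `|c i|.
have K0 : 0 <= K by rewrite addr_ge0// sumr_ge0.
have a0 : 0 < `|A i0 ord0| by rewrite normr_gt0.
exists (2 * (C * K ^+ k / `|A i0 ord0|)).
  by rewrite !mulr_ge0 ?exprn_ge0// invr_ge0.
move=> rho rho0.
apply: le_trans (@leb_le_section n _ (sublevel A' B (K * rho))
  (fun y => - (\sum_j A i0 (lift ord0 j) * y j 0) / A i0 ord0) (rho / `|A i0 ord0|) _ _ _ _) _.
- exact: measurable_sublevel.
- exact: measurable_sublevel.
- by rewrite divr_ge0.
- move=> xi [xB xA]; split.
    split=> [j|i]; first by rewrite mxE.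
    have -> : (A' *m vtail xi) i 0 = (A *m xi) (lift i0 i) 0 - c i * (A *m xi) i0 0.
      rewrite !tailE mxE mulrDr opprD addrACA mulr_sumr -sumrB.
      rewrite (_ : _ - _ = 0); last by rewrite /c; field.
      by rewrite add0r; apply: eq_bigr => j _; rewrite [A' _ _]mxE; ring.
    apply: (le_trans (ler_normB _ _)); rewrite /K mulrDl mul1r lerD//.
    rewrite normrM; apply: ler_pM => //.
    by rewrite (bigD1 i)//= lerDl sumr_ge0.
  rewrite ler_pdivlMr// -normrM mulrBl mulfVK// opprK mulrC -tailE.
  exact: xA.
apply: (@le_trans _ _ ((2 * (rho / `|A i0 ord0|))%:E * (C * (K * rho) ^+ k)%:E)%E).
  rewrite lee_wpmul2l ?lee_fin ?mulr_ge0 ?divr_ge0//; apply: hC.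
  by rewrite mulr_ge0.
by rewrite -EFinM lee_fin exprMn exprS le_eqVlt; apply/orP; left; apply/eqP; ring.
Qed.

End sublevel.

Section dyadic.
Context {R : realType} d {T : measurableType d} (m : {measure set T -> \bar R}).

Lemma dyadic_bracket (t : R) : 0 < t <= 1 ->
  exists j : nat, 2^-1 ^+ j.+1 < t <= 2^-1 ^+ j.
Proof.
move=> /andP[t0 t1].
have ex : exists j : nat, 2^-1 ^+ j.+1 < t.
  have c : 2^-1 ^+ j @[j --> \oo] --> (0 : R).
    by apply: cvg_expr; rewrite gtr0_norm ?invr_gt0// invf_lt1// ltr1n.
  have [N _ hN] : \forall j \near \oo, 2^-1 ^+ j < t by exact: (cvgr_lt _ c).
  by exists N; apply: hN => /=.
case: (ex_minnP ex) => j jt jmin; exists j; rewrite jt/=.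
case: j jt jmin => [|j] jt jmin; first by rewrite expr0.
rewrite leNgt; apply/negP => H; have := jmin _ H; by rewrite ltnn.
Qed.

(** On the layer where t is comparable to 2^-j the function is at most 2^(alpha (j + 1)), on a set
    of measure at most C 2^(- j k). The layers sum to a geometric series of ratio 2^(alpha - k) < 1;
    where t > 1 the function is at most 1 on a set of finite measure. *)
Lemma integrable_inv_powR (E : set T) (t : T -> R) (C alpha : R) (k : nat) :
  measurable E -> (m E < +oo)%E -> measurable_fun setT t -> (forall x, 0 <= t x) ->
  0 <= C -> 0 < alpha < k%:R ->
  (forall rho, 0 <= rho -> (m (E `&` [set x | t x <= rho]%R) <= (C * rho ^+ k)%:E)%E) ->
  m.-integrable setT (EFin \o (fun x => \1_E x * (t x `^ alpha)^-1)).
Proof.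
move=> mE Eoo mt t0 C0 /andP[a0 ak] hC.
pose S j := E `&` [set x | t x <= 2^-1 ^+ j].
have mS j : measurable (S j).
  apply: measurableI => //; have := mt measurableT _ (measurable_itv `]-oo, 2^-1 ^+ j]%R).
  by rewrite setTI; congr measurable; apply/seteqP; split => x /=; rewrite in_itv.
pose g j x := (2 `^ (alpha * j.+1%:R) * \1_(S j) x)%:E : \bar R.
have mg j : measurable_fun setT (g j).
  by apply/measurable_EFinP; apply: measurable_funM => //; exact: measurable_indic.
have g0 j x : (0 <= g j x)%E by rewrite lee_fin mulr_ge0// powR_ge0.
have mf : measurable_fun setT (fun x => \1_E x * (t x `^ alpha)^-1).
  apply: measurable_funM; first exact: measurable_indic.
  under eq_fun do rewrite -powRN.
  exact: (measurableT_comp (measurable_powR (- alpha))).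
have bound x : (`|(\1_E x * (t x `^ alpha)^-1)%:E| <= (\1_E x)%:E + \sum_(j <oo) g j x)%E.
  rewrite gee0_abs; last by rewrite lee_fin mulr_ge0// invr_ge0 powR_ge0.
  have s0 : (0 <= \sum_(j <oo) g j x)%E by apply: nneseries_ge0.
  have [xE|xE] := boolP (x \in E); last first.
    by rewrite indicE (negbTE xE) mul0r adde_ge0.
  rewrite indicE xE mul1r.
  (* Where t vanishes the inverse is 0 by convention, so this set contributes nothing. *)
  have [tx0|tx0] := eqVneq (t x) 0.
    by rewrite tx0 powR0 ?gt_eqF// invr0 adde_ge0// lee_fin.
  have tp : 0 < t x by rewrite lt_neqAle eq_sym tx0 t0.
  have [t1|t1] := leP (t x) 1; last first.
    rewrite -[leLHS]adde0 leeD// lee_fin invf_le1 ?powR_gt0//.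
    by rewrite -(powRr0 (t x)) ler_powR// ltW.
  have [j /andP[j1 j2]] : exists j : nat, 2^-1 ^+ j.+1 < t x <= 2^-1 ^+ j.
    by apply: dyadic_bracket; rewrite tp t1.
  rewrite -[leLHS]add0e leeD ?lee_fin//.
  apply: (@le_trans _ _ (g j x)).
    rewrite /g indicE mem_set ?mulr1; last first.
      by split; [exact: set_mem|].
    rewrite lee_fin -powRN.
    have -> : 2 `^ (alpha * j.+1%:R) = (2^-1 ^+ j.+1) `^ (- alpha) :> R.
      rewrite -powR_mulrn ?invr_ge0// -powR_inv1// -!powRrM; congr (_ `^ _); ring.
    rewrite !powRN lef_pV2 ?posrE ?powR_gt0 ?exprn_gt0 ?invr_gt0//.
    by rewrite ge0_ler_powR ?nnegrE ?ltW// exprn_gt0// invr_gt0.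
  have := @nneseries_lim_ge R (g ^~ x) xpredT 0 j.+1 (fun n _ _ => g0 n x).
  apply: le_trans; rewrite big_nat_recr//=.
  by rewrite leeDr// sume_ge0.
apply/integrableP; split; first exact/measurable_EFinP.
have m1 : measurable_fun setT (fun x => (\1_E x)%:E : \bar R).
  by apply/measurable_EFinP; exact: measurable_indic.
have ms : measurable_fun setT (fun x => \sum_(j <oo) g j x)%E.
  by apply: ge0_emeasurable_sum => //.
apply: (@le_lt_trans _ _ (\int[m]_x ((\1_E x)%:E + \sum_(j <oo) g j x))%E).
  apply: ge0_le_integral => //.
  - by apply: measurableT_comp => //; exact/measurable_EFinP.
  - exact: emeasurable_funD.
  by move=> x _; exact: bound.
rewrite ge0_integralD//; last by move=> x _; exact: nneseries_ge0.
rewrite integral_indic// setIT lte_add_pinfty//.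
rewrite integral_nneseries//.
pose r : R := 2 `^ (alpha - k%:R).
have r0 : 0 < r by rewrite powR_gt0.
have r1 : r < 1.
  rewrite /r -(opprB k%:R) powRN invf_lt1 ?powR_gt0// /powR pnatr_eq0 expR_gt1.
  by rewrite mulr_gt0 ?subr_gt0// ln_gt0// ltr1n.
pose a : R := C * 2 `^ alpha.
have a0' : 0 <= a by rewrite mulr_ge0// powR_ge0.
apply: (@le_lt_trans _ _ (a * (1 - r)^-1)%:E); last exact: ltry.
apply: lime_le; first by apply: is_cvg_nneseries => j _ _; exact: integral_ge0.
apply: nearW => N.
apply: (@le_trans _ _ (\sum_(0 <= j < N) (geometric a r j)%:E)%E); last first.
  by rewrite sumEFin lee_fin; apply: geometric_le_lim; rewrite // gtr0_norm.
apply: lee_sum => j _; rewrite /g.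
under eq_integral do rewrite EFinM.
rewrite ge0_integralZl ?lee_fin ?powR_ge0//; last first.
  by apply/measurable_EFinP; exact: measurable_indic.
rewrite integral_indic// setIT.
apply: (@le_trans _ _ ((2 `^ (alpha * j.+1%:R))%:E * (C * (2^-1 ^+ j) ^+ k)%:E)%E).
  by rewrite lee_wpmul2l ?lee_fin ?powR_ge0//; apply: hC; rewrite exprn_ge0// invr_ge0.
rewrite -EFinM lee_fin /geometric /= /a /r le_eqVlt; apply/orP; left; apply/eqP.
have -> : (2^-1 ^+ j) ^+ k = 2 `^ (- (j%:R * k%:R)) :> R.
  by rewrite -exprM -natrM powR_invn// exprVn.
have -> : (2 `^ (alpha - k%:R)) ^+ j = 2 `^ ((alpha - k%:R) * j%:R) :> R.
  by rewrite powRrM powR_mulrn// powR_ge0.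
rewrite mulrCA -!mulrA; congr (_ * _); rewrite -!powRD ?pnatr_eq0 ?implybT//.
by congr (_ `^ _); rewrite -natr1; ring.
Qed.

End dyadic.

Section projection.
Context {R : realType} {n : nat}.
Local Notation Rn := 'cV[R]_n.
Local Notation nu := (@leb R n).
Implicit Types (Q : 'M[R]_n) (x xi : Rn) (k : nat).

Definition proj2 k Q xi : R := \sum_(j < n | (j < k)%N) dot (Q *m basis_vec j) xi ^+ 2.

Lemma proj2_ge0 k Q xi : 0 <= proj2 k Q xi.
Proof. by apply: sumr_ge0 => j _; exact: sqr_ge0. Qed.

Lemma dot_col Q (j : 'I_n) xi : dot (Q *m basis_vec j) xi = (Q^T *m xi) j 0.
Proof.
rewrite /dot mxE; apply: eq_bigr => i _; rewrite !mxE; congr (_ * _).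
rewrite (bigD1 j)//= /basis_vec mxE !eqxx mulr1 big1 ?addr0// => l lj.
by rewrite mxE (negbTE lj) mulr0.
Qed.

Lemma measurable_proj2 k Q : measurable_fun setT (proj2 k Q).
Proof.
rewrite /proj2; under eq_fun do rewrite big_mkcond/=.
apply: measurable_sum => j; case: (_ < _)%N; last exact: measurable_cst.
by apply: measurable_funX; exact: measurable_dot.
Qed.

Lemma SO_orthonormal Q : SO Q -> Q^T *m Q = 1%:M. Proof. by case. Qed.

(** The vectors Q e_1, ..., Q e_k written as rows, so that the entries of [rows_of kn Q *m xi] are
    the coordinates of the projection of xi. *)
Definition rows_of k (kn : (k <= n)%N) Q : 'M[R]_(k, n) :=
  \matrix_(i, l) Q l (widen_ord kn i).

Lemma rows_ofE k (kn : (k <= n)%N) Q xi (i : 'I_k) :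
  (rows_of kn Q *m xi) i 0 = dot (Q *m basis_vec (widen_ord kn i)) xi.
Proof. by rewrite dot_col !mxE; apply: eq_bigr => l _; rewrite !mxE. Qed.

Lemma rows_of_free k (kn : (k <= n)%N) Q : Q^T *m Q = 1%:M ->
  forall v : 'rV[R]_k, v *m rows_of kn Q = 0 -> v = 0.
Proof.
move=> QQ v vA; have : rows_of kn Q *m (rows_of kn Q)^T = 1%:M.
  apply/matrixP => i j; rewrite !mxE.
  move/matrixP/(_ (widen_ord kn i) (widen_ord kn j)): QQ; rewrite !mxE => E.
  rewrite (_ : (i == j) = (widen_ord kn i == widen_ord kn j))// -E.
  by apply: eq_bigr => l _; rewrite !mxE.
by move=> E; rewrite -[v]mulmx1 -E mulmxA vA mul0mx.
Qed.

Definition box (B : R) : set Rn := [set xi | forall j, `|xi j 0| <= B].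

Lemma measurable_box B : measurable (box B).
Proof.
apply: measurable_forall_ord => i; apply: measurable_le_cst.
by apply: measurableT_comp => //; exact: measurable_coord.
Qed.

Lemma leb_cube (c : Rn) (e : R) : 0 <= e ->
  nu [set xi | forall j, `|xi j 0 - c j 0| <= e] = ((2 * e) ^+ n)%:E.
Proof.
move=> e0; have := @leb_box R n (fun i => c i 0 - e) (fun i => c i 0 + e).
rewrite (_ : [set y | _] = [set xi : Rn | forall j, `|xi j 0 - c j 0| <= e]); last first.
  by apply/seteqP; split => y h j; have := h j; rewrite /= in_itv/= ler_distl.
move=> -> => [|i]; last by lra.
congr EFin; rewrite (eq_bigr (fun=> 2 * e)) => [|i _]; last by ring.
by rewrite prodr_const card_ord.
Qed.

Lemma leb_box_lty B : (nu (box B) < +oo)%E.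
Proof.
apply: (@le_lt_trans _ _ (nu [set xi : Rn | forall j, `|xi j 0 - (0 : Rn) j 0| <= `|B|])).
  apply: le_measure; rewrite ?inE; first exact: measurable_box.
    apply: measurable_forall_ord => i; apply: measurable_le_cst.
    by apply: measurableT_comp => //; apply: measurable_funB => //; exact: measurable_coord.
  by move=> xi h j /=; rewrite mxE subr0 (le_trans (h j))// ler_norm.
by rewrite leb_cube// ltry.
Qed.

Lemma proj2_sublevel k (kn : (k <= n)%N) Q (B rho : R) : 0 <= rho ->
  box B `&` [set xi | Num.sqrt (proj2 k Q xi) <= rho] `<=` sublevel (rows_of kn Q) B rho.
Proof.
move=> rho0 xi [xB /= xr]; split=> // i; apply: le_trans xr.
rewrite rows_ofE -sqrtr_sqr ler_sqrt ?proj2_ge0// /proj2.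
rewrite (bigD1 (widen_ord kn i))//=.
by rewrite lerDl sumr_ge0// => j _; exact: sqr_ge0.
Qed.

Lemma leb_proj2 k Q (B : R) : (k <= n)%N -> 0 <= B -> Q^T *m Q = 1%:M ->
  exists2 C : R, 0 <= C & forall rho, 0 <= rho ->
  (nu (box B `&` [set xi | Num.sqrt (proj2 k Q xi) <= rho]%R) <= (C * rho ^+ k)%:E)%E.
Proof.
move=> kn B0 QQ.
have [C C0 hC] := leb_sublevel B0 (rows_of_free (kn := kn) QQ).
exists C => // rho rho0; apply: le_trans (hC _ rho0).
apply: le_measure; rewrite ?inE; last exact: proj2_sublevel.
  apply: measurableI; first exact: measurable_box.
  apply: measurable_le_cst; apply: measurableT_comp (measurable_proj2 k Q).
  by apply: continuous_measurable_fun; exact: sqrt_continuous.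
exact: measurable_sublevel.
Qed.

Lemma powR_sqrt (p a : R) : 0 <= p -> Num.sqrt p `^ a = p `^ (a / 2).
Proof. by move=> p0; rewrite -powR12_sqrt// -powRrM mulrC. Qed.

Lemma integrable_inv_proj2 k Q (B alpha : R) : (k <= n)%N -> 0 <= B ->
  Q^T *m Q = 1%:M -> 0 < alpha < k%:R ->
  nu.-integrable setT (EFin \o (fun xi => \1_(box B) xi * (proj2 k Q xi `^ (alpha / 2))^-1)).
Proof.
move=> kn B0 QQ ak; have [C C0 hC] := leb_proj2 kn B0 QQ.
have mt : measurable_fun setT (fun xi => Num.sqrt (proj2 k Q xi)).
  apply: measurableT_comp (measurable_proj2 k Q).
  by apply: continuous_measurable_fun; exact: sqrt_continuous.
have := integrable_inv_powR (measurable_box B) (leb_box_lty B) mt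
  (fun xi => sqrtr_ge0 _) C0 ak hC.
congr (nu.-integrable _ _); apply/funext => xi /=.
by rewrite powR_sqrt// proj2_ge0.
Qed.

(** The sublevel bound at rho = 0, where k > 0 makes rho^k vanish. The symbol takes the value 0 on
    this set by convention, so it has to be discarded before bounding the symbol from below. *)
Lemma leb_proj2_eq0 k Q (B : R) : (0 < k <= n)%N -> 0 <= B -> Q^T *m Q = 1%:M ->
  nu (box B `&` [set xi | proj2 k Q xi = 0]) = 0%E.
Proof.
move=> /andP[k0 kn] B0 QQ; have [C C0 hC] := leb_proj2 kn B0 QQ.
apply/eqP; rewrite eq_le measure_ge0 andbT.
have := hC 0 (lexx 0); rewrite expr0n gtn_eqF// mulr0; apply: le_trans.
rewrite le_eqVlt; apply/orP; left; apply/eqP; congr (nu _).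
apply/seteqP; split => xi [xB h]; split=> //=; first by rewrite h sqrtr0.
have : Num.sqrt (proj2 k Q xi) == 0 by rewrite eq_le h sqrtr_ge0.
by rewrite sqrtr_eq0 => h'; apply/eqP; rewrite eq_le h' proj2_ge0.
Qed.

End projection.

(** * Wave packets *)

Section wave_packet.
Context {R : realType} {n : nat}.
Local Notation Rn := 'cV[R]_n.+1.
Local Notation nu := (@leb R n.+1).
Variables (lam N : R).
Hypothesis lam0 : 0 < lam.

Definition center : Rn := \col_j (if j == ord0 then N else 0).

(** The factor sqrt [lam] makes the L^2 norm of the dilated bump independent of [lam]. *)
Definition profile (j : 'I_n.+1) (y : R) : R :=
  Num.sqrt lam * bump (lam * (y - center j 0)).

(** The share of one coordinate in [fourier_const]. Inserted in [packet] as well, it cancels the 2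
    pi of the inversion formula ([gauge_sqr]), so the transform of [packet] is exactly
    [packet_hat]. *)
Definition gauge : R := (2 * pi) `^ (- (1 / 2)).

Definition packet : Rn -> R[i] := itrans (fun j y => gauge * profile j y).

Definition packet_hat (xi : Rn) : R := \prod_j profile j (xi j 0).

Lemma fourier_const_gauge : fourier_const (R := R) (n := n.+1) = gauge ^+ n.+1.
Proof.
rewrite /fourier_const /gauge -powR_mulrn ?powR_ge0// -powRrM.
by congr (_ `^ _); rewrite div1r; ring.
Qed.

Lemma gauge_sqr : gauge * (2 * pi * gauge) = 1.
Proof.
have p : 0 < 2 * pi :> R by rewrite mulr_gt0// pi_gt0.
rewrite mulrCA -expr2 /gauge -powR_mulrn ?powR_ge0// -powRrM.
rewrite (_ : - (1 / 2) * 2 = -1 :> R); last by field.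
by rewrite powR_inv1 ?ltW// divff// gt_eqF.
Qed.

Lemma test_fun_profile j : test_fun (`|N| + lam^-1) (fun y => gauge * profile j y).
Proof.
split.
  move=> m.
  have -> : (fun y => gauge * profile j y) = (cst (gauge * Num.sqrt lam)) \*
      (fun y => bump (lam * y + - (lam * center j 0))).
    by apply/funext => y; rewrite /profile /= mulrBr mulrA.
  by apply: CkM; [exact: Ck_cst|apply: Ck_affine; exact: smooth_bump].
move=> y Ly; rewrite /profile bump_out ?mulr0// normrM gtr0_norm//.
rewrite -ler_pdivrMl// mulr1.
have cN : `|center j 0| <= `|N| by rewrite mxE; case: ifP; rewrite ?normr0.
have := ler_normB y (center j 0); have := ler_distD 0 y (center j 0).
have := lerB_dist y (center j 0); lra.
Qed.

Lemma schwartz_packet : schwartz packet.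
Proof.
apply: (schwartz_itrans (L := `|N| + lam^-1)) => [i|i y]; first exact: test_fun_profile.
by rewrite /profile mxE /= !subr0 mulrN bumpN.
Qed.

Lemma fourier_packet xi : fourier packet xi = (packet_hat xi)%:C.
Proof.
rewrite (fourier_itrans xi test_fun_profile); congr (_ %:C).
under eq_bigr do rewrite mulrA.
rewrite big_split/= mulrA prodr_const card_ord fourier_const_gauge -exprMn.
by rewrite gauge_sqr expr1n mul1r.
Qed.

Lemma packet_hat_ge0 xi : 0 <= packet_hat xi.
Proof. by apply: prodr_ge0 => j _; rewrite mulr_ge0 ?sqrtr_ge0 ?bump_ge0. Qed.

Lemma packet_hat_le xi : packet_hat xi <= Num.sqrt lam ^+ n.+1.
Proof.
rewrite -[n.+1 in leRHS]card_ord -prodr_const; apply: ler_prod => j _.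
rewrite mulr_ge0 ?sqrtr_ge0 ?bump_ge0//= ler_piMr ?sqrtr_ge0//.
exact: bump_le1.
Qed.

Definition cube (e : R) : set Rn := [set xi | forall j, `|xi j 0 - center j 0| <= e].

Lemma measurable_cube e : measurable (cube e).
Proof.
apply: measurable_forall_ord => i; apply: measurable_le_cst.
by apply: measurableT_comp => //; apply: measurable_funB => //; exact: measurable_coord.
Qed.

Lemma packet_hat_out xi : ~ cube lam^-1 xi -> packet_hat xi = 0.
Proof.
move=> /existsNP[j /negP]; rewrite -ltNge => hj.
rewrite /packet_hat (bigD1 j)//= /profile bump_out ?mulr0 ?mul0r//.
rewrite normrM gtr0_norm// -ler_pdivrMl// mulr1; exact: ltW.
Qed.

Lemma packet_hat_ge xi : cube (lam^-1 / 2) xi ->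
  (Num.sqrt lam * expR (- 4)) ^+ n.+1 <= packet_hat xi.
Proof.
move=> hx; rewrite -[n.+1 in leLHS]card_ord -prodr_const; apply: ler_prod => j _.
rewrite mulr_ge0 ?sqrtr_ge0 ?expR_ge0//= ler_wpM2l ?sqrtr_ge0//.
apply: bump_ge; rewrite normrM gtr0_norm// -ler_pdivlMl//.
Qed.

Lemma measurable_packet_hat : measurable_fun setT packet_hat.
Proof.
apply: measurable_prod => j _; rewrite /profile.
apply: measurable_funM => //.
apply: (measurableT_comp (f := bump)).
  by apply: continuous_measurable_fun; exact: smooth_continuous smooth_bump.
apply: measurable_funM => //; apply: measurable_funB => //; exact: measurable_coord.
Qed.

End wave_packet.

Section integral_bounds.
Context {R : realType} d {T : measurableType d} (m : {measure set T -> \bar R}).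

(* Unlike [ge0_le_integral], this needs no measurability: the integral of a
   nonnegative function is a supremum over the simple functions below it. *)
Lemma ge0_le_integral_nonmeas (D : set T) (f g : T -> \bar R) :
  (forall x, D x -> (0 <= f x)%E) -> (forall x, D x -> (f x <= g x)%E) ->
  (\int[m]_(x in D) f x <= \int[m]_(x in D) g x)%E.
Proof.
move=> f0 fg; have g0 x : D x -> (0 <= g x)%E by move=> Dx; exact: le_trans (f0 _ Dx) (fg _ Dx).
rewrite !ge0_integralE//; apply: ge_ereal_sup => _ [h hf <-].
apply: ereal_sup_ubound; exists h => // x; apply: le_trans (hf x) _.
by rewrite !patchE; case: ifPn => // /set_mem; exact: fg.
Qed.

Lemma integral_cst_indic (A : set T) (a : R) : measurable A -> 0 <= a ->
  (\int[m]_x (a * \1_A x)%:E = a%:E * m A)%E.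
Proof.
move=> mA a0; under eq_integral do rewrite EFinM.
rewrite ge0_integralZl ?lee_fin//; last first.
  by apply/measurable_EFinP; exact: measurable_indic.
by rewrite integral_indic// setIT.
Qed.

Lemma sqr_poweR_half (x : \bar R) : (0 <= x)%E -> ((x `^ (1 / 2)) ^+ 2 = x)%E.
Proof.
case: x => [x| |] //; rewrite ?lee_fin => x0; last first.
  by rewrite poweRyr ?lt0r_neq0// ?mulyy// divr_gt0.
rewrite poweR_EFin -EFin_expe div1r powR12_sqrt// sqr_sqrtr//.
Qed.

Lemma le_poweR_half (x y : \bar R) : (0 <= x)%E -> (x <= y)%E ->
  (x `^ (1 / 2) <= y `^ (1 / 2))%E.
Proof.
move=> x0 xy; apply: gt0_ler_poweR => //.
  by rewrite in_itv/= x0 leey.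
by rewrite in_itv/= leey (le_trans x0 xy).
Qed.

End integral_bounds.

Section powR_bounds.
Context {R : realType}.

(** Taking logarithms, |p ln (x / N)| <= |p| ln 2; the absolute value treats both signs of the
    exponent at once. *)
Lemma powR_between (x N p : R) : 0 < N -> N / 2 <= x <= 2 * N ->
  N `^ p * 2 `^ (- `|p|) <= x `^ p <= N `^ p * 2 `^ `|p|.
Proof.
move=> N0 /andP[x1 x2].
have x0 : 0 < x by apply: lt_le_trans x1; rewrite divr_gt0.
have -> : x `^ p = N `^ p * (x / N) `^ p.
  by rewrite -powRM ?divr_ge0 ?ltW// mulrCA divff ?mulr1// gt_eqF.
have y0 : 0 < x / N by rewrite divr_gt0.
have ln2 : 0 < ln 2 :> R by rewrite ln_gt0// ltr1n.
have ly : `|ln (x / N)| <= ln 2.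
  rewrite ler_norml -lnV ?posrE// !ler_ln ?posrE ?invr_gt0//.
  by rewrite ler_pdivrMr// ler_pdivlMr// mulrC x1 x2.
have ly' : `|p * ln (x / N)| <= `|p| * ln 2 by rewrite normrM ler_wpM2l.
move: ly'; rewrite ler_norml => /andP[l1 l2].
rewrite /powR !gt_eqF// !ler_pM2l ?expR_gt0// !ler_expR mulNr.
by rewrite l1 l2.
Qed.

End powR_bounds.

Section packet_bounds.
Context {R : realType} {n : nat}.
Local Notation Rn := 'cV[R]_n.+1.
Local Notation nu := (@leb R n.+1).
Variables (lam N : R).
Hypotheses (n0 : (0 < n)%N) (lam0 : 0 < lam) (N0 : 0 < N) (lamN : n.+1%:R / lam <= N).
Local Notation cube := (@cube R n N).
Local Notation packet_hat := (@packet_hat R n lam N).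


Let ilam0 : 0 < lam^-1. Proof. by rewrite invr_gt0. Qed.

Lemma enorm_cube xi : cube lam^-1 xi -> N / 2 <= enorm xi <= 2 * N.
Proof.
move=> hx.
have h0 : `|xi ord0 0 - N| <= lam^-1 by have := hx ord0; rewrite mxE eqxx.
(* Dimension at least 2 turns the hypothesis [lamN] into a margin of N / 2 around the centre. *)
have lN2 : lam^-1 <= N / 2.
  have : 2 / lam <= N by apply: le_trans lamN; rewrite ler_pM2r// (ler_nat _ 2).
  lra.
apply/andP; split.
  have e0 : xi ord0 0 <= enorm xi.
    apply: (le_trans (ler_norm _)); rewrite -sqrtr_sqr ler_sqrt ?dot_ge0//.
    rewrite /dot (bigD1 ord0)//= -expr2 lerDl sumr_ge0// => j _.
    by rewrite -expr2 sqr_ge0.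
  apply: le_trans e0; move: h0; rewrite ler_distl => /andP[h1 _]; lra.
apply: (le_trans (enorm_le_sum _)).
apply: (@le_trans _ _ (\sum_j (`|center N j 0| + lam^-1))).
  apply: ler_sum => j _; have := hx j; have := lerB_dist (xi j 0) (center N j 0); lra.
rewrite big_split/= sumr_const card_ord -(mulr_natl lam^-1).
rewrite (bigD1 ord0)//= mxE eqxx gtr0_norm// big1 ?addr0; last first.
  by move=> j /negbTE j0; rewrite mxE j0 normr0.
have -> : 2 * N = N + N by ring.
by rewrite lerD2l.
Qed.

Lemma packet_hat_sqr_le xi : packet_hat xi ^+ 2 <= lam ^+ n.+1 * \1_(cube lam^-1) xi.
Proof.
have [h|h] := pselect (cube lam^-1 xi); last first.
  by rewrite packet_hat_out// expr0n indicE memNset// mulr0.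
rewrite indicE mem_set// mulr1.
apply: (@le_trans _ _ ((Num.sqrt lam ^+ n.+1) ^+ 2)).
  by rewrite lerXn2r ?nnegrE ?exprn_ge0 ?sqrtr_ge0 ?packet_hat_ge0 ?packet_hat_le.
by rewrite exprAC sqr_sqrtr// ltW.
Qed.

Lemma packet_hat_sqr_ge xi :
  (lam * expR (- 8)) ^+ n.+1 * \1_(cube (lam^-1 / 2)) xi <= packet_hat xi ^+ 2.
Proof.
have [h|h] := pselect (cube (lam^-1 / 2) xi); last first.
  by rewrite indicE memNset// mulr0 sqr_ge0.
rewrite indicE mem_set// mulr1.
have -> : (lam * expR (- 8)) ^+ n.+1 = ((Num.sqrt lam * expR (- 4)) ^+ n.+1) ^+ 2.
  rewrite [RHS]exprAC (exprMn 2 (Num.sqrt lam)) sqr_sqrtr ?ltW// -expRM_natl.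
  by congr ((_ * expR _) ^+ _); lra.
rewrite lerXn2r ?nnegrE ?packet_hat_ge0 ?exprn_ge0 ?mulr_ge0 ?sqrtr_ge0 ?expR_ge0//.
exact: packet_hat_ge.
Qed.

Lemma cubeS (e e' : R) : e <= e' -> cube e `<=` cube e'.
Proof. by move=> ee xi h j; exact: le_trans (h j) ee. Qed.

Lemma leb_center_cube (e : R) : 0 <= e -> nu (cube e) = ((2 * e) ^+ n.+1)%:E.
Proof. exact: leb_cube. Qed.

Lemma integral_cube (a e : R) : 0 <= a -> 0 <= e ->
  (\int[nu]_xi (a * \1_(cube e) xi)%:E = (a * (2 * e) ^+ n.+1)%:E)%E.
Proof.
move=> a0 e0; rewrite EFinM -leb_center_cube//.
by apply: integral_cst_indic => //; exact: measurable_cube.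
Qed.

(** One constant for both inequalities: 2^|s| compares |xi| with N, 2^(n+1) covers the volume of the
    support, and the exponential covers the lower bound of the bump. *)
Definition sobolev_cst (s : R) : R := 2 `^ `|s| * 2 ^+ n.+1 * expR 4 ^+ n.+1.

(** The square of [packet_hat] is of order [lam]^(n+1) on a cube of volume of order [lam]^(-(n+1)),
    so [lam] disappears and only the weight |xi|^(2 s), comparable to N^(2 s), remains. *)
Lemma sobolev_packet s :
  (sobolev_norm s (packet lam N : Rn -> R[i]) <= (sobolev_cst s)%:E * (N `^ s)%:E)%E /\
  ((N `^ s)%:E <= (sobolev_cst s)%:E * sobolev_norm s (packet lam N : Rn -> R[i]))%E.
Proof.
have IE xi : (enorm xi `^ (2 * s) * normc (fourier (packet lam N) xi) ^+ 2)%:E =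
    (enorm xi `^ (2 * s) * packet_hat xi ^+ 2)%:E.
  rewrite fourier_packet// /normc /= expr0n addr0 sqrtr_sqr ger0_norm//.
  exact: packet_hat_ge0.
have half (a : R) : 0 <= a -> (a `^ (2 * s)) `^ (1 / 2) = a `^ s.
  by move=> a0; rewrite -powRrM; congr (_ `^ _); field.
pose M : R := N `^ (2 * s) * 2 `^ `|2 * s| * lam ^+ n.+1.
pose m : R := N `^ (2 * s) * 2 `^ (- `|2 * s|) * (lam * expR (- 8)) ^+ n.+1.
have M0 : 0 <= M by rewrite !mulr_ge0 ?powR_ge0 ?exprn_ge0 ?ltW.
have m0 : 0 <= m by rewrite !mulr_ge0 ?powR_ge0 ?exprn_ge0 ?mulr_ge0 ?expR_ge0 ?ltW.
have hcube : lam^-1 / 2 <= lam^-1 by rewrite ler_pdivrMr// ler_peMr ?ltW// ltr1n.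
have up : (\int[nu]_xi (enorm xi `^ (2 * s) * packet_hat xi ^+ 2)%:E <=
    (M * (2 / lam) ^+ n.+1)%:E)%E.
  apply: (@le_trans _ _ (\int[nu]_xi (M * \1_(cube lam^-1) xi)%:E)%E); last first.
    by rewrite integral_cube// ltW.
  apply: ge0_le_integral_nonmeas => xi _.
    by rewrite lee_fin mulr_ge0 ?powR_ge0 ?sqr_ge0.
  rewrite lee_fin; have [h|h] := pselect (cube lam^-1 xi); last first.
    by rewrite packet_hat_out// expr0n mulr0 mulr_ge0.
  rewrite /M -mulrA; apply: ler_pM; rewrite ?powR_ge0 ?sqr_ge0 ?packet_hat_sqr_le//.
  by have /andP[] := powR_between (2 * s) N0 (enorm_cube h).
have lo : ((m * lam^-1 ^+ n.+1)%:E <=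
    \int[nu]_xi (enorm xi `^ (2 * s) * packet_hat xi ^+ 2)%:E)%E.
  apply: (@le_trans _ _ (\int[nu]_xi (m * \1_(cube (lam^-1 / 2)) xi)%:E)%E).
    rewrite integral_cube//; last by rewrite divr_ge0// ltW.
    by have -> : 2 * (lam^-1 / 2) = lam^-1 by field; rewrite gt_eqF.
  apply: ge0_le_integral_nonmeas => xi _; first by rewrite lee_fin mulr_ge0.
  rewrite lee_fin; have [h|h] := pselect (cube (lam^-1 / 2) xi); last first.
    by rewrite indicE memNset// mulr0 mulr_ge0 ?powR_ge0 ?sqr_ge0.
  rewrite /m -mulrA; apply: ler_pM; rewrite ?packet_hat_sqr_ge ?mulr_ge0 ?powR_ge0//.
    by rewrite exprn_ge0// mulr_ge0 ?expR_ge0 ?ltW.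
  by have /andP[] := powR_between (2 * s) N0 (enorm_cube (cubeS hcube h)).
have E4 : 1 <= expR 4 ^+ n.+1 :> R by rewrite exprn_ege1// -expR0 ler_expR.
have E2 : 1 <= 2 ^+ n.+1 :> R by rewrite exprn_ege1// ler1n.
have P2 : 1 <= 2 `^ `|s| :> R by rewrite -[leLHS](powRr0 2) ler_powR// ler1n.
have s2 : 2 `^ `|2 * s| = (2 `^ `|s|) ^+ 2 :> R.
  by rewrite normrM ger0_norm// mulrC powRrM powR_mulrn ?powR_ge0.
rewrite /sobolev_norm; under eq_integral do rewrite IE.
set I := (\int[nu]_xi _)%E in up lo *.
have I0 : (0 <= I)%E.
  by apply: integral_ge0 => xi _; rewrite lee_fin mulr_ge0 ?powR_ge0 ?sqr_ge0.
split.
  apply: (@le_trans _ _ ((M * (2 / lam) ^+ n.+1)%:E `^ (1 / 2))%E).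
    exact: le_poweR_half.
  rewrite poweR_EFin -EFinM lee_fin.
  have -> : M * (2 / lam) ^+ n.+1 = N `^ (2 * s) * ((2 `^ `|s|) ^+ 2 * 2 ^+ n.+1).
    rewrite /M s2 exprMn exprVn.
    by field; rewrite expf_neq0// gt_eqF.
  rewrite powRM ?powR_ge0 ?mulr_ge0 ?exprn_ge0 ?powR_ge0// (half _ (ltW N0)) mulrC.
  rewrite ler_wpM2r ?powR_ge0// div1r powR12_sqrt; last by rewrite mulr_ge0 ?exprn_ge0 ?powR_ge0.
  rewrite sqrtrM ?sqr_ge0// sqrtr_sqr ger0_norm ?powR_ge0// /sobolev_cst -mulrA.
  rewrite ler_wpM2l ?powR_ge0//.
  apply: (@le_trans _ _ (2 ^+ n.+1)); last by rewrite ler_peMr// exprn_ge0.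
  rewrite -[leRHS]ger0_norm ?exprn_ge0// -sqrtr_sqr ler_sqrt ?sqr_ge0//.
  by rewrite expr2 ler_peMr// exprn_ge0.
apply: (@le_trans _ _ ((sobolev_cst s)%:E * (m * lam^-1 ^+ n.+1)%:E `^ (1 / 2))%E); last first.
  rewrite lee_wpmul2l// ?lee_fin ?mulr_ge0 ?exprn_ge0 ?powR_ge0 ?expR_ge0//.
  by apply: le_poweR_half => //; rewrite lee_fin mulr_ge0// exprn_ge0// ltW.
rewrite poweR_EFin -EFinM lee_fin.
have -> : m * lam^-1 ^+ n.+1 = N `^ (2 * s) * ((2 `^ `|s|)^-1 ^+ 2 * (expR 4 ^- n.+1) ^+ 2).
  rewrite /m powRN s2 exprMn exprVn.
  have -> : expR (- 8) ^+ n.+1 = (expR 4 ^- n.+1) ^+ 2 :> R.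
    rewrite -exprVn -expRN exprAC -(expRM_natl 2 (- 4)); congr (expR _ ^+ _); lra.
  by field; rewrite !expf_neq0 ?gt_eqF ?expR_gt0 ?powR_gt0.
rewrite powRM ?powR_ge0 ?mulr_ge0 ?sqr_ge0// (half _ (ltW N0)) -exprMn div1r powR12_sqrt ?sqr_ge0//.
rewrite sqrtr_sqr ger0_norm ?mulr_ge0 ?invr_ge0 ?exprn_ge0 ?powR_ge0 ?expR_ge0//.
have -> : sobolev_cst s * (N `^ s * ((2 `^ `|s|)^-1 * (expR 4 ^+ n.+1)^-1)) = 2 ^+ n.+1 * N `^ s.
  rewrite /sobolev_cst; field.
  by rewrite expf_neq0 ?gt_eqF ?expR_gt0// powR_gt0.
by rewrite ler_peMl ?powR_ge0.
Qed.

End packet_bounds.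

(** * Absence of cancellation on the ball *)

Section lower_bound.
Context {R : realType} {n : nat}.
Local Notation Rn := 'cV[R]_n.+1.
Local Notation nu := (@leb R n.+1).
Variables (lam N r alpha : R) (k : nat) (Q : 'M[R]_n.+1).
Hypotheses (n0 : (0 < n)%N) (lam0 : 0 < lam) (N0 : 0 < N) (r0 : 0 < r)
  (lamN : n.+1%:R / lam <= N) (lamr : lam = n.+1%:R * r)
  (k0 : (0 < k <= n.+1)%N) (ak : 0 < alpha < k%:R) (QQ : Q^T *m Q = 1%:M).
Local Notation cube := (@cube R n N).
Local Notation packet_hat := (@packet_hat R n lam N).

Definition symbol (xi : Rn) : R := packet_hat xi / proj2 k Q xi `^ (alpha / 2).

Let cube_box : cube lam^-1 `<=` box (N + lam^-1).
Proof.
move=> xi h j; have := h j; have := lerB_dist (xi j 0) (center N j 0).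
have : `|center N j 0| <= N.
  by rewrite mxE; case: ifP => _; [rewrite gtr0_norm|rewrite normr0 ltW].
lra.
Qed.

Lemma symbol_ge0 xi : 0 <= symbol xi.
Proof. by rewrite divr_ge0 ?packet_hat_ge0 ?powR_ge0. Qed.

Lemma measurable_symbol : measurable_fun setT symbol.
Proof.
apply: measurable_funM; first exact: measurable_packet_hat.
under eq_fun do rewrite -powRN.
exact: (measurableT_comp (measurable_powR _) (measurable_proj2 k Q)).
Qed.

Let kn : (k <= n.+1)%N. Proof. by case/andP: k0. Qed.

Let B0 : 0 <= N + lam^-1. Proof. by rewrite addr_ge0 ?invr_ge0 ?ltW. Qed.

Lemma integrable_symbol : nu.-integrable setT (EFin \o symbol).
Proof.
have i1 := integrableZl measurableT (Num.sqrt lam ^+ n.+1) (integrable_inv_proj2 kn B0 QQ ak).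
apply: (le_integrable _ _ _ i1) => //.
  by apply/measurable_EFinP; exact: measurable_symbol.
move=> xi _; rewrite /= lee_fin ger0_norm ?symbol_ge0//.
rewrite ger0_norm; last by rewrite !mulr_ge0 ?exprn_ge0 ?sqrtr_ge0 ?invr_ge0 ?powR_ge0.
rewrite mulrA /symbol ler_wpM2r ?invr_ge0 ?powR_ge0//.
have [h|h] := pselect (cube lam^-1 xi); last first.
  by rewrite packet_hat_out// mulr_ge0 ?exprn_ge0 ?sqrtr_ge0.
by rewrite indicE mem_set ?mulr1 ?packet_hat_le//; exact: cube_box.
Qed.

Definition weight (xi : Rn) : R := enorm xi `^ alpha * symbol xi.

Lemma weight_ge0 xi : 0 <= weight xi.
Proof. by rewrite mulr_ge0 ?powR_ge0 ?symbol_ge0. Qed.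

Lemma measurable_enorm_powR (a : R) : measurable_fun setT (fun xi : Rn => enorm xi `^ a).
Proof.
apply: (measurableT_comp (measurable_powR _)).
apply: measurableT_comp.
  by apply: continuous_measurable_fun; exact: sqrt_continuous.
by apply: measurable_sum => i; apply: measurable_funM; exact: measurable_coord.
Qed.

Lemma integrable_weight : nu.-integrable setT (EFin \o weight).
Proof.
have i1 := integrableZl measurableT ((2 * N) `^ alpha) integrable_symbol.
apply: (le_integrable _ _ _ i1) => //.
  apply/measurable_EFinP; apply: measurable_funM; last exact: measurable_symbol.
  exact: measurable_enorm_powR.
move=> xi _; rewrite /= lee_fin ger0_norm ?weight_ge0//.
rewrite ger0_norm; last by rewrite mulr_ge0 ?powR_ge0 ?symbol_ge0.
have [h|h] := pselect (cube lam^-1 xi); last first.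
  by rewrite /weight /symbol packet_hat_out// mul0r !mulr0.
rewrite /weight ler_wpM2r ?symbol_ge0//.
have /andP[h1 h2] := enorm_cube n0 lam0 N0 lamN h.
have a0 : 0 <= alpha by case/andP: ak => /ltW.
by rewrite ge0_ler_powR// ?nnegrE ?enorm_ge0// mulr_ge0// ltW.
Qed.

Lemma frac_laplacian_riesz x :
  frac_laplacian alpha (fun x => riesz_potential k alpha (packet lam N) x Q) x =
  inv_fourier (fun xi => (weight xi)%:C) x.
Proof.
have -> : (fun x => riesz_potential k alpha (packet lam N) x Q) =
    inv_fourier (fun xi => (symbol xi)%:C).
  apply/funext => y; rewrite /riesz_potential /inv_fourier; congr (_ * cintegral _).
  apply/funext => xi; rewrite fourier_packet// -/(proj2 k Q xi) ger0_norm ?proj2_ge0//.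
  by rewrite /symbol rmorphM fmorphV.
rewrite /frac_laplacian fourier_multiplier_inv.
- congr (_ * cintegral _); apply/funext => xi.
  by rewrite /weight [X in _ = _ * X]rmorphM.
- exact: measurable_enorm_powR.
- by split; [exact: integrable_symbol|exact: integrable0].
Qed.

(** Here the choice [lam] = (n + 1) r is used: each of the n + 1 coordinates contributes at most r /
    [lam] to the phase. *)
Lemma dot_cauchy_cube x xi : enorm x < r -> cube lam^-1 xi ->
  `|dot x (xi - center N)| <= 1.
Proof.
move=> xr h; rewrite /dot (le_trans (ler_norm_sum _ _ _))//.
apply: (@le_trans _ _ (\sum_(i < n.+1) r / lam)).
  apply: ler_sum => i _; rewrite normrM; apply: ler_pM => //.
    apply: le_trans (ltW xr); rewrite -sqrtr_sqr ler_sqrt ?dot_ge0//.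
    rewrite /dot (bigD1 i)//= -expr2 lerDl sumr_ge0// => j _.
    by rewrite -expr2 sqr_ge0.
  by rewrite !mxE; have := h i; rewrite mxE.
by rewrite sumr_const card_ord -mulr_natl lamr mulrA divff// mulf_neq0 ?gt_eqF ?ltr0n.
Qed.

Lemma cos_ge_cos1 (u : R) : `|u| <= 1 -> cos 1 <= cos u.
Proof.
move=> u1; have -> : cos u = cos `|u| by case: ger0P => _; rewrite ?cosN.
have p1 : (1 : R) <= pi by apply: le_trans (pi_ge2 _); rewrite ler1n.
by rewrite leNgt ltr_cos ?in_itv/= ?ler01 ?p1 ?normr_ge0 ?(le_trans u1 p1)// -leNgt.
Qed.

(** Multiplying by e^(- i x . center) does not change the modulus and leaves the phase x . (xi -
    center), whose cosine is at least cos 1 on the support. Since [weight] is nonnegative, the real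
    part is at least cos 1 times its integral. *)
Lemma normc_inv_fourier_ge x : enorm x < r ->
  (fourier_const (R := R) (n := n.+1) * cos 1 * \int[nu]_xi weight xi) ^+ 2 <=
  normc (inv_fourier (fun xi => (weight xi)%:C) x) ^+ 2.
Proof.
move=> xr.
have c1 xi : `|cos (dot x xi)| <= 1 by exact: cos_max.
have s1 xi : `|sin (dot x xi)| <= 1 by exact: sin_max.
have iw := integrable_weight.
have ic := integrable_bounded_mul (measurable_cos_dot0 x) c1 iw.
have is_ := integrable_bounded_mul (measurable_sin_dot x) s1 iw.
pose A := \int[nu]_xi (cos (dot x xi) * weight xi).
pose B := \int[nu]_xi (sin (dot x xi) * weight xi).
have E : inv_fourier (fun xi => (weight xi)%:C) x = (fourier_const (R := R) (n := n.+1))%:C * (A +i* B).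
  rewrite /inv_fourier; congr (_ * _); rewrite /cintegral; congr (_ +i* _).
    by apply: eq_Rintegral => xi _; rewrite Re_expi_mul /= mulr0 subr0.
  by apply: eq_Rintegral => xi _; rewrite Im_expi_mul /= mulr0 add0r.
rewrite E /normc /= !mul0r subr0 addr0 sqr_sqrtr ?addr_ge0 ?sqr_ge0//.
set fc := fourier_const; set t := dot x (center N).
have W0 : 0 <= \int[nu]_xi weight xi by apply: Rintegral_ge0 => xi _; exact: weight_ge0.
have key : cos 1 * \int[nu]_xi weight xi <= cos t * A + sin t * B.
  rewrite -!RintegralZl// -RintegralD//; last 2 first.
    exact: (integrableZl measurableT _ ic).
    exact: (integrableZl measurableT _ is_).
  apply: le_Rintegral => //.
    exact: (integrableZl measurableT _ iw).
    exact: (integrableD measurableT (integrableZl measurableT (cos t) ic)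
      (integrableZl measurableT (sin t) is_)).
  move=> xi _; have := weight_ge0 xi.
  have w0 : ~ cube lam^-1 xi -> weight xi = 0.
    by move=> h; rewrite /weight /symbol packet_hat_out// mul0r mulr0.
  move: (weight xi) w0 => w w0 wge0; rewrite !mulrA -mulrDl.
  have [h|/w0 ->] := pselect (cube lam^-1 xi); last by rewrite !mulr0.
  rewrite ler_wpM2r//.
  have -> : cos t * cos (dot x xi) + sin t * sin (dot x xi) = cos (dot x (xi - center N)).
    rewrite (_ : dot x (xi - center N) = dot x xi - t); last first.
      by rewrite ![dot x _]dotC dotDl dotNl ![dot _ x]dotC.
    by rewrite cosB mulrC [sin t * _]mulrC.
  by apply: cos_ge_cos1; exact: dot_cauchy_cube.
have cs : cos t ^+ 2 + sin t ^+ 2 = 1 by exact: cos2Dsin2.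
have c10 : 0 <= cos 1 * \int[nu]_xi weight xi by rewrite mulr_ge0// ltW// cos1_gt0.
have sq : (cos 1 * \int[nu]_xi weight xi) ^+ 2 <= A ^+ 2 + B ^+ 2.
  apply: (@le_trans _ _ ((cos t * A + sin t * B) ^+ 2)).
    by rewrite lerXn2r ?nnegrE// (le_trans c10).
  (* The real part of a rotated complex number is at most its modulus; the defect is the square of
     the imaginary part. *)
  rewrite -subr_ge0 (_ : _ - _ = (sin t * A - cos t * B) ^+ 2) ?sqr_ge0//.
  rewrite -[A ^+ 2 + _]mul1r -cs; ring.
rewrite -mulrA (exprMn _ fc (cos 1 * _)) !(exprMn _ fc) -mulrDr.
apply: ler_wpM2l sq; exact: sqr_ge0.
Qed.

End lower_bound.

Section projection_bounds.
Context {R : realType} {n : nat}.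
Local Notation Rn := 'cV[R]_n.
Implicit Types (Q : 'M[R]_n) (x y : Rn).

Lemma dotE x y : dot x y = (x^T *m y) 0 0.
Proof. by rewrite mxE; apply: eq_bigr => i _; rewrite mxE. Qed.

Lemma proj2_le_dot k Q x : Q^T *m Q = 1%:M -> proj2 k Q x <= dot x x.
Proof.
move=> QQ; have QQ' : Q *m Q^T = 1%:M by exact: mulmx1C.
have -> : dot x x = dot (Q^T *m x) (Q^T *m x).
  by rewrite !dotE trmx_mul trmxK mulmxA -(mulmxA _ Q) QQ' mulmx1.
rewrite /proj2 big_mkcond /dot; apply: ler_sum => j _.
by case: ifP => _; rewrite -expr2 ?sqr_ge0// -/(dot _ _) dot_col.
Qed.

Lemma dotZr (a : R) x y : dot x (a *: y) = a * dot x y.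
Proof. by rewrite dotC dotZl dotC. Qed.

Lemma dotDr x y z : dot x (y + z) = dot x y + dot x z.
Proof. by rewrite dotC dotDl ![dot _ x]dotC. Qed.

Lemma proj2Z k Q (a : R) x : proj2 k Q (a *: x) = a ^+ 2 * proj2 k Q x.
Proof. by rewrite mulr_sumr; apply: eq_bigr => j _; rewrite dotZr exprMn. Qed.

Lemma proj2D_le k Q x y : proj2 k Q (x + y) <= 2 * (proj2 k Q x + proj2 k Q y).
Proof.
rewrite /proj2 -big_split/= mulr_sumr; apply: ler_sum => j _.
rewrite dotDr; move: (dot _ x) (dot _ y) => a b.
have := sqr_ge0 (a - b); rewrite sqrrB sqrrD; lra.
Qed.

End projection_bounds.

Section average_lower_bound.
Context {R : realType} {n : nat}.
Local Notation Rn := 'cV[R]_n.+1.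
Local Notation nu := (@leb R n.+1).
Variables (lam N r alpha : R) (k : nat) (Q : 'M[R]_n.+1).
Hypotheses (n0 : (0 < n)%N) (lam0 : 0 < lam) (N0 : 0 < N) (r0 : 0 < r)
  (lamN : n.+1%:R / lam <= N) (lamr : lam = n.+1%:R * r)
  (k0 : (0 < k <= n.+1)%N) (ak : 0 < alpha < k%:R) (QQ : Q^T *m Q = 1%:M).
Local Notation cube := (@cube R n N).
Local Notation weight := (@weight R n lam N alpha k Q).
Local Notation p2 := (proj2 k Q (@basis_vec R n.+1 ord0)).

Let n1 : (n.+1%:R : R) != 0. Proof. by rewrite pnatr_eq0. Qed.

Let lamV : lam^-1 = r^-1 / n.+1%:R. Proof. by rewrite lamr invfM mulrC. Qed.

Let hcube : lam^-1 / 2 <= lam^-1.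
Proof. by rewrite ler_pdivrMr// ler_peMr ?invr_ge0 ?ltW// ltr1n. Qed.

(** Bound for |P_Q xi|^2 on the support: N e_1 contributes N^2 |P_Q e_1|^2, the deviation from the
    centre at most 1 / r^2, and the 2 comes from squaring a sum. *)
Let M : R := 2 * (N ^+ 2 * p2 + r^-1 ^+ 2).

Let M0 : 0 < M.
Proof.
have h1 : 0 <= N ^+ 2 * p2 by rewrite mulr_ge0 ?sqr_ge0 ?proj2_ge0.
have h2 : 0 < r^-1 ^+ 2 by rewrite exprn_gt0// invr_gt0.
by rewrite mulr_gt0// ltr_wpDl.
Qed.

Lemma proj2_cube_le xi : cube lam^-1 xi -> proj2 k Q xi <= M.
Proof.
move=> h; have -> : xi = center N + (xi - center N) by rewrite addrC subrK.
apply: le_trans (proj2D_le _ _ _ _) _; rewrite /M ler_pM2l// lerD//.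
  have -> : center N = N *: basis_vec ord0 :> Rn.
    apply/colP => j; rewrite !mxE eqxx andbT.
    by case: ifP => _; rewrite ?mulr1 ?mulr0.
  by rewrite proj2Z.
apply: (le_trans (proj2_le_dot _ _ QQ)); rewrite -sqr_enorm.
have rv : 0 <= r^-1 by rewrite invr_ge0 ltW.
rewrite lerXn2r ?nnegrE ?enorm_ge0//.
apply: (le_trans (enorm_le_sum _)).
apply: (@le_trans _ _ (\sum_(i < n.+1) lam^-1)).
  by apply: ler_sum => i _; rewrite !mxE; have := h i; rewrite mxE.
by rewrite sumr_const card_ord -(mulr_natl lam^-1) lamV mulrCA divff// mulr1.
Qed.

Let a : R := (N / 2) `^ alpha * ((Num.sqrt lam * expR (- 4)) ^+ n.+1 / M `^ (alpha / 2)).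

Let a0 : 0 <= a.
Proof. by rewrite !mulr_ge0 ?powR_ge0 ?exprn_ge0 ?mulr_ge0 ?sqrtr_ge0 ?expR_ge0 ?invr_ge0 ?powR_ge0. Qed.

Lemma weight_ge xi : cube (lam^-1 / 2) xi -> proj2 k Q xi != 0 -> a <= weight xi.
Proof.
move=> h p0; have h1 := cubeS hcube h.
have al0 : 0 <= alpha by case/andP: ak => /ltW.
have pp : 0 < proj2 k Q xi by rewrite lt_neqAle eq_sym p0 proj2_ge0.
rewrite /a /weight /symbol; apply: ler_pM; rewrite ?powR_ge0//.
- by rewrite mulr_ge0 ?exprn_ge0 ?mulr_ge0 ?sqrtr_ge0 ?expR_ge0 ?invr_ge0 ?powR_ge0.
- have /andP[h2 _] := enorm_cube n0 lam0 N0 lamN h1.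
  by rewrite ge0_ler_powR// ?nnegrE ?enorm_ge0// divr_ge0// ltW.
- apply: ler_pM; rewrite ?exprn_ge0 ?mulr_ge0 ?sqrtr_ge0 ?expR_ge0 ?invr_ge0 ?powR_ge0//.
    exact: packet_hat_ge.
  rewrite lef_pV2 ?posrE ?powR_gt0//.
  rewrite ge0_ler_powR ?nnegrE ?proj2_ge0 ?divr_ge0// ?(ltW M0)//.
  exact: proj2_cube_le.
Qed.

Lemma integral_weight_ge : a * lam^-1 ^+ n.+1 <= \int[nu]_xi weight xi.
Proof.
have iw := integrable_weight n0 lam0 N0 lamN k0 ak QQ.
pose B := N + lam^-1.
pose Z := box B `&` [set xi : Rn | proj2 k Q xi = 0].
have mZ : measurable Z.
  apply: measurableI; first exact: measurable_box.
  rewrite -[X in measurable X]setTI.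
  exact: (measurable_proj2 k Q measurableT (measurable_set1 0)).
have mC : measurable (cube (lam^-1 / 2)) by exact: measurable_cube.
have e0 : 0 <= lam^-1 / 2 by rewrite divr_ge0// invr_ge0 ltW.
have lC : nu (cube (lam^-1 / 2) `\` Z) = (lam^-1 ^+ n.+1)%:E.
  have -> : nu (cube (lam^-1 / 2) `\` Z) = nu (cube (lam^-1 / 2)).
    have Z0 : nu Z = 0%E.
      by apply: (leb_proj2_eq0 k0 _ QQ); apply: addr_ge0; rewrite ?invr_ge0; apply: ltW.
    have CZ0 : nu (cube (lam^-1 / 2) `&` Z) = 0%E.
      apply/eqP; rewrite eq_le measure_ge0 andbT -Z0.
      by apply: le_measure; rewrite ?inE//; exact: measurableI.
    apply/esym/(etrans (measureDI nu mC mZ)); rewrite -[RHS]adde0.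
    by congr (_ + _)%E; exact: CZ0.
  by rewrite leb_center_cube// mulrCA divff ?mulr1.
rewrite -lee_fin /Rintegral fineK; last exact: (integrable_fin_num measurableT iw).
apply: (@le_trans _ _ (\int[nu]_xi (a * \1_(cube (lam^-1 / 2) `\` Z) xi)%:E)%E).
  rewrite integral_cst_indic//; last exact: measurableD.
  by rewrite EFinM -lC.
apply: ge0_le_integral_nonmeas => xi _; first by rewrite lee_fin mulr_ge0.
rewrite lee_fin indicE.
have [/set_mem[h hZ]|_] := boolP (xi \in _); last first.
  by rewrite mulr0 weight_ge0.
rewrite mulr1; apply: weight_ge => //.
apply/eqP => p0; apply: hZ; split=> // j.
have := h j; have := lerB_dist (xi j 0) (center N j 0).
have : `|center N j 0| <= N.
  by rewrite mxE; case: ifP => _; [rewrite gtr0_norm|rewrite normr0 ltW].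
rewrite /B; lra.
Qed.

(** It is free of r and N. The two factors (n + 1)^(-(n + 1)) come from [lam] and from a cube inside
    the ball, whose powers of r cancel; 8 is the 4 in (N / 2)^2 times the 2 in [M]. *)
Definition lower_cst : R :=
  (fourier_const (R := R) (n := n.+1) * cos 1) ^+ 2 * expR (- 8) ^+ n.+1 *
  (n.+1%:R ^- n.+1) ^+ 2 * 8 `^ (- alpha).

Lemma L2norm_frac_laplacian_ge :
  ((lower_cst * ((N * r) ^+ 2 / ((N * r) ^+ 2 * p2 + 1)) `^ alpha)%:E <=
   (L2norm (eball r) (frac_laplacian alpha
     (fun x => riesz_potential k alpha (packet lam N) x Q))) ^+ 2)%E.
Proof.
set u := frac_laplacian _ _.
rewrite /L2norm sqr_poweR_half; last by apply: integral_ge0 => x _; rewrite lee_fin sqr_ge0.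
pose V : R := (fourier_const (R := R) (n := n.+1) * cos 1 * (a * lam^-1 ^+ n.+1)) ^+ 2.
have fc0 := @fourier_const_gt0 R n.+1.
have c10 := @cos1_gt0 R.
have V0 : 0 <= V by exact: sqr_ge0.
have uV x : eball r x -> V <= normc (u x) ^+ 2.
  move=> xr; rewrite /u frac_laplacian_riesz//.
  apply: le_trans (normc_inv_fourier_ge n0 lam0 N0 r0 lamN lamr k0 ak QQ xr).
  have fc1 := mulr_gt0 fc0 c10.
  have lv : 0 <= lam^-1 by rewrite invr_ge0 ltW.
  rewrite lerXn2r ?nnegrE//.
  - by rewrite (mulr_ge0 (ltW fc1))// mulr_ge0// exprn_ge0.
  - rewrite (mulr_ge0 (ltW fc1))// Rintegral_ge0// => xi _; exact: weight_ge0.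
  - by rewrite ler_pM2l ?mulr_gt0//; exact: integral_weight_ge.
(* A cube of half-side [e] lies in the ball, since the sum of its coordinates in absolute value is
   at most r / 2; its volume is explicit. *)
pose e := r / (2 * n.+1%:R).
have e0 : 0 <= e by rewrite divr_ge0 ?ltW// mulr_ge0.
pose S : set Rn := [set x | forall j, `|x j 0 - (0 : Rn) j 0| <= e].
have mS : measurable S.
  apply: measurable_forall_ord => i; apply: measurable_le_cst.
  by apply: measurableT_comp => //; apply: measurable_funB => //; exact: measurable_coord.
have SB : S `<=` eball r.
  move=> x xS; rewrite /eball /=.
  apply: (@le_lt_trans _ _ (r / 2)); last by rewrite ltr_pdivrMr// ltr_pMr// ltr1n.
  apply: (le_trans (enorm_le_sum _)).
  apply: (@le_trans _ _ (\sum_(i < n.+1) e)).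
    by apply: ler_sum => i _; have := xS i; rewrite mxE subr0.
  rewrite sumr_const card_ord -(mulr_natl e) /e le_eqVlt; apply/orP; left; apply/eqP.
  by move: (n.+1%:R) n1 => z z0; field.
apply: (@le_trans _ _ (\int[nu]_x (V * \1_S x)%:E)%E); last first.
  rewrite [leRHS]integral_mkcond.
  apply: ge0_le_integral_nonmeas => x _; first by rewrite lee_fin mulr_ge0.
  rewrite patchE indicE; have [xS|xS] := boolP (x \in S).
    by rewrite mem_set; [rewrite mulr1 lee_fin; apply: uV; apply: SB; exact: set_mem|apply: SB; exact: set_mem].
  by rewrite mulr0; case: ifP => // _; rewrite lee_fin sqr_ge0.
have lS : nu S = ((2 * e) ^+ n.+1)%:E by exact: leb_cube.
have -> : (\int[nu]_x (V * \1_S x)%:E = (V * (2 * e) ^+ n.+1)%:E)%E.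
  by rewrite EFinM -lS; exact: integral_cst_indic.
rewrite lee_fin le_eqVlt; apply/orP; left; apply/eqP.
have e2 : 2 * e = r / n.+1%:R by rewrite /e; move: (n.+1%:R) n1 => z z0; field.
have al0 : 0 <= alpha by case/andP: ak => /ltW.
have a2 : a ^+ 2 = (N ^+ 2 / 4 / M) `^ alpha * (lam ^+ n.+1 * expR (- 8) ^+ n.+1).
  rewrite /a exprMn.
  have -> : ((N / 2) `^ alpha) ^+ 2 = (N ^+ 2 / 4) `^ alpha.
    rewrite -powR_mulrn ?powR_ge0// powRAC powR_mulrn ?divr_ge0 ?ltW//.
    by congr (_ `^ _); field.
  rewrite [X in _ * X]exprMn exprVn.
  have -> : (M `^ (alpha / 2)) ^+ 2 = M `^ alpha.
    by rewrite -powR_mulrn ?powR_ge0// -powRrM; congr (_ `^ _); field.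
  have -> : ((Num.sqrt lam * expR (- 4)) ^+ n.+1) ^+ 2 = lam ^+ n.+1 * expR (- 8) ^+ n.+1.
    rewrite exprAC (exprMn 2 (Num.sqrt lam)) sqr_sqrtr ?ltW// -(expRM_natl 2 (- 4)).
    by rewrite exprMn; congr (_ * expR _ ^+ _); lra.
  have -> : (N ^+ 2 / 4 / M) `^ alpha = (N ^+ 2 / 4) `^ alpha / M `^ alpha.
    rewrite powRM ?divr_ge0 ?invr_ge0 ?sqr_ge0 ?(ltW M0)//.
    by rewrite -(powR_inv1 (ltW M0)) powRAC powR_inv1 ?powR_ge0.
  ring.
have quot : N ^+ 2 / 4 / M = ((N * r) ^+ 2 / ((N * r) ^+ 2 * p2 + 1)) / 8.
  have q0 : 0 < N ^+ 2 * p2 + r^-1 ^+ 2.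
    by move: M0; rewrite /M pmulr_rgt0.
  have q1 : 0 < (N * r) ^+ 2 * p2 + 1 by rewrite ltr_wpDl// mulr_ge0 ?proj2_ge0 ?sqr_ge0.
  have -> : M = 2 * (((N * r) ^+ 2 * p2 + 1) / r ^+ 2).
    rewrite /M; congr (_ * _); field; by rewrite gt_eqF.
  field; rewrite (gt_eqF r0)/= andbT; move: q1; rewrite exprMn => q1.
  by rewrite gt_eqF.
rewrite /V (exprMn 2 (_ * cos 1)) (exprMn 2 a) a2 quot e2 /lower_cst.
have T1 : 0 <= (N * r) ^+ 2 * p2 + 1 by rewrite addr_ge0// mulr_ge0 ?proj2_ge0 ?sqr_ge0.
have T0 : 0 <= (N * r) ^+ 2 / ((N * r) ^+ 2 * p2 + 1) by rewrite divr_ge0 ?sqr_ge0.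
have i8 : 0 <= 8^-1 :> R by rewrite invr_ge0.
rewrite (powRM _ T0 i8) powRN.
have -> : (8^-1 `^ alpha) = (8 `^ alpha)^-1 :> R.
  by rewrite -(powR_inv1 (ler0n _ 8)) powRAC powR_inv1 ?powR_ge0.
rewrite [(r / _) ^+ _]exprMn !exprVn lamr [(n.+1%:R * r) ^+ n.+1]exprMn.
have p8 : 8 `^ alpha != 0 :> R by rewrite gt_eqF// powR_gt0.
have nn : (n.+1%:R : R) ^+ n.+1 != 0 by rewrite expf_neq0.
have rn : r ^+ n.+1 != 0 by rewrite expf_neq0// gt_eqF.
move: (n.+1%:R ^+ n.+1) (r ^+ n.+1) (8 `^ alpha) (expR (- 8) ^+ n.+1) (_ `^ alpha) nn rn p8.
move=> x1 x2 x3 x4 x5 x10 x20 x30; field.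
by rewrite x10 x20 x30.
Qed.

End average_lower_bound.

(** * Haar measure on SO(n) *)

Section rotations.
Context {R : realType} {n : nat}.
Local Notation Rn := 'cV[R]_n.+1.
Local Notation e0 := (@basis_vec R n.+1 ord0).
Implicit Types (Q S P : 'M[R]_n.+1) (w : Rn).

Lemma SO_mul S P : SO S -> SO (S *m P) <-> SO P.
Proof.
move=> [SS dS]; rewrite /SO /= trmx_mul -mulmxA (mulmxA S^T) SS mul1mx det_mulmx dS mul1r.
by [].
Qed.

Lemma proj2_mul k S P w : proj2 k (S *m P) w = proj2 k P (S^T *m w).
Proof. by apply: eq_bigr => j _; rewrite !dot_col trmx_mul mulmxA. Qed.

Lemma mulmx_dot (v w : Rn) : v *m v^T *m w = dot v w *: v.
Proof.
rewrite -mulmxA; apply/matrixP => i j; rewrite (ord1 j) !mxE big_ord1 mulrC dotE.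
by rewrite !mxE.
Qed.

Lemma exists_rotation w : (0 < n)%N -> dot w w = 1 -> exists2 S, SO S & S^T *m w = e0.
Proof.
move=> n0 w1; suff [S SS Sw] : exists2 S, SO S & S *m e0 = w.
  by exists S => //; rewrite -Sw mulmxA (SO_orthonormal SS) mul1mx.
have [->|we] := eqVneq w e0.
  by exists 1%:M; rewrite ?mul1mx//; split; rewrite ?trmx1 ?mulmx1 ?det1.
pose v := w - e0.
have e00 : dot e0 e0 = 1 by rewrite dot_basis /basis_vec mxE !eqxx.
have vv : dot v v = 2 - 2 * dot e0 w.
  have dNr x y : dot x (- y) = - dot x y :> R by rewrite dotC dotNl dotC.
  by rewrite /v dotDl !dotDr !dotNl !dNr w1 e00 (dotC w e0); ring.
have ve : dot v e0 = dot e0 w - 1 by rewrite /v dotDl dotNl e00 (dotC w).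
have vv0 : dot v v != 0.
  apply/negP => /eqP H; move/eqP: we; apply.
  apply/eqP; rewrite -subr_eq0 -/v; apply/eqP/colP => i; rewrite [RHS]mxE.
  have /psumr_eq0P : \sum_i v i 0 * v i 0 = 0 by exact: H.
  move=> /(_ (fun i _ => _)) /(_ i isT)/eqP; rewrite mulf_eq0 orbb => /(_ _)/eqP; apply.
  by move=> j; rewrite -expr2 sqr_ge0.
(* The Householder reflection that exchanges [w] and [e0], corrected by a sign
   change of another coordinate to have determinant 1. *)
pose c := 2 / dot v v.
pose H : 'M[R]_n.+1 := 1%:M - c *: (v *m v^T).
have HT : H^T = H.
  by rewrite /H linearB linearZ/= trmx1 trmx_mul trmxK.
have HH : H^T *m H = 1%:M.
  rewrite HT {1}/H mulmxBl mul1mx -scalemxAl /H mulmxBr mulmx1 -scalemxAr.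
  have -> : v *m v^T *m (v *m v^T) = dot v v *: (v *m v^T).
    by rewrite mulmxA mulmx_dot -scalemxAl.
  rewrite scalerBr !scalerA.
  have -> : c * c * dot v v = c + c by rewrite /c; field.
  rewrite scalerDl !opprB; apply/matrixP => i j; rewrite !mxE; ring.
have He : H *m e0 = w.
  rewrite /H mulmxBl mul1mx -scalemxAl mulmx_dot scalerA.
  have -> : c * dot v e0 = -1.
    by rewrite /c ve; move: vv0; rewrite vv => vv0; field.
  by rewrite scaleN1r opprK /v addrC subrK.
have dH : \det H = 1 \/ \det H = -1.
  have : \det H ^+ 2 == 1 by rewrite expr2 -{1}det_tr -det_mulmx HH det1.
  by rewrite sqrf_eq1 => /orP[/eqP|/eqP]; [left|right].
case: dH => dH; first by exists H.
pose D : 'M[R]_n.+1 := diag_mx (\row_j (if j == ord_max then -1 else 1)).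
have DT : D^T = D by rewrite /D tr_diag_mx.
exists (H *m D).
  split.
    rewrite trmx_mul -mulmxA (mulmxA H^T) HH mul1mx DT /D mulmx_diag.
    apply/matrixP => i j; rewrite !mxE; congr (_ *+ _).
    by case: ifP => _; rewrite ?mulr1 ?mulrNN ?mulr1.
  rewrite det_mulmx dH det_diag (bigD1 ord_max)//= mxE eqxx.
  rewrite big1 ?mulr1 ?mulrNN ?mulr1// => j /negbTE jm; rewrite mxE jm//.
rewrite -mulmxA (_ : D *m e0 = e0)//.
apply/colP => i; rewrite mul_diag_mx !mxE eqxx andbT.
case: ifP => [/eqP->|_]; last by rewrite mul1r.
(* Dimension at least 2 enters here: the coordinate whose sign is changed is not the first one. *)
by rewrite (_ : (ord_max == ord0) = false) ?mulr0// -val_eqE/= gtn_eqF.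
Qed.

Lemma measurable_SO : measurable (@SO R n.+1).
Proof.
have -> : @SO R n.+1 = [set Q | forall i, forall j, (Q^T *m Q) i j = (1%:M : 'M[R]_n.+1) i j] `&`
    [set Q | \det Q = 1].
  by apply/seteqP; split => Q [QQ dQ]; split=> //=; [rewrite QQ|apply/matrixP].
have meq (f : 'M[R]_n.+1 -> R) (c : R) : measurable_fun setT f -> measurable [set Q | f Q = c].
  move=> mf; rewrite -[X in measurable X]setTI.
  exact: (mf measurableT _ (measurable_set1 c)).
have mforall (P : 'I_n.+1 -> set 'M[R]_n.+1) : (forall i, measurable (P i)) ->
    measurable [set Q | forall i, P i Q].
  move=> mP; rewrite (_ : [set _ | _] = \bigcap_(i in [set: 'I_n.+1]) P i).
    by apply: fin_bigcap_measurable => // i _.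
  by apply/seteqP; split => y /= h i => [_|]; exact: h.
apply: measurableI.
  apply: (mforall _) => i; apply: (mforall _) => j; apply: (meq _).
  under eq_fun do rewrite mxE; apply: measurable_sum => l.
  by apply: measurable_funM => //; under eq_fun do rewrite ?mxE; exact: measurable_coord.
apply: meq; rewrite /determinant; apply: measurable_sum => s.
apply: measurable_funM => //; apply: measurable_prod => i _; exact: measurable_coord.
Qed.

Lemma measurable_proj2_rotation k w : measurable_fun setT (fun Q => proj2 k Q w).
Proof.
rewrite /proj2; under eq_fun do rewrite big_mkcond/=.
apply: measurable_sum => j; case: (_ < _)%N; last exact: measurable_cst.
apply: measurable_funX; under eq_fun do rewrite dot_col mxE.
apply: measurable_sum => l; apply: measurable_funM => //.
by under eq_fun do rewrite mxE; exact: measurable_coord.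
Qed.

Definition close_rotations k w (e : R) : set 'M[R]_n.+1 :=
  SO `&` [set Q | proj2 k Q w <= e].

Lemma measurable_close_rotations k w e : measurable (close_rotations k w e).
Proof.
apply: measurableI; first exact: measurable_SO.
have := measurable_proj2_rotation k w measurableT (measurable_itv `]-oo, e]%R).
by rewrite setTI; congr measurable; apply/seteqP; split => Q /=; rewrite in_itv.
Qed.

Variables (mu : probability 'M[R]_n.+1 R).
Hypothesis haar : is_haar_SO mu.

(** Left translation by a rotation S with S^T w = e_1 carries one set to the other, because P_(S Q)
    w has the same length as P_Q (S^T w). *)
Lemma haar_close_rotations k w e : (0 < n)%N -> dot w w = 1 ->
  mu (close_rotations k w e) = mu (close_rotations k e0 e).
Proof.
move=> n0 w1; have [S SS Sw] := exists_rotation n0 w1.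
have := haar.2 _ SS _ (measurable_close_rotations k w e) => <-.
congr (mu _); apply/seteqP; split => P; rewrite /close_rotations /=.
  by move=> [/(SO_mul _ SS) h]; rewrite /= proj2_mul Sw.
by move=> [h1 h2]; split; [apply/(SO_mul _ SS)|rewrite /= proj2_mul Sw].
Qed.

End rotations.

(** * Covering of SO(n) by a grid of directions *)

Section covering.
Context {R : realType} {n k : nat}.
Local Notation Rn := 'cV[R]_n.+1.
Local Notation e0 := (@basis_vec R n.+1 ord0).
Hypotheses (n0 : (0 < n)%N) (kn : (k < n.+1)%N).
Implicit Types (Q : 'M[R]_n.+1).

(* A point of a grid on the boundary of the cube [-1, 1]^(k+1), embedded in the
   first coordinates: [p.1] is a coordinate equal to 1, [p.2] gives the others. *)
Definition grid_point (m : nat) (p : 'I_k.+1 * {ffun 'I_k -> 'I_(2 * m).+1}) : Rn :=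
  \col_i (if insub (val i) is Some i' then
            (if unlift p.1 i' is Some j then (p.2 j)%:R / m%:R - 1 else 1)
          else 0).

Lemma dot_grid_point_ge1 m p : 1 <= dot (grid_point (m := m) p) (grid_point p).
Proof.
rewrite /dot (bigD1 (widen_ord kn p.1))//= mxE.
rewrite (_ : insub _ = Some p.1); last exact: (valK p.1).
rewrite unlift_none mulr1 lerDl sumr_ge0// => j _.
by rewrite -expr2 sqr_ge0.
Qed.

(** k linear equations in k + 1 unknowns have a nonzero solution; dividing it by an entry of largest
    modulus puts it on the boundary of the cube. Using only k + 1 coordinates keeps the grid of
    dimension k. *)
Lemma exists_orthogonal Q : exists l : 'I_k.+1, exists u : 'rV[R]_k.+1,
  [/\ u 0 l = 1, forall i, `|u 0 i| <= 1 &
    forall j : 'I_n.+1, (j < k)%N -> \sum_i u 0 i * Q (widen_ord kn i) j = 0].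
Proof.
pose A : 'M[R]_(k.+1, k) := \matrix_(i, j) Q (widen_ord kn i) (widen_ord (ltnW kn) j).
have K0 : kermx A != 0.
  rewrite -mxrank_eq0 mxrank_ker subn_eq0 -ltnNge.
  by rewrite (leq_ltn_trans (rank_leq_col A)).
pose v := nz_row (kermx A).
have v0 : v != 0 by rewrite nz_row_eq0.
have vA : v *m A = 0 by apply/sub_kermxP; exact: nz_row_sub.
pose l := [arg max_(i > ord0) `|v 0 i|]%O.
have lmax i : `|v 0 i| <= `|v 0 l|.
  by rewrite /l; case: arg_maxP => // i0 _ h; exact: h.
have vl : v 0 l != 0.
  apply/negP => /eqP vl; move/eqP: v0; apply; apply/rowP => i.
  by rewrite mxE; apply/eqP; rewrite -normr_le0 (le_trans (lmax i))// vl normr0.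
exists l, ((v 0 l)^-1 *: v); split.
- by rewrite mxE mulVf.
- by move=> i; rewrite mxE normrM normfV ler_pdivrMl ?normr_gt0// mulr1.
- move=> j jk; have /rowP/(_ (Ordinal jk)) := vA; rewrite !mxE => E.
  apply: etrans (etrans (congr1 ( *%R (v 0 l)^-1) E) (mulr0 _)); rewrite mulr_sumr.
  apply: eq_bigr => i _; rewrite mxE mulrA; congr (_ * _); rewrite mxE; congr (Q _ _).
  exact: val_inj.
Qed.

(** The exact solution w has zero projection, so the grid point z projects like z - w, whose entries
    are at most 1 / m in absolute value. *)
Lemma grid_point_close Q m : (0 < m)%N -> Q^T *m Q = 1%:M ->
  exists p, proj2 k Q (grid_point (m := m) p) <= (n.+1%:R / m%:R) ^+ 2.
Proof.
move=> m0 QQ; have [l [u [ul u1 uQ]]] := exists_orthogonal Q.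
have mp : (0 : R) < m%:R by rewrite ltr0n.
(* Adding 1 moves the entries to [0, 2], where rounding down m times the entry gives an integer
   between 0 and 2 m. *)
pose g : {ffun 'I_k -> 'I_(2 * m).+1} :=
  [ffun j => inord (Num.truncn ((u 0 (lift l j) + 1) * m%:R))].
exists (l, g); set z := grid_point _.
pose w : Rn := \col_i (if insub (val i) is Some i' then u 0 i' else 0).
have dw (j : 'I_n.+1) : (j < k)%N -> dot (Q *m basis_vec j) w = 0.
  move=> jk; rewrite dot_col mxE -[RHS](uQ j jk).
  rewrite (bigID (fun i : 'I_n.+1 => (i < k.+1)%N))/= [X in _ + X]big1 ?addr0; last first.
    by move=> i ik; rewrite [w _ _]mxE insubF ?mulr0//; exact/negbTE.
  rewrite (big_ord_narrow kn)/=; apply: eq_bigr => i _.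
  rewrite !mxE (_ : insub _ = Some i); last exact: (valK i).
  by rewrite mulrC.
have -> : proj2 k Q z = proj2 k Q (z - w).
  apply: eq_bigr => j jk; rewrite dotDr.
  have -> : dot (Q *m basis_vec j) (- w) = 0 by rewrite dotC dotNl dotC dw ?oppr0.
  by rewrite addr0.
apply: (le_trans (proj2_le_dot _ _ QQ)); rewrite -sqr_enorm.
rewrite lerXn2r ?nnegrE ?enorm_ge0 ?divr_ge0//.
apply: (le_trans (enorm_le_sum _)).
apply: (@le_trans _ _ (\sum_(i < n.+1) m%:R^-1)); last first.
  by rewrite sumr_const card_ord -(mulr_natl m%:R^-1).
apply: ler_sum => i _; rewrite !mxE.
case: insubP => [i' _ ii'|_]; last by rewrite subr0 normr0 invr_ge0 ltW.
case: unliftP => [j ->|->]; last by rewrite ul subrr normr0 invr_ge0 ltW.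
rewrite ffunE /=.
set y := (u 0 (lift l j) + 1) * m%:R.
have := u1 (lift l j); rewrite ler_norml => /andP[h1 h2].
have y0 : 0 <= y by apply: mulr_ge0; [lra|exact: ltW].
have y2 : y <= (2 * m)%:R by rewrite natrM ler_pM2r//; lra.
have /andP[t1 t2] := truncn_itv y0.
rewrite inordK; last first.
  by rewrite ltnS -(ler_nat R) (le_trans t1).
have -> : (Num.truncn y)%:R / m%:R - 1 - u 0 (lift l j) = ((Num.truncn y)%:R - y) / m%:R.
  by rewrite /y; field; rewrite gt_eqF.
rewrite normrM normfV (gtr0_norm mp); apply: ler_piMl; first by rewrite invr_ge0 ltW.
rewrite ler_norml; apply/andP; split; move: t1 t2; rewrite -natr1; lra.
Qed.

Variables (mu : probability 'M[R]_n.+1 R).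
Hypothesis haar : is_haar_SO mu.

Lemma measure_bigU_le (I : finType) (F : I -> set 'M[R]_n.+1) (s : seq I) :
  (forall i, measurable (F i)) ->
  (mu (\big[setU/set0]_(i <- s) F i) <= \sum_(i <- s) mu (F i))%E.
Proof.
move=> mF; elim: s => [|i s ih]; first by rewrite !big_nil measure0.
rewrite !big_cons (le_trans (measureU2 mu (mF i) _))//; last by rewrite leeD2l.
by apply: bigsetU_measurable => j _.
Qed.

(* The sets [close_rotations k (w q) d], for [q] in the grid, cover [SO] and are
   translates of one another. *)
Lemma haar_close_ge m : (0 < m)%N ->
  (((k.+1 * (3 * m) ^ k)%:R^-1)%:E <=
    mu (close_rotations k e0 ((n.+1%:R / m%:R) ^+ 2)))%E.
Proof.
move=> m0; set d := (_ / _) ^+ 2; set p := mu _.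
have pfin : p \is a fin_num by apply: fin_num_measure; exact: measurable_close_rotations.
pose z (q : 'I_k.+1 * {ffun 'I_k -> 'I_(2 * m).+1}) := grid_point q.
(* Invariance needs unit vectors. Grid points have length at least 1, so normalising only shortens
   their projections. *)
pose w q : Rn := (Num.sqrt (dot (z q) (z q)))^-1 *: z q.
have z1 q : 1 <= dot (z q) (z q) by exact: dot_grid_point_ge1.
have z0 q : 0 < dot (z q) (z q) by exact: lt_le_trans (z1 q).
have w1 q : dot (w q) (w q) = 1.
  rewrite /w dotZl dotZr mulrA -invfM -expr2 sqr_sqrtr ?ltW// mulVf//.
  by rewrite gt_eqF.
pose F q := close_rotations k (w q) d.
have mF q : measurable (F q) by exact: measurable_close_rotations.
have cover : SO `<=` \big[setU/set0]_(q <- index_enum _) F q.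
  move=> Q SQ; have [q hq] := grid_point_close m0 (SO_orthonormal SQ).
  rewrite -bigcup_seq; exists q => /=; first by rewrite mem_index_enum.
  split=> //=; apply: le_trans hq.
  rewrite /w proj2Z exprVn (sqr_sqrtr (ltW (z0 q))) ler_piMl ?proj2_ge0//.
  by rewrite invf_le1.
have : (1 <= \sum_(q : 'I_k.+1 * {ffun 'I_k -> 'I_(2 * m).+1}) p)%E.
  rewrite -haar.1; apply: (@le_trans _ _ (mu (\big[setU/set0]_(q <- index_enum _) F q))).
    apply: le_measure; rewrite ?inE//; first exact: measurable_SO.
    by apply: bigsetU_measurable => q _.
  apply: (le_trans (measure_bigU_le _ mF)); apply: lee_sum => q _.
  by rewrite (haar_close_rotations haar _ _ n0 (w1 q)).
have -> : p = (fine p)%:E by rewrite fineK.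
rewrite sumEFin sumr_const card_prod card_ord card_ffun !card_ord.
rewrite !lee_fin -(mulr_natl (fine p)) => h.
have p0 : 0 <= fine p by apply: fine_ge0; exact: measure_ge0.
have c0 : 0 < (k.+1 * (3 * m) ^ k)%:R :> R by rewrite ltr0n muln_gt0 expn_gt0 muln_gt0 m0.
suff : 1 <= (k.+1 * (3 * m) ^ k)%:R * fine p by rewrite -ler_pdivrMl// mulr1.
apply: (le_trans h).
(* The grid has (k + 1) (2 m + 1)^k points, and 2 m + 1 <= 3 m. *)
rewrite ler_wpM2r// ler_nat leq_mul2l/=.
case: (posnP k) => [->|k0]; first by rewrite !expn0.
by rewrite leq_exp2r// (mulnDl 1 2 m) mul1n -add1n leq_add2r.
Qed.

End covering.

(** * Growth of the average over rotations *)

Section haar_growth.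
Context {R : realType} {n k : nat}.
Local Notation e0 := (@basis_vec R n.+1 ord0).
Hypotheses (n0 : (0 < n)%N) (k0 : (0 < k)%N) (kn : (k < n.+1)%N).
Variables (mu : probability 'M[R]_n.+1 R) (alpha : R).
Hypotheses (haar : is_haar_SO mu) (ak : k%:R / 2 <= alpha).
Implicit Types (Q : 'M[R]_n.+1) (F : 'M[R]_n.+1 -> \bar R).
Local Notation A m := (close_rotations k e0 ((n.+1%:R / m%:R) ^+ 2)).

Let alpha0 : 0 < alpha.
Proof. by apply: lt_le_trans ak; rewrite divr_gt0// ltr0n. Qed.

(** The step function is measurable and its integral is bounded below by [haar_close_ge]; F is only
    compared pointwise, so it may be any function above it. *)
Lemma sum_le_integral_SO (J : nat) (b : nat -> R) (m : nat -> nat) F :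
  (forall j, 0 <= b j) -> (forall j, (0 < m j)%N) ->
  (forall Q, SO Q -> ((\sum_(j < J) b j * \1_(A (m j)) Q)%:E <= F Q)%E) ->
  ((\sum_(j < J) b j / (k.+1 * (3 * m j) ^ k)%:R)%:E <= \int[mu]_(Q in SO) F Q)%E.
Proof.
move=> b0 m0 bF.
apply: (@le_trans _ _ (\int[mu]_Q (\sum_(j < J) (b j * \1_(A (m j)) Q)%:E))%E).
  rewrite ge0_integral_sum//; last 2 first.
  - move=> j; apply/measurable_EFinP; apply: measurable_funM => //.
    by apply: measurable_indic; exact: measurable_close_rotations.
  - by move=> j Q _; rewrite lee_fin mulr_ge0.
  rewrite -sumEFin; apply: lee_sum => j _.
  rewrite integral_cst_indic//; last exact: measurable_close_rotations.
  by rewrite EFinM lee_wpmul2l ?lee_fin//; exact: haar_close_ge.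
rewrite [leRHS]integral_mkcond; apply: ge0_le_integral_nonmeas => Q _.
  by apply: sume_ge0 => j _; rewrite lee_fin mulr_ge0.
rewrite patchE; have [/set_mem SQ|SQ] := boolP (Q \in SO).
  by rewrite sumEFin; exact: bF.
rewrite big1// => j _; rewrite indicE memNset ?mulr0// => -[SQ' _].
by rewrite mem_set in SQ.
Qed.

Let K : R := n.+1%:R ^+ 2 + 1.
Let K0 : 0 < K. Proof. by rewrite ltr_wpDl// sqr_ge0. Qed.

Let Phi (t : R) Q : R := (t ^+ 2 / (t ^+ 2 * proj2 k Q e0 + 1)) `^ alpha.

(** If |P_Q e_1| <= (n + 1) / x with x <= t, then x^2 (t^2 |P_Q e_1|^2 + 1) <= t^2 ((n + 1)^2 + 1),
    and the last factor is [K]. *)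
Lemma density_ge (t x : R) Q : 0 < t -> 0 < x -> x <= t ->
  proj2 k Q e0 <= (n.+1%:R / x) ^+ 2 -> (x ^+ 2 / K) `^ alpha <= Phi t Q.
Proof.
move=> t0 x0 xt pQ; have p0 := proj2_ge0 k Q e0.
have d0 : 0 < t ^+ 2 * proj2 k Q e0 + 1 by rewrite ltr_wpDl// mulr_ge0// sqr_ge0.
have t2 : 0 < t ^+ 2 by rewrite exprn_gt0.
have x2 : 0 < x ^+ 2 by rewrite exprn_gt0.
rewrite /Phi ge0_ler_powR ?nnegrE ?(ltW alpha0)//.
- by rewrite divr_ge0 ?sqr_ge0// ltW.
- by rewrite divr_ge0 ?sqr_ge0// ltW.
rewrite ler_pdivrMr// mulrAC ler_pdivlMr// mulrDr mulr1.
have h1 : x ^+ 2 <= t ^+ 2 by rewrite lerXn2r ?nnegrE// ltW.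
have h2 : x ^+ 2 * proj2 k Q e0 <= n.+1%:R ^+ 2.
  by move: pQ; rewrite exprMn exprVn ler_pdivlMr// mulrC.
rewrite /K mulrDr mulr1 lerD// mulrCA ler_pM2l//.
Qed.

(** A single scale suffices: for t <= m <= 2 t the density is of order t^(2 alpha) on a set of
    measure of order t^(-k). The 6 is the 3 of the grid count times the 2 in m <= 2 t. *)
Lemma haar_growth_gt (c0 t : R) F : k%:R / 2 < alpha -> 0 < c0 -> 1 <= t ->
  (forall Q, SO Q -> ((c0 * Phi t Q)%:E <= F Q)%E) ->
  ((t `^ (2 * alpha - k%:R))%:E <=
    (K `^ alpha * (k.+1%:R * 6 ^+ k) / c0)%:E * \int[mu]_(Q in SO) F Q)%E.
Proof.
move=> ak' c00 t1 hF; have t0 : 0 < t by exact: lt_le_trans t1.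
pose m := (Num.truncn t).+1.
have /andP[mt tm] := truncn_itv (ltW t0).
have m2t : m%:R <= 2 * t.
  rewrite /m -natr1; have -> : 2 * t = t + t by ring.
  exact: lerD.
have mp : 0 < m%:R :> R by rewrite ltr0n.
pose b := c0 * (t ^+ 2 / K) `^ alpha.
have b0 : 0 <= b by rewrite mulr_ge0 ?powR_ge0// ltW.
have := @sum_le_integral_SO 1 (fun=> b) (fun=> m) F (fun=> b0) (fun=> isT).
rewrite !big_ord1 => H; have {}H := H _.
have Fb : ((b / (k.+1 * (3 * m) ^ k)%:R)%:E <= \int[mu]_(Q in SO) F Q)%E.
  apply: H => Q SQ; rewrite big_ord1; apply: le_trans (hF Q SQ).
  rewrite lee_fin indicE; have [/set_mem[_ hQ]|_] := boolP (Q \in _); last first.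
    by rewrite mulr0 mulr_ge0 ?powR_ge0// ltW.
  rewrite mulr1 /b ler_pM2l//; apply: density_ge => //.
  apply: (le_trans hQ); rewrite lerXn2r ?nnegrE ?divr_ge0 ?(ltW t0)//.
  by rewrite ler_pM2l ?ltr0n// lef_pV2 ?posrE// ltW.
set c := _ / c0.
have cp : 0 <= c.
  by rewrite /c divr_ge0 ?(ltW c00)// mulr_ge0 ?powR_ge0// mulr_ge0// exprn_ge0.
apply: (@le_trans _ _ (c%:E * (b / (k.+1 * (3 * m) ^ k)%:R)%:E)%E); last first.
  by rewrite lee_wpmul2l.
rewrite -EFinM lee_fin.
have E : t `^ (2 * alpha - k%:R) = (t ^+ 2) `^ alpha / t ^+ k.
  rewrite powRB ?(gt_eqF t0) ?implybT// powR_mulrn ?(ltW t0)// powRrM powR_mulrn ?(ltW t0)//.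
have -> : c * (b / (k.+1 * (3 * m) ^ k)%:R) = (t ^+ 2) `^ alpha * (6 ^+ k / (3 * m%:R) ^+ k).
  rewrite /c /b powRM ?sqr_ge0 ?invr_ge0 ?(ltW K0)//.
  rewrite -(powR_inv1 (ltW K0)) (powRAC K) powR_inv1 ?powR_ge0//.
  rewrite natrM natrX natrM.
  have h1 : K `^ alpha != 0 by rewrite gt_eqF// powR_gt0.
  have h2 : (k.+1%:R : R) != 0 by rewrite pnatr_eq0.
  have h3 : (3 * m%:R : R) ^+ k != 0 by rewrite expf_neq0// mulf_neq0 ?pnatr_eq0.
  have h4 : c0 != 0 by rewrite gt_eqF.
  move: (K `^ alpha) (k.+1%:R) ((3 * m%:R) ^+ k) h1 h2 h3 => x1 x2 x3 h1 h2 h3.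
  by field; rewrite h1 h2 h3 h4.
have h : (t ^+ k)^-1 <= 6 ^+ k / (3 * m%:R) ^+ k.
  have -> : 6 ^+ k / (3 * m%:R) ^+ k = (6 / (3 * m%:R)) ^+ k :> R by rewrite expr_div_n.
  rewrite -exprVn; apply: lerXn2r; rewrite ?nnegrE ?invr_ge0 ?(ltW t0) ?divr_ge0 ?mulr_ge0 ?ler0n//.
  rewrite ler_pdivlMr ?mulr_gt0 ?ltr0n// mulrC ler_pdivrMr//; lra.
by rewrite E; exact: (ler_wpM2l (powR_ge0 _ _) h).
Qed.

(** A partial geometric sum is at most twice its largest active term, as k >= 1. A superposition of
    indicators at all scales is thus controlled by the density bound at one scale. *)
Lemma geometric_indicator_le (p : nat -> bool) (J : nat) :
  (exists2 j, (j <= J)%N & p j /\ \sum_(i < J.+1) (2 ^+ (i * k)) * (p i)%:R <= 2 * 2 ^+ (j * k) :> R) \/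
  \sum_(i < J.+1) (2 ^+ (i * k)) * (p i)%:R = 0 :> R.
Proof.
elim: J => [|J [[j jJ [pj ih]]|ih]].
- rewrite !big_ord1; have [p0|p0] := boolP (p 0); last by right; rewrite mulr0.
  by left; exists 0 => //; split=> //; rewrite mul0n expr0 !mulr1 ler1n.
- rewrite big_ord_recr/=; have [p0|p0] := boolP (p J.+1); last first.
    by left; exists j; rewrite ?(leq_trans jJ)// mulr0 addr0.
  left; exists J.+1 => //; split=> //.
  rewrite mulr1 [leRHS]mulr_natl mulr2n lerD2r (le_trans ih)//.
  rewrite -exprS ler_eXn2l ?ltr1n//.
  by rewrite mulSn -add1n leq_add// leq_mul2r jJ orbT.
- rewrite big_ord_recr/= ih add0r; have [p0|p0] := boolP (p J.+1); last by right; rewrite mulr0.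
  left; exists J.+1 => //; split=> //.
  by rewrite mulr1 ler_peMl ?exprn_ge0// ler1n.
Qed.

(* At the critical exponent each scale [2 ^ j <= t] contributes the same amount. *)
Lemma haar_growth_eq (c0 t : R) F : alpha = k%:R / 2 -> 0 < c0 -> 1 <= t ->
  (forall Q, SO Q -> ((c0 * Phi t Q)%:E <= F Q)%E) ->
  ((ln t)%:E <=
    (2 * K `^ alpha * (k.+1%:R * 3 ^+ k) / c0)%:E * \int[mu]_(Q in SO) F Q)%E.
Proof.
move=> ak' c00 t1 hF; have t0 : 0 < t by exact: lt_le_trans t1.
have /andP[mt tm] := truncn_itv (ltW t0).
have tr0 : (0 < Num.truncn t)%N.
  by rewrite truncn_gt0.
pose J := trunc_log 2 (Num.truncn t).
have J1 : 2 ^+ J <= t.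
  by apply: le_trans mt; rewrite -natrX ler_nat; exact: trunc_logP.
have J2 : t <= 2 ^+ J.+1.
  apply: (le_trans (ltW tm)); rewrite -natrX ler_nat; exact: trunc_log_ltn.
have Kp : 0 < K `^ alpha by rewrite powR_gt0.
(* The weight 2^(j k) is the density at scale 2^j for alpha = k / 2 and compensates the measure of
   order 2^(- j k); the 2 pays for [geometric_indicator_le]. *)
pose b j : R := c0 * (2 ^+ (j * k) / (2 * K `^ alpha)).
have b0 j : 0 <= b j.
  by rewrite mulr_ge0 ?(ltW c00)// divr_ge0 ?exprn_ge0// mulr_ge0// ltW.
have m0 j : (0 < 2 ^ j)%N by rewrite expn_gt0.
have := @sum_le_integral_SO J.+1 b (fun j => 2 ^ j)%N F b0 m0.
move=> H; have {}H := H _.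
have Fb : ((\sum_(j < J.+1) b j / (k.+1 * (3 * 2 ^ j) ^ k)%:R)%:E <= \int[mu]_(Q in SO) F Q)%E.
  apply: H => Q SQ; apply: le_trans (hF Q SQ); rewrite lee_fin.
  have -> : \sum_(j < J.+1) b j * \1_(A (2 ^ j)%N) Q =
      c0 * ((2 * K `^ alpha)^-1 * \sum_(j < J.+1) 2 ^+ (j * k) * (Q \in A (2 ^ j)%N)%:R).
    by rewrite !mulr_sumr; apply: eq_bigr => j _; rewrite /b indicE; ring.
  rewrite ler_pM2l//.
  case: (geometric_indicator_le (fun j => Q \in A (2 ^ j)%N) J); last first.
    by move=> ->; rewrite mulr0 powR_ge0.
  move=> [j jJ [/set_mem[_ hQ] le2]].
  rewrite ler_pdivrMl ?mulr_gt0// (le_trans le2)// -mulrA ler_pM2l//.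
  have tj : 2 ^+ j <= t by apply: le_trans J1; rewrite ler_weXn2l// ler1n.
  have := @density_ge t (2 ^+ j) Q t0 (exprn_gt0 _ (ltr0n _ 2)) tj.
  rewrite -natrX => /(_ hQ) => D.
  rewrite -ler_pdivrMl//; apply: le_trans D.
  rewrite powRM ?sqr_ge0 ?invr_ge0 ?(ltW K0)//.
  rewrite -(powR_inv1 (ltW K0)) (powRAC K) powR_inv1 ?powR_ge0// mulrC ler_wpM2r ?invr_ge0 ?(ltW Kp)//.
  rewrite ak' natrX -exprM -powR_mulrn ?exprn_ge0// le_eqVlt; apply/orP; left; apply/eqP.
  rewrite -(@powR_mulrn R 2 (j * 2)) ?ler0n// -powRrM; congr (_ `^ _).
  by rewrite !natrM; field.
set c := _ / c0.
have cp : 0 <= c.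
  by rewrite /c divr_ge0 ?(ltW c00)// mulr_ge0 ?mulr_ge0 ?exprn_ge0// ltW.
apply: (@le_trans _ _ (c%:E * (\sum_(j < J.+1) b j / (k.+1 * (3 * 2 ^ j) ^ k)%:R)%:E)%E); last first.
  by rewrite lee_wpmul2l.
rewrite -EFinM lee_fin mulr_sumr (eq_bigr (fun=> 1)); last first.
  move=> j _; rewrite /c /b natrM natrX natrM natrX exprMn exprM.
  have h2 : (k.+1%:R : R) != 0 by rewrite pnatr_eq0.
  have h3 : (3 : R) ^+ k != 0 by rewrite expf_neq0// pnatr_eq0.
  have h5 : ((2 : R) ^+ j) ^+ k != 0 by rewrite !expf_neq0// pnatr_eq0.
  have h4 : c0 != 0 by rewrite gt_eqF.
  have h1 : K `^ alpha != 0 by rewrite gt_eqF.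
  move: (K `^ alpha) (k.+1%:R) (3 ^+ k) ((2 ^+ j) ^+ k) h1 h2 h3 h5 => x1 x2 x3 x5 h1 h2 h3 h5.
  by field; rewrite h1 h2 h3 h4 h5.
rewrite sumr_const card_ord.
(* After normalisation each of the J + 1 scales contributes exactly 1, and ln t <= (J + 1) ln 2 <= J
   + 1. *)
apply: (@le_trans _ _ (ln (2 ^+ J.+1))).
  by rewrite ler_ln ?posrE// exprn_gt0.
rewrite lnXn ?ltr0n// lerMn2r /=.
have -> : 2 = 1 + 1 :> R by [].
by apply: le_ln1Dx; lra.
Qed.

End haar_growth.

Lemma lower_cst_gt0 {R : realType} {n : nat} (alpha : R) : 0 < @lower_cst R n alpha.
Proof.
have c0 : 0 < (@fourier_const R n.+1 * cos 1) ^+ 2.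
  by rewrite exprn_gt0// mulr_gt0 ?fourier_const_gt0 ?cos1_gt0.
have n1 : 0 < (n.+1%:R : R) by rewrite ltr0n.
rewrite /lower_cst; apply: mulr_gt0; last by rewrite powR_gt0.
apply: mulr_gt0; last by rewrite exprn_gt0// invr_gt0 exprn_gt0.
by apply: mulr_gt0 => //; rewrite exprn_gt0 ?expR_gt0.
Qed.

Lemma sobolev_cst_gt0 {R : realType} {n : nat} (s : R) : 0 < @sobolev_cst R n s.
Proof. by rewrite !mulr_gt0 ?powR_gt0 ?exprn_gt0 ?expR_gt0. Qed.

Unset Implicit Arguments.
Set Strict Implicit.
Set Printing Implicit Defensive.

Theorem theorem2 (R : realType) (n k : nat) (alpha : R)
    (mu : probability 'M[R]_n R)
    (hn : (2 <= n)%N) (hk : (1 <= k <= n - 1)%N)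
    (halpha : k%:R / 2 <= alpha < k%:R)
    (hmu : is_haar_SO mu) :
  exists (C : R -> R) (c : R), (forall s, 0 < C s) /\ 0 < c /\
  forall r : R, 0 < r ->
  exists f : nat -> 'cV[R]_n -> R[i],
    [/\ forall N, schwartz (f N),
        forall (s : R) (N : nat), (0 < N)%N ->
          (sobolev_norm s (f N) <= (C s)%:E * (N%:R `^ s)%:E)%E /\
          ((N%:R `^ s)%:E <= (C s)%:E * sobolev_norm s (f N))%E
      & forall N : nat, pi / (2 * r) < N%:R ->
          ((growth k alpha (r * N%:R))%:E <=
           c%:E * \int[mu]_(Q in SO)
             (L2norm (eball r)
                (frac_laplacian alpha
                   (fun x => riesz_potential k alpha (f N) x Q))) ^+ 2)%E].
Proof.
case: n => [//|n] in mu hn hk hmu *.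
have n0 : (0 < n)%N by [].
move: hk; rewrite subSS subn0 => /andP[k0 kn].
have [ak ak'] := andP halpha.
have alpha0 : 0 < alpha by apply: lt_le_trans ak; rewrite divr_gt0// ltr0n.
have K0 : 0 < (n.+1%:R ^+ 2 + 1 : R) `^ alpha by rewrite powR_gt0// ltr_wpDl// sqr_ge0.
have L0 := @lower_cst_gt0 R n alpha.
pose c : R := if alpha == k%:R / 2
  then 2 * (n.+1%:R ^+ 2 + 1) `^ alpha * (k.+1%:R * 3 ^+ k) / @lower_cst R n alpha
  else (n.+1%:R ^+ 2 + 1) `^ alpha * (k.+1%:R * 6 ^+ k) / @lower_cst R n alpha.
exists (@sobolev_cst R n), c; split; first exact: sobolev_cst_gt0.
split.
  by rewrite /c; case: ifP => _; rewrite divr_gt0// !mulr_gt0// ?exprn_gt0 ?ltr0n.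
move=> r r0.
(* [rho N] is [r] for the [N] of interest; for the others it keeps the spectrum
   of the packet away from the origin. *)
pose rho (N : nat) : R := Num.max r (pi / (2 * N%:R)).
have rho0 N : 0 < rho N by rewrite lt_max r0.
have lam0 N : 0 < n.+1%:R * rho N by rewrite mulr_gt0// ltr0n.
(* The requirement is 1 / [rho N] <= N; it follows from [rho N] >= pi / (2 N) and pi >= 2, for every
   positive N and every r. *)
have lamN N : (0 < N)%N -> n.+1%:R / (n.+1%:R * rho N) <= N%:R.
  move=> N0; rewrite invfM mulrA divff ?pnatr_eq0// mul1r.
  have Np : 0 < N%:R :> R by rewrite ltr0n.
  rewrite invf_ple ?posrE// le_max; apply/orP; right.
  rewrite invfM mulrA ler_peMl ?invr_ge0 ?(ltW Np)// ler_pdivlMr// mul1r.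
  exact: pi_ge2.
exists (fun N => packet (n.+1%:R * rho N) N%:R); split.
- by move=> N; exact: schwartz_packet.
- move=> s N N0; apply: sobolev_packet; rewrite ?ltr0n//; exact: lamN.
move=> N rN.
have Np : 0 < N%:R :> R by apply: le_lt_trans rN; rewrite divr_ge0 ?pi_ge0// mulr_ge0// ltW.
have N0 : (0 < N)%N by rewrite -(ltr0n R).
have rhoE : rho N = r.
  apply/max_idPl; rewrite ler_pdivrMr ?mulr_gt0// mulrCA mulrA.
  by move: rN; rewrite ltr_pdivrMr ?mulr_gt0// => /ltW; rewrite [N%:R * _]mulrC.
(* The hypothesis says r N > pi / 2, which is at least 1. *)
have t1 : 1 <= r * N%:R.
  move: rN; rewrite ltr_pdivrMr ?mulr_gt0// => h.
  have := @pi_ge2 R; lra.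
have lb (Q : 'M[R]_n.+1) : SO Q -> ((@lower_cst R n alpha * ((r * N%:R) ^+ 2 /
    ((r * N%:R) ^+ 2 * proj2 k Q (basis_vec ord0) + 1)) `^ alpha)%:E <=
  L2norm (eball r) (frac_laplacian alpha
    (fun x => riesz_potential k alpha (packet (n.+1%:R * rho N) N%:R) x Q)) ^+ 2)%E.
  move=> SQ; rewrite [r * _]mulrC; apply: L2norm_frac_laplacian_ge => //.
  - exact: lamN.
  - by rewrite rhoE.
  - by rewrite k0 (leq_trans kn).
  - by rewrite alpha0.
  - exact: SO_orthonormal.
rewrite /growth /c; case: eqP => [a_eq|/eqP a_neq].
  exact: (haar_growth_eq n0 k0 _ hmu ak a_eq L0 t1 lb).
apply: (haar_growth_gt n0 k0 _ hmu ak _ L0 t1 lb) => //.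
by rewrite lt_neqAle eq_sym a_neq.
Qed.
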